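(* There is an algorithm $\mathtt{Decompose}(n,\mathcal{K})$ that, given an $n\times n$ binary matrix $M$ specified by a slab decomposition $\mathcal{K}$ of $M$, computes the canonical slab decomposition $\mathcal{R}$ of $M$ in $\mathcal{O}(n+|\mathcal{K}|\log\log n)$ time (in the word RAM model).
   Context: For $a\le b$ in $\mathbb{N}$, $[a,b]=\{a,\dots,b\}$. A slab $(a,b,c,e)$ of a binary matrix $M$ is a submatrix $M[[a,b],[c,e]]$ (rows $a..b$, columns $c..e$) all of whose entries are $1$. A slab decomposition of $M$ is a set of pairwise disjoint slabs such that every entry $1$ of $M$ lies in one of them. For $i\in[1,n]$, an $i$-strip is a slab $(a,b,i,i)$ such that neither $(a-1,b,i,i)$ nor $(a,b+1,i,i)$ is a slab (a row index $0$ or $n+1$ does not give a slab); $\mathtt{strips}_i$ is the set of $i$-strips and $\mathtt{strips}=\bigcup_i\mathtt{strips}_i$. Strips $(a,b,i,i)$ and $(a,b,j,j)$ (with $i\le j$) are siblings if $(a,b,k,k)\in\mathtt{strips}_k$ for every $k\in[i,j]$. This is an equivalence relation on $\mathtt{strips}$; each equivalence class, identified with its union (a slab), is a canonical slab, and the canonical slab decomposition of $M$ is the set of all canonical slabs. *)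

(* Defs.v *)
From mathcomp Require Import all_boot matrix.

Set Implicit Arguments.
Unset Strict Implicit.
Unset Printing Implicit Defensive.

(** Rows and columns are numbered from 1: entry [(i.+1, j.+1)] of the matrix
    is [M i j] with [i j : 'I_n].  The quadruple [(a, b, c, e)] stands for rows
    [a..b] and columns [c..e]. *)
Definition slab : Type := (nat * nat * nat * nat)%type.

Definition in_slab (s : slab) (x y : nat) : bool :=
  let: (a, b, c, e) := s in (a <= x <= b) && (c <= y <= e).

Definition is_slab n (M : 'M[bool]_n) (s : slab) : bool :=
  let: (a, b, c, e) := s in
  [&& 1 <= a, a <= b, b <= n, 1 <= c, c <= e, e <= n &
      [forall i : 'I_n, forall j : 'I_n, in_slab s i.+1 j.+1 ==> M i j]].

Definition disjoint_slabs (s t : slab) : Prop :=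
  forall x y, ~ (in_slab s x y /\ in_slab t x y).

(** Finite sets of slabs are duplicate-free sequences, in any order, so that
    the cardinality is [size]. *)
Definition slab_decomposition n (M : 'M[bool]_n) (K : seq slab) : Prop :=
  [/\ uniq K,
      (forall s, s \in K -> is_slab M s),
      (forall s t, s \in K -> t \in K -> s <> t -> disjoint_slabs s t)
    & (forall i j : 'I_n, M i j -> exists2 s, s \in K & in_slab s i.+1 j.+1)].

(** A strip [(a, b, i, i)] has [1 <= a], so [a.-1] is the true predecessor;
    row indices [0] and [n.+1] are rejected by [is_slab]. *)
Definition is_istrip n (M : 'M[bool]_n) (i : nat) (s : slab) : Prop :=
  exists a b, [/\ s = (a, b, i, i), is_slab M (a, b, i, i),
    ~~ is_slab M (a.-1, b, i, i) & ~~ is_slab M (a, b.+1, i, i)].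

Definition is_strip n (M : 'M[bool]_n) (s : slab) : Prop :=
  exists2 i, 1 <= i <= n & is_istrip M i s.

(** [minn]/[maxn] make the relation symmetric: the two strips are unordered. *)
Definition siblings n (M : 'M[bool]_n) (s t : slab) : Prop :=
  exists a b i j, [/\ s = (a, b, i, i), t = (a, b, j, j) &
    forall k, minn i j <= k <= maxn i j -> is_istrip M k (a, b, k, k)].

(** [r] is the union of the sibling class of some strip [s]. *)
Definition canonical_slab n (M : 'M[bool]_n) (r : slab) : Prop :=
  is_slab M r /\
  exists2 s, is_strip M s &
    forall x y, in_slab r x y <->
      exists t, [/\ is_strip M t, siblings M s t & in_slab t x y].

Definition canonical_slab_decomposition n (M : 'M[bool]_n) (R : seq slab) :
    Prop :=
  uniq R /\ forall r, r \in R <-> canonical_slab M r.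

Definition reg := nat.

Inductive binop : Set :=
  BAdd | BSub | BMul | BDiv | BMod | BAnd | BOr | BXor | BShl | BShr | BEq | BLt.

(** The last argument of a jump is an absolute position in the program. *)
Inductive instr : Set :=
| IConst (r : reg) (k : nat)
| IOp (o : binop) (r r1 r2 : reg)
| ILoad (r ra : reg)
| IStore (ra r : reg)
| IJump (l : nat)
| IJumpZ (r : reg) (l : nat).

Definition program := seq instr.

(** State of a word RAM with [w]-bit words.  Words are naturals below [2 ^ w];
    this invariant is not in the type, but [initial] requires it and [step]
    preserves it.  A program mentions finitely many registers. *)
Record state :=
  State { st_pc : nat; st_reg : reg -> nat; st_mem : nat -> nat }.

Definition upd (f : nat -> nat) (x v : nat) : nat -> nat :=
  fun y => if y == x then v else f y.

(** Results are reduced modulo [2 ^ w] by [step]; [BDiv] and [BMod] by [0]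
    return [0] and the dividend. *)
Definition eval_binop (w : nat) (o : binop) (x y : nat) : nat :=
  match o with
  | BAdd => x + y
  | BSub => x + (2 ^ w - y)
  | BMul => x * y
  | BDiv => x %/ y
  | BMod => x %% y
  | BAnd => Nat.land x y
  | BOr => Nat.lor x y
  | BXor => Nat.lxor x y
  | BShl => x * 2 ^ y
  | BShr => x %/ 2 ^ y
  | BEq => x == y
  | BLt => x < y
  end.

(** One unit-cost step; [None] when the machine has halted, that is, when
    [st_pc] has left the program.  Since registers hold words, only the memory cells
    at addresses below [2 ^ w] are reachable. *)
Definition step (w : nat) (P : program) (s : state) : option state :=
  let: State p R m := s in
  match onth P p with
  | None => None
  | Some (IConst r k) => Some (State p.+1 (upd R r (k %% 2 ^ w)) m)
  | Some (IOp o r r1 r2) =>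
      Some (State p.+1 (upd R r (eval_binop w o (R r1) (R r2) %% 2 ^ w)) m)
  | Some (ILoad r ra) => Some (State p.+1 (upd R r (m (R ra))) m)
  | Some (IStore ra r) => Some (State p.+1 R (upd m (R ra) (R r)))
  | Some (IJump l) => Some (State l R m)
  | Some (IJumpZ r l) => Some (State (if R r == 0 then l else p.+1) R m)
  end.

Fixpoint exec (w : nat) (P : program) (t : nat) (s : state) : option state :=
  if t is t'.+1 then obind (exec w P t') (step w P s) else Some s.

Definition halts_in (w : nat) (P : program) (t : nat) (s s' : state) : Prop :=
  exec w P t s = Some s' /\ step w P s' = None.

Definition stores (m : nat -> nat) (l : seq nat) : Prop :=
  forall k, k < size l -> m k = nth 0 l k.

Definition encode_slabs (S : seq slab) : seq nat :=
  flatten [seq (let: (a, b, c, e) := s in [:: a; b; c; e]) | s <- S].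

Definition encode_input (n : nat) (K : seq slab) : seq nat :=
  n :: size K :: encode_slabs K.

Definition encode_output (R : seq slab) : seq nat :=
  size R :: encode_slabs R.

(** The input is written from address [0] on; registers and all other cells
    initially contain arbitrary words. *)
Definition initial (w : nat) (input : seq nat) (s : state) : Prop :=
  [/\ st_pc s = 0, stores (st_mem s) input,
      forall r, st_reg s r < 2 ^ w & forall x, st_mem s x < 2 ^ w].

(** The integer part of [log2 (log2 n)] for [n >= 2], and [0] for [n <= 1].  In
    a bound [O(n + k * log log n)] with [1 <= n] and [k <= n ^ 2] the rounding
    is immaterial: it costs a constant factor for [n >= 4], and for [n <= 3]
    the summand [n] dominates. *)
Definition loglog (n : nat) : nat := trunc_log 2 (trunc_log 2 n).

(* Main.v *)
(** The columns are swept from left to right, maintaining the strips of the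
    current column.  A slab of [K] changes the column only where it begins and
    just after it ends, so that over the whole sweep [O(|K|)] rows are touched.  A
    strip appears or disappears only if it meets a touched row, the end of a new
    strip is a touched row or the end of an old strip that meets one, and a
    canonical slab is a maximal run of columns in which the same strip persists.
    The starts of the strips of the current column are kept in a van Emde Boas
    tree, where one predecessor query, in time [O(log log n)], finds the strip
    through a touched row.  The algorithm is written in a small imperative language
    that is compiled to the word RAM; memory polynomial in [n] is affordable
    because it is never initialised. *)

Require Import Defs.
From mathcomp Require Import all_boot matrix zify.

Set Implicit Arguments.
Unset Strict Implicit.
Unset Printing Implicit Defensive.

(** * An imperative language and its compiler *)

(** The programs rely on tables that read as zero although memory starts out arbitrary. This is
    simulated: a counter bounds the validated cells and the clock of the source language bounds the
    counter, so that one number [bd] limits time, indices and values, and no sum or product of the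
    source language wraps around. The language has no procedures, so the tree is run by loops. Nodes
    carry no pointers: the number of a node encodes its path from the root, so a query descends in
    one loop and assembles its answer in a second one that climbs back. The invariant of an update
    says which subtree still shows the old set. Keys lie below [pw k = 2 ^ (2 ^ k)], the least
    number of this form that is at least [n + 2]; universes are exact squares down to the leaves,
    and [k] is at most [loglog n + 2]. Bounds on memory rest on the crude estimate that distinct
    quadruples of numbers up to [n] are at most [n.+1 ^ 4] in number; this is where words of
    [23 * (trunc_log 2 n).+1] bits come from. *)

Inductive bop : Set := Add | Sub | Mul | Div | Mod | Eq | Lt.

Inductive expr : Set :=
| EC (k : nat)
| EV (r : nat)
| EB (o : bop) (e1 e2 : expr)
| EL (a : nat) (e : expr).

Inductive cmd : Set :=
| Skip
| Asg (r : nat) (e : expr)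
| Sto (a : nat) (e1 e2 : expr)
| Seq (c1 c2 : cmd)
| If (e : expr) (c1 c2 : cmd)
| While (e : expr) (c : cmd).

(** Array [0] is the memory of the machine below a fixed address; arrays [1] to
    [15] are initially zero.  [tm] is a clock counting assignments and tests. *)
Record st := St { vr : nat -> nat; ar : nat -> nat -> nat; tm : nat }.

Definition bopv (o : bop) (x y : nat) : nat :=
  match o with
  | Add => x + y
  | Sub => x - y
  | Mul => x * y
  | Div => x %/ y
  | Mod => x %% y
  | Eq => x == y
  | Lt => x < y
  end.

Fixpoint eval (v : nat -> nat) (m : nat -> nat -> nat) (e : expr) : nat :=
  match e with
  | EC k => k
  | EV r => v r
  | EB o e1 e2 => bopv o (eval v m e1) (eval v m e2)
  | EL a e => m a (eval v m e)
  end.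

(** [Nat.eqb] and not [==], so that [cbv] decides it on numerals. *)
Definition rupd (f : nat -> nat) (x v : nat) : nat -> nat :=
  fun y => if Nat.eqb y x then v else f y.

Definition aupd (f : nat -> nat -> nat) (a i v : nat) : nat -> nat -> nat :=
  fun b j => if Nat.eqb b a then (if j == i then v else f b j) else f b j.

Section Semantics.
Variables bd lim : nat.

(** Only sums and products can exceed both operands; every other operation returns at most its first
    operand or a truth value. *)
Definition bop_safe (o : bop) (x y : nat) : Prop :=
  match o with
  | Add => x + y < bd
  | Mul => x * y < bd
  | _ => True
  end.

Definition idx_safe (a i : nat) : Prop :=
  if a is 0 then i < lim else a < 16 /\ i < bd.

Fixpoint safe (v : nat -> nat) (m : nat -> nat -> nat) (e : expr) : Prop :=
  match e with
  | EC k => k < bd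
  | EV r => True
  | EB o e1 e2 =>
      [/\ safe v m e1, safe v m e2 & bop_safe o (eval v m e1) (eval v m e2)]
  | EL a e => safe v m e /\ idx_safe a (eval v m e)
  end.

Inductive run : st -> cmd -> st -> Prop :=
| run_skip s : run s Skip s
| run_asg v m t r e : safe v m e ->
    run (St v m t) (Asg r e) (St (rupd v r (eval v m e)) m t.+1)
| run_sto v m t a e1 e2 : safe v m e1 -> safe v m e2 ->
    idx_safe a (eval v m e1) ->
    run (St v m t) (Sto a e1 e2)
        (St v (aupd m a (eval v m e1) (eval v m e2)) t.+1)
| run_seq s1 s2 s3 c1 c2 : run s1 c1 s2 -> run s2 c2 s3 ->
    run s1 (Seq c1 c2) s3
| run_if v m t e c1 c2 s' : safe v m e ->
    run (St v m t.+1) (if eval v m e == 0 then c2 else c1) s' ->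
    run (St v m t) (If e c1 c2) s'
| run_while0 v m t e c : safe v m e -> eval v m e = 0 ->
    run (St v m t) (While e c) (St v m t.+1)
| run_while1 v m t e c s1 s2 : safe v m e -> eval v m e <> 0 ->
    run (St v m t.+1) c s1 -> run s1 (While e c) s2 ->
    run (St v m t) (While e c) s2.

End Semantics.

Lemma run_tm bd lim s c s' : run bd lim s c s' -> tm s <= tm s'.
Proof.
by elim=> //= *; lia.
Qed.

(** Compilation: machine register 1 holds the base [off] of the virtual memory,
    3 the number of validated cells, 5 to 15 are scratch, [tmp d] for [d >= 8]
    is the expression stack, and the even registers are the variables. *)
Definition usr (r : nat) : reg := r.*2.
Definition tmp (d : nat) : reg := d.*2.+1.

(** The address [off + 3 * (16 * x + a)] of the value of an entry is left in register 5. *)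
Definition addr_code (a : nat) (x : reg) : program :=
  [:: IConst 5 16; IOp BMul 5 x 5; IConst 7 a; IOp BAdd 5 5 7;
      IConst 7 3; IOp BMul 5 5 7; IOp BAdd 5 5 1].

(** Validity is left as 0 or 1 in register 9 and used as a factor. Without branches the code of an
    expression is straight-line, so that a fold ([xblock]) executes it. *)
Definition valid_code : program :=
  [:: IConst 7 1; IOp BAdd 7 5 7; ILoad 7 7; IOp BLt 9 7 3;
      IConst 11 3; IOp BMul 11 7 11; IOp BAdd 11 11 1; IConst 13 2;
      IOp BAdd 11 11 13; ILoad 11 11; IOp BEq 11 11 5; IOp BMul 9 9 11].

Definition vload_code (a : nat) (x : reg) : program :=
  addr_code a x ++ valid_code ++ [:: ILoad 5 5; IOp BMul x 5 9].

(** A valid cell keeps its stack index and its back pointer is rewritten unchanged; a fresh cell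
    takes the index [cnt]. The same instructions serve both cases, selected by the factors in
    registers 9 and 11. *)
Definition vstore_code (a : nat) (x y : reg) : program :=
  addr_code a x ++ valid_code ++
  [:: IOp BMul 7 7 9; IConst 11 1; IOp BSub 11 11 9; IOp BMul 13 11 3;
      IOp BAdd 7 7 13; IStore 5 y; IConst 13 1; IOp BAdd 13 13 5;
      IStore 13 7; IConst 13 3; IOp BMul 13 7 13; IOp BAdd 13 13 1;
      IConst 15 2; IOp BAdd 13 13 15; IStore 13 5; IOp BAdd 3 3 11].

(** Machine subtraction wraps around, so truncated subtraction multiplies the difference by the test
    [y < x]. *)
Definition bop_code (o : bop) (x y : reg) : program :=
  match o with
  | Add => [:: IOp BAdd x x y]
  | Sub => [:: IOp BSub 5 x y; IOp BLt 7 y x; IOp BMul x 5 7]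
  | Mul => [:: IOp BMul x x y]
  | Div => [:: IOp BDiv x x y]
  | Mod => [:: IOp BMod x x y]
  | Eq => [:: IOp BEq x x y]
  | Lt => [:: IOp BLt x x y]
  end.

(** The machine has no move instruction: a register is copied by adding 0 to it. *)
Fixpoint ecode (d : nat) (e : expr) : program :=
  match e with
  | EC k => [:: IConst (tmp d) k]
  | EV r => [:: IConst (tmp d) 0; IOp BAdd (tmp d) (usr r) (tmp d)]
  | EB o e1 e2 => ecode d e1 ++ ecode d.+1 e2 ++ bop_code o (tmp d) (tmp d.+1)
  | EL a e => ecode d e ++
      (if a is 0 then [:: ILoad (tmp d) (tmp d)] else vload_code a (tmp d))
  end.

(** Jumps are absolute, hence the parameter [p], the position of the first instruction. *)
Fixpoint ccode (p : nat) (c : cmd) : program :=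
  match c with
  | Skip => [::]
  | Asg r e =>
      ecode 8 e ++ [:: IConst 5 0; IOp BAdd (usr r) (tmp 8) 5]
  | Sto a e1 e2 => ecode 8 e1 ++ ecode 9 e2 ++
      (if a is 0 then [:: IStore (tmp 8) (tmp 9)]
       else vstore_code a (tmp 8) (tmp 9))
  | Seq c1 c2 =>
      let l1 := ccode p c1 in l1 ++ ccode (p + size l1) c2
  | If e c1 c2 =>
      let l0 := ecode 8 e in
      let l1 := ccode (p + size l0).+1 c1 in
      let q := ((p + size l0).+1 + size l1).+1 in
      let l2 := ccode q c2 in
      l0 ++ IJumpZ (tmp 8) q :: l1 ++ IJump (q + size l2) :: l2
  | While e c =>
      let l0 := ecode 8 e in
      let l1 := ccode (p + size l0).+1 c in
      l0 ++ IJumpZ (tmp 8) ((p + size l0).+1 + size l1).+1 :: l1 ++ [:: IJump p]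
  end.

(** * Execution of straight-line machine code *)

Section Blocks.
Variable w : nat.

Definition mstate := ((nat -> nat) * (nat -> nat))%type.

Definition xinstr (s : mstate) (i : instr) : mstate :=
  let: (R, m) := s in
  match i with
  | IConst r k => (upd R r (k %% 2 ^ w), m)
  | IOp o r r1 r2 => (upd R r (eval_binop w o (R r1) (R r2) %% 2 ^ w), m)
  | ILoad r ra => (upd R r (m (R ra)), m)
  | IStore ra r => (R, upd m (R ra) (R r))
  | _ => s
  end.

Definition xblock (s : mstate) (l : program) : mstate := foldl xinstr s l.

Definition straight (i : instr) : bool :=
  match i with IJump _ | IJumpZ _ _ => false | _ => true end.

Definition target (i : instr) : seq nat :=
  match i with
  | IConst r _ | IOp _ r _ _ | ILoad r _ => [:: r]
  | _ => [::]
  end.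

Definition targets (l : program) : seq nat := flatten (map target l).

Definition words (s : mstate) : Prop :=
  (forall r, s.1 r < 2 ^ w) /\ (forall x, s.2 x < 2 ^ w).

Lemma xblock_cat s l1 l2 : xblock s (l1 ++ l2) = xblock (xblock s l1) l2.
Proof. exact: foldl_cat. Qed.

Lemma words_xinstr s i : words s -> words (xinstr s i).
Proof.
case: s => R m [/= hR hm]; case: i => [r k|o r r1 r2|r ra|ra r|l|r l] //=;
  split=> //= x; rewrite /upd; case: ifP => // _; by rewrite ?ltn_mod ?expn_gt0.
Qed.

Lemma words_xblock s l : words s -> words (xblock s l).
Proof. by elim: l s => //= i l IH s hs; apply/IH/words_xinstr. Qed.

Lemma xblock_frame s l r : r \notin targets l -> (xblock s l).1 r = s.1 r.
Proof.
elim: l s => //= i l IH s; rewrite /targets /= mem_cat negb_or => /andP[h1 h2].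
rewrite IH //; case: s => R m.
by case: i h1 => [r' k|o r' r1 r2|r' ra|ra r'|l'|r' l'] //=;
  rewrite inE /upd => /negbTE ->.
Qed.

Lemma onth_cat_size (T : Type) (pre : seq T) i post :
  onth (pre ++ i :: post) (size pre) = Some i.
Proof. by elim: pre. Qed.

Lemma exec_block pre l post s : all straight l ->
  exec w (pre ++ l ++ post) (size l) (State (size pre) s.1 s.2) =
  Some (State (size pre + size l) (xblock s l).1 (xblock s l).2).
Proof.
elim: l pre s => [|i l IH] pre s /=; first by rewrite addn0.
case/andP=> hi hl; have := IH (rcons pre i) (xinstr s i) hl.
rewrite size_rcons cat_rcons addSnnS => E.
rewrite onth_cat_size.
by case: s E => R m; case: i hi => [r' k|o r' r1 r2|r' ra|ra r'|l'|r' l'].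
Qed.

Lemma exec_add P t1 t2 s :
  exec w P (t1 + t2) s = obind (exec w P t2) (exec w P t1 s).
Proof.
elim: t1 s => //= t IH s; case: (Defs.step w P s) => //= a; exact: IH.
Qed.

End Blocks.

(** The arrays live in uninitialised memory (Briggs and Torczon): entry [x] of
    array [a] is the cell [v = 16 * x + a], with its value at [off + 3 * v], and it
    counts as zero unless its index at [off + 3 * v + 1] into the stack at
    [off + 3 * j + 2] is below [cnt] and the stack points back to it. *)
Definition vvalid (off cnt : nat) (m : nat -> nat) (v : nat) : bool :=
  let j := m (off + 3 * v + 1) in
  (j < cnt) && (m (off + 3 * j + 2) == off + 3 * v).

(** * Correctness of the compiler *)

Section Simulation.
Variables w bd off : nat.
(** The cells [v < 16 * bd] take three words each, whence [48 * bd] words above [off]; 51 leaves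
    room for the small constants of the code. *)
Hypothesis bd_le : off + 48 * bd + 51 <= 2 ^ w.

Definition memrel (cnt : nat) (m : nat -> nat) (A : nat -> nat -> nat) : Prop :=
  (forall x, x < off -> m x = A 0 x) /\
  (forall a x, a.+1 < 16 -> x < bd -> A a.+1 x =
     if vvalid off cnt m (16 * x + a.+1) then m (off + 3 * (16 * x + a.+1))
     else 0).

Definition envrel (v : nat -> nat) (A : nat -> nat -> nat) (s : mstate) : Prop :=
  [/\ forall r, s.1 (usr r) = v r, s.1 1 = off & memrel (s.1 3) s.2 A].

Lemma modw x : x <= off + 48 * bd + 50 -> x %% 2 ^ w = x.
Proof. by move=> h; rewrite modn_small //; lia. Qed.

Lemma addr_ok a x s : a < 16 -> x != 5 -> s.1 x < bd -> s.1 1 = off ->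
  let s' := xblock w s (addr_code a x) in
  s'.1 5 = off + 3 * (16 * s.1 x + a) /\ s'.2 = s.2.
Proof.
case: s => R m /= ha hx hb h1.
rewrite /= /upd /= (negbTE hx) h1; split=> //.
rewrite !(modw (x := 16), modw (x := 3), modw (x := a)) //; try lia.
by rewrite (modw (x := R x * 16)) ?(modw (x := R x * 16 + a)) ?modw; lia.
Qed.

Lemma valid_ok v s : s.1 5 = off + 3 * v -> v < 16 * bd -> s.1 1 = off ->
  s.1 3 <= bd ->
  let s' := xblock w s valid_code in
  [/\ s'.1 5 = off + 3 * v, s'.1 7 = s.2 (off + 3 * v + 1),
      s'.1 9 = vvalid off (s.1 3) s.2 v & s'.2 = s.2].
Proof.
case: s => R m /= h5 hv h1 h3.
rewrite /= /upd /= h5 h1.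
rewrite !(modw (x := 1), modw (x := 3), modw (x := 2)) //; try lia.
rewrite (modw (x := off + 3 * v + 1)); last by lia.
split=> //; rewrite /vvalid.
(* If [j] is not below [cnt], the address formed from it may wrap and the loaded word is arbitrary,
   but the first factor is 0. *)
set j := m _; case: (ltnP j (R 3)) => hj /=; last first.
  by rewrite (modw (x := 0)) // ?mul0n ?mod0n.
rewrite (modw (x := 1)) ?mul1n; last by lia.
 rewrite (modw (x := j * 3)); last by lia.
rewrite (modw (x := j * 3 + off)) ?(modw (x := j * 3 + off + 2)); try lia.
rewrite (_ : j * 3 + off + 2 = off + 3 * j + 2); last by lia.
by case: eqP => _ /=; rewrite !modw; lia.
Qed.

Lemma vload_ok a d s A : a.+1 < 16 -> 8 <= d -> s.1 (tmp d) < bd ->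
  s.1 1 = off -> s.1 3 <= bd -> words w s -> memrel (s.1 3) s.2 A ->
  let s' := xblock w s (vload_code a.+1 (tmp d)) in
  s'.1 (tmp d) = A a.+1 (s.1 (tmp d)) /\ s'.2 = s.2.
Proof.
move=> ha hd hx h1 h3 hw [_ hm]; rewrite /vload_code !xblock_cat.
have hx5 : tmp d != 5 by rewrite /tmp; lia.
have [] := addr_ok ha hx5 hx h1.
set s1 := xblock w s _ => e5 em.
have f1 : s1.1 1 = off by rewrite xblock_frame.
have f3 : s1.1 3 = s.1 3 by rewrite xblock_frame.
have [||||] := @valid_ok (16 * s.1 (tmp d) + a.+1) s1 => //; try lia.
set s2 := xblock w s1 _ => g5 g7 g9 gm.
have hw2 : words w s2 by do 2 apply: words_xblock.
move: s2 g5 g7 g9 gm hw2 => [R m] /= g5 g7 g9 gm [_ /= hmw].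
rewrite /upd /= eqxx hm // g5 g9 f3 gm em; split=> //.
rewrite -em -gm; case: ifP => _ /=; rewrite ?muln0 ?muln1 modn_small //; lia.
Qed.

Lemma memrel_store cnt m A a i v cnt' m' : let c := 16 * i + a.+1 in
  a.+1 < 16 -> i < bd -> memrel cnt m A ->
  let j := if vvalid off cnt m c then m (off + 3 * c + 1) else cnt in
  cnt' = (if vvalid off cnt m c then cnt else cnt.+1) ->
  m' = upd (upd (upd m (off + 3 * c) v) (off + 3 * c + 1) j)
           (off + 3 * j + 2) (off + 3 * c) ->
  memrel cnt' m' (aupd A a.+1 i v).
Proof.
move=> c ha hi [h0 hA] j ecnt em; split=> [x hx|b x hb hx].
  by rewrite em /upd /aupd /= -h0 //; do 3 (case: eqP => [?|_]; first by lia).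
have hj : j < cnt' by rewrite /j ecnt; rewrite /vvalid; case: ifP => [/andP[]|].
rewrite /aupd /=.
have sv d : m' (off + 3 * d) = if d == c then v else m (off + 3 * d).
  rewrite em /upd; case: eqP => [?|_]; first by lia.
  case: eqP => [?|_]; first by lia.
  by case: (d =P c) => [->|?]; [rewrite eqxx|case: eqP => // ?; lia].
have sb d : m' (off + 3 * d + 1) = if d == c then j else m (off + 3 * d + 1).
  rewrite em /upd; case: eqP => [?|_]; first by lia.
  case: (d =P c) => [->|?]; first by rewrite eqxx.
  by case: eqP => [?|_]; [lia | case: eqP => // ?; lia].
have ss d : m' (off + 3 * d + 2) =
    if d == j then off + 3 * c else m (off + 3 * d + 2).
  rewrite em /upd; case: (d =P j) => [->|?]; first by rewrite eqxx.
  by do 3 (case: eqP => [?|_]; first by lia).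
have vc : vvalid off cnt' m' c by rewrite /vvalid sb !eqxx ss eqxx hj /=.
case: (16 * x + b.+1 =P c) => [ec|nc].
  have -> : Nat.eqb b a by apply/PeanoNat.Nat.eqb_eq; lia.
  have -> : x == i by lia.
  by rewrite ec vc sv eqxx.
have -> : (if Nat.eqb b a then if x == i then v else A b.+1 x else A b.+1 x)
    = A b.+1 x.
  case: (PeanoNat.Nat.eqb_spec b a) => // eb; case: eqP => // ex.
  by case: nc; rewrite /c eb ex.
move/eqP/negbTE: nc => nc.
rewrite hA // sv nc; congr (if _ then _ else _).
(* Any other cell keeps its validity. The stack entry just written matters to it only if its index
   equals [j]; but then it was invalid before, since entry [j] either pointed back to [c] or was not
   below [cnt]. *)
rewrite /vvalid sb nc; set k := m _.
rewrite ss; case: (k =P j) => [ek|nk]; last first.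
  rewrite ecnt; case: ifP => // hv; congr (_ && _).
  by move: nk; rewrite /j hv; lia.
rewrite ek; have -> : (off + 3 * c == off + 3 * (16 * x + b.+1)) = false by lia.
rewrite andbF; apply/negbTE; rewrite /j; case: ifP => hv; last by rewrite ltnn.
apply/negP=> /andP[_]; move: (hv) => /andP[_ /eqP ->]; lia.
Qed.

Lemma vstore_ok a s A i v : a.+1 < 16 ->
  s.1 (tmp 8) = i -> s.1 (tmp 9) = v -> i < bd ->
  s.1 1 = off -> s.1 3 < bd -> words w s -> memrel (s.1 3) s.2 A ->
  let s' := xblock w s (vstore_code a.+1 (tmp 8) (tmp 9)) in
  memrel (s'.1 3) s'.2 (aupd A a.+1 i v) /\ s'.1 3 <= (s.1 3).+1.
Proof.
move=> ha hi hv hib h1 h3 hw hm; rewrite /vstore_code !xblock_cat.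
have [|//|] := @addr_ok a.+1 (tmp 8) s ha _ _ h1; first by [].
  by rewrite hi.
set s1 := xblock w s _; rewrite hi => e5 em.
have f1 : s1.1 1 = off by rewrite xblock_frame.
have f3 : s1.1 3 = s.1 3 by rewrite xblock_frame.
have fy : s1.1 19 = v by rewrite xblock_frame.
have hw1 : words w s1 by apply: words_xblock.
have [||||] := @valid_ok (16 * i + a.+1) s1 => //; try lia.
set s2 := xblock w s1 _ => g5 g7 g9 gm.
have k1 : s2.1 1 = off by rewrite xblock_frame.
have k3 : s2.1 3 = s.1 3 by rewrite xblock_frame // f3.
have ky : s2.1 19 = v by rewrite xblock_frame // fy.
have hw2 : words w s2 by apply: words_xblock.
rewrite f3 em in g9; rewrite em in g7 gm.
have [hw2r hw2m] := hw2.
clear hw2; clearbody s2; clear e5 em f1 f3 fy hw1; move: s2 g5 g7 g9 gm k1 k3 ky hw2r hw2m {s1}.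
move=> [R m] /= g5 g7 g9 gm k1 k3 ky hwr hwm; subst m.
set V := vvalid _ _ _ _ in g9.
set j := if V then s.2 (off + 3 * (16 * i + a.+1) + 1) else s.1 3.
have hj : j <= s.1 3.
  by rewrite /j /V /vvalid; case: ifP => [/andP[/ltnW]|].
rewrite /upd /= g9 ky k1 k3 g5 g7.
rewrite !(modw (x := 1), modw (x := 3), modw (x := 2)) //; try lia.
have -> : (1 + (2 ^ w - V)) %% 2 ^ w = ~~ V.
  case: (V) => /=; last by rewrite subn0 addnC modnDl modw; lia.
  by rewrite subnKC ?modnn; lia.
have -> : (s.2 (off + 3 * (16 * i + a.+1) + 1) * V %% 2 ^ w
    + ~~ V * s.1 3 %% 2 ^ w) %% 2 ^ w = j.
  rewrite /j; case: (V); rewrite /= ?muln1 ?mul0n ?muln0 ?mul1n mod0n ?addn0.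
    by rewrite modn_mod modn_small.
  by rewrite add0n modn_mod modw; lia.
rewrite (modw (x := j * 3)); last by lia.
rewrite (modw (x := j * 3 + off)); last by lia.
rewrite (modw (x := j * 3 + off + 2)); last by lia.
rewrite (modw (x := 1 + _)); last by lia.
have -> : (s.1 3 + ~~ V) %% 2 ^ w = if V then s.1 3 else (s.1 3).+1.
  by case: (V) => /=; rewrite ?addn0 ?addn1 modw; lia.
split; last by case: ifP.
apply: (memrel_store (cnt := s.1 3) (m := s.2)) => //.
rewrite -/V -/j /upd (addnC 1) (mulnC j) (addnC (3 * j)) //.
Qed.

Lemma xblock_frame_all l s r (p : pred nat) :
  all p (targets l) -> ~~ p r -> (xblock w s l).1 r = s.1 r.
Proof.
move=> /allP h hr; apply: xblock_frame; apply/negP=> /h.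
by apply/negP.
Qed.

(** The scratch registers and the stack from depth [d] on. Variables, registers 1 and 3 and the
    lower part of the stack lie outside, so evaluating a second operand preserves the first. *)
Definition etarget (d r : nat) : bool :=
  odd r && ((5 <= r) && (r <= 15) || (tmp d <= r)).

Lemma targets_cat l1 l2 : targets (l1 ++ l2) = targets l1 ++ targets l2.
Proof. by rewrite /targets map_cat flatten_cat. Qed.

Lemma targets_ecode d e : 8 <= d -> all (etarget d) (targets (ecode d e)).
Proof.
elim: e d => [k|r|o e1 IH1 e2 IH2|a e IH] d hd.
- by rewrite /= andbT /etarget /tmp; lia.
- by rewrite /= /etarget /tmp; lia.
- rewrite /= !targets_cat !all_cat IH1 //=; apply/andP; split.
    apply: sub_all (IH2 d.+1 _); last by lia.
    by move=> r; rewrite /etarget /tmp; lia.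
  by case: o => /=; rewrite /etarget /tmp; lia.
- rewrite /= !targets_cat all_cat IH //=.
  by case: a => [|a] /=; rewrite /etarget /tmp; lia.
Qed.

Lemma ecode_straight d e : all straight (ecode d e).
Proof.
elim: e d => //= [o e1 IH1 e2 IH2|a e IH] d; rewrite !all_cat ?IH1 ?IH2 ?IH /=.
  by case: o.
by case: a.
Qed.

Lemma ecode_ok e d s v A : words w s -> envrel v A s -> s.1 3 <= bd ->
  8 <= d -> safe bd off v A e ->
  let s' := xblock w s (ecode d e) in
  s'.1 (tmp d) = eval v A e /\ s'.2 = s.2.
Proof.
elim: e d s => [k|r|o e1 IH1 e2 IH2|a e IH] d s hw hE h3 hd /=.
- case: s {hw hE h3} => R m hk /=; rewrite /upd eqxx modw //; lia.
- case: hE => hr _ _ _; case: s hw h3 hr => R m [/= hR hm] _ hr.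
  rewrite /upd eqxx /=; have -> : (usr r == tmp d) = false.
    by rewrite /usr /tmp; lia.
  by rewrite mod0n addn0 hr modn_small // -hr.
- move=> [s1 s2 sb]; rewrite !xblock_cat.
  have [e1v e1m] := IH1 d s hw hE h3 hd s1.
  set t1 := xblock w s _ in e1v e1m *.
  have hw1 : words w t1 by apply: words_xblock.
  have fr r : ~~ etarget d r -> t1.1 r = s.1 r.
    by apply/xblock_frame_all/targets_ecode.
  have hE1 : envrel v A t1.
    case: hE => a1 a2 a3; split.
    + by move=> r; rewrite fr // /etarget /usr; lia.
    + by rewrite fr // /etarget /tmp; lia.
    + by rewrite e1m fr // /etarget /tmp; lia.
  have [|||e2v e2m] := IH2 d.+1 t1 hw1 hE1 => //; try lia.
    by rewrite fr // /etarget /tmp; lia.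
  set t2 := xblock w t1 _ in e2v e2m *.
  have hw2 : words w t2 by apply: words_xblock.
  have e1v2 : t2.1 (tmp d) = eval v A e1.
    rewrite -e1v; apply: (@xblock_frame_all (ecode d.+1 e2) t1 (tmp d) (etarget d.+1)).
      by apply: targets_ecode; lia.
    by rewrite /etarget /tmp; lia.
  have b1 := hw2.1 (tmp d); have b2 := hw2.1 (tmp d.+1).
  rewrite e1v2 in b1; rewrite e2v in b2.
  rewrite -e1m -e2m; move: t2 e1v2 e2v {e2m hw2} => [R m] /= r1 r2.
  have n1 : (tmp d == tmp d.+1) = false by rewrite /tmp; lia.
  have n2 : (tmp d.+1 == tmp d) = false by rewrite /tmp; lia.
  have n3 : (tmp d.+1 == 5) = false by rewrite /tmp; lia.
  have n4 : (tmp d == 5) = false by rewrite /tmp; lia.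
  case: o sb => /= sb; rewrite /upd ?n1 ?n2 ?n3 ?n4 eqxx /= r1 r2; split=> //.
  + by rewrite modw //; lia.
  + case: ltnP => h; last first.
      by rewrite mod0n muln0 mod0n; apply/esym/eqP; rewrite subn_eq0.
    rewrite (modw (x := 1)); last by lia.
    rewrite muln1 modn_mod (_ : _ + _ = eval v A e1 - eval v A e2 + 2 ^ w).
      by rewrite modnDr modn_small; lia.
    by lia.
  + by rewrite modw //; lia.
  + by rewrite modn_small //; apply: leq_ltn_trans b1; apply: leq_div.
  + by rewrite modn_small //; apply: leq_ltn_trans b1; apply: leq_mod.
  + by rewrite modw //; case: eqP; lia.
  + by rewrite modw //; case: ltnP; lia.
- move=> [se si]; rewrite xblock_cat.
  have [ev em] := IH d s hw hE h3 hd se.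
  set t1 := xblock w s _ in ev em *.
  have hw1 : words w t1 by apply: words_xblock.
  have fr r : ~~ etarget d r -> t1.1 r = s.1 r.
    by apply/xblock_frame_all/targets_ecode.
  case: hE => a1 a2 [m0 mA].
  case: a si => [|a] si.
    move: t1 ev em {hw1 fr} => [R m] /= -> em.
    by rewrite /upd eqxx em m0.
  case: si => ha hi.
  have q1 : t1.1 1 = off by rewrite fr // /etarget /tmp; lia.
  have q3 : t1.1 3 = s.1 3 by rewrite fr // /etarget /tmp; lia.
  have hE2 : memrel (t1.1 3) t1.2 A by rewrite em q3.
  have hx : t1.1 (tmp d) < bd by rewrite ev.
  have hc : t1.1 3 <= bd by rewrite q3.
  by have [-> ->] := vload_ok ha hd hx q1 hc hw1 hE2; rewrite ev.
Qed.

(** A store validates at most one cell and costs one tick; hence the clock bounds [cnt], and with it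
    the height of the stack. *)
Definition rel (o : st) (s : mstate) : Prop :=
  [/\ envrel (vr o) (ar o) s, s.1 3 <= tm o & words w s].

Lemma rel_frame (o : st) s s' d l : rel o s -> 8 <= d ->
  s' = xblock w s l -> all (etarget d) (targets l) -> s'.2 = s.2 ->
  rel o s'.
Proof.
move=> [[h1 h2 h3] h4 h5] hd -> ht hm; split.
- split=> [r||].
  + by rewrite (@xblock_frame_all _ _ _ (etarget d)) // /etarget /usr; lia.
  + by rewrite (@xblock_frame_all _ _ _ (etarget d)) // /etarget /tmp; lia.
  + rewrite hm (@xblock_frame_all _ _ _ (etarget d)) // /etarget /tmp; lia.
- by rewrite (@xblock_frame_all _ _ _ (etarget d)) // /etarget /tmp; lia.
- exact: words_xblock.
Qed.

Lemma ecode_rel e d o s : rel o s -> tm o <= bd -> 8 <= d ->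
  safe bd off (vr o) (ar o) e ->
  let s' := xblock w s (ecode d e) in
  [/\ s'.1 (tmp d) = eval (vr o) (ar o) e, s'.2 = s.2 & rel o s'].
Proof.
move=> hr ht hd hs /=; have [hE h3 hw] := hr.
have [ev em] := ecode_ok hw hE (leq_trans h3 ht) hd hs.
by split=> //; apply: (rel_frame hr hd erefl _ em); apply: targets_ecode.
Qed.

Lemma rel_tick v m t s : rel (St v m t) s -> rel (St v m t.+1) s.
Proof. by case=> /= h1 h2 h3; split=> //=; lia. Qed.

Lemma exec_code pre l post s : all straight l ->
  exec w (pre ++ l ++ post) (size l) (State (size pre) s.1 s.2) =
  Some (State (size (pre ++ l)) (xblock w s l).1 (xblock w s l).2).
Proof. by move=> hl; rewrite exec_block // size_cat. Qed.

Lemma step_jumpz pre r q post s :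
  exec w (pre ++ IJumpZ r q :: post) 1 (State (size pre) s.1 s.2) =
  Some (State (if s.1 r == 0 then q else (size pre).+1) s.1 s.2).
Proof. by rewrite /= onth_cat_size. Qed.

Lemma step_jump pre q post s :
  exec w (pre ++ IJump q :: post) 1 (State (size pre) s.1 s.2) =
  Some (State q s.1 s.2).
Proof. by rewrite /= onth_cat_size. Qed.

Lemma exec_trans P t1 t2 s1 s2 s3 : exec w P t1 s1 = Some s2 ->
  exec w P t2 s2 = s3 -> exec w P (t1 + t2) s1 = s3.
Proof. by rewrite exec_add => -> /=. Qed.

Lemma asg_ok v m t r e s : rel (St v m t) s -> t.+1 <= bd ->
  safe bd off v m e ->
  rel (St (rupd v r (eval v m e)) m t.+1)
      (xblock w s (ecode 8 e ++ [:: IConst 5 0; IOp BAdd (usr r) (tmp 8) 5])).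
Proof.
move=> hr ht hs; rewrite xblock_cat.
have ht' : tm (St v m t) <= bd by rewrite /=; lia.
have [ev em [[h1 h2 h3] h4 h5]] := ecode_rel (d := 8) hr ht' isT hs.
set s1 := xblock w s _ in ev em h1 h2 h3 h4 h5 *.
have hw : words w (xblock w s1 [:: IConst 5 0; IOp BAdd (usr r) (tmp 8) 5]).
  exact: words_xblock.
split=> //; last first.
  rewrite xblock_frame /=; last by rewrite /usr !inE; lia.
  exact: leq_trans h4 _.
split=> [r'||].
- case: h5 => hwr _; have := hwr (tmp 8); rewrite ev => hv.
  move: s1 ev h1 {h2 h3 h4 em hw hwr} => [R M] /= ev h1.
  rewrite /upd /= mod0n addn0 ev modn_small // /rupd.
  case: (PeanoNat.Nat.eqb_spec r' r) => [->|n]; first by rewrite eqxx.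
  have -> : (usr r' == usr r) = false by rewrite /usr; lia.
  have -> : (usr r' == 5) = false by rewrite /usr; lia.
  exact: h1.
- by rewrite xblock_frame //= /usr !inE; lia.
- rewrite xblock_frame; last by rewrite /= /usr !inE; lia.
  by move: s1 h3 {ev em h1 h2 h4 h5 hw} => [R M].
Qed.

Lemma sto_ok v m t a e1 e2 s : rel (St v m t) s -> t.+1 <= bd ->
  safe bd off v m e1 -> safe bd off v m e2 ->
  idx_safe bd off a (eval v m e1) ->
  rel (St v (aupd m a (eval v m e1) (eval v m e2)) t.+1)
      (xblock w s (ecode 8 e1 ++ ecode 9 e2 ++
        (if a is 0 then [:: IStore (tmp 8) (tmp 9)]
         else vstore_code a (tmp 8) (tmp 9)))).
Proof.
move=> hr ht hs1 hs2 hi; rewrite !xblock_cat.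
have ht' : tm (St v m t) <= bd by rewrite /=; lia.
have [ev1 em1 hr1] := ecode_rel (d := 8) hr ht' isT hs1.
set s1 := xblock w s _ in ev1 em1 hr1 *.
have [ev2 em2 hr2] := ecode_rel (d := 9) hr1 ht' isT hs2.
set s2 := xblock w s1 _ in ev2 em2 hr2 *.
have ev1' : s2.1 (tmp 8) = eval v m e1.
  rewrite -ev1 /=; apply: (@xblock_frame_all (ecode 9 e2) s1 (tmp 8) (etarget 9)).
    exact: targets_ecode.
  by rewrite /etarget /tmp; lia.
have [[h1 h2 h3] h4 h5] := hr2.
case: a hi => [|a] hi.
  split; last exact: words_xblock.
    case: h3 => h3 h3'; move: s2 ev1' ev2 h1 h2 h3 h3' {h4 h5 em2 hr2} => [R M] /= -> ->.
    move=> h1 h2 h3 h3'; split=> //; split=> //= [x hx|b x hb hx].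
      by rewrite /aupd /= /upd h3.
    rewrite /aupd /= h3' //; rewrite /vvalid /upd.
    have ne z : off + z == eval v m e1 = false by move: hi => /=; lia.
    by rewrite -!addnA !ne.
  by move: s2 h4 {ev1' ev2 em2 hr2 h1 h2 h3 h5} => [R M] /= h; lia.
case: hi => ha hi.
have hc : s2.1 3 < bd by move: h4 => /=; lia.
have [hm hk] := vstore_ok ha ev1' ev2 hi h2 hc h5 h3.
split; last exact: words_xblock.
  split=> //.
    move=> r; rewrite xblock_frame; first exact: h1.
    by rewrite /= /usr !inE; lia.
  by rewrite xblock_frame.
apply: (leq_trans hk); exact: h4.
Qed.

Lemma test_ok v m t e q P pre post s : rel (St v m t) s -> t <= bd ->
  safe bd off v m e -> P = pre ++ ecode 8 e ++ IJumpZ (tmp 8) q :: post ->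
  exists2 s', exec w P (size (ecode 8 e) + 1) (State (size pre) s.1 s.2) =
    Some (State (if eval v m e == 0 then q
                 else (size pre + size (ecode 8 e)).+1) s'.1 s'.2)
  & rel (St v m t.+1) s'.
Proof.
move=> hr ht hs ->; have [ev _ hr0] := ecode_rel (d := 8) hr ht isT hs.
have x0 := exec_code pre (IJumpZ (tmp 8) q :: post) s (ecode_straight 8 e).
set s0 := xblock w s _ in x0 ev hr0; exists s0; last exact: rel_tick.
have := step_jumpz (pre ++ ecode 8 e) (tmp 8) q post s0.
by rewrite -catA ev size_cat => /(exec_trans _); apply; rewrite x0 size_cat.
Qed.

(** A tick is worth [size P] machine steps: it pays for a piece of straight-line code of [P] and, in
    the case of a test, also for the unconditional jump that closes the branch or the loop body. *)
Lemma sim_run o c o' : run bd off o c o' ->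
  forall P pre post s, P = pre ++ ccode (size pre) c ++ post ->
  rel o s -> tm o' <= bd ->
  exists t s', [/\ exec w P t (State (size pre) s.1 s.2) =
      Some (State (size (pre ++ ccode (size pre) c)) s'.1 s'.2),
    rel o' s' & t + size P * tm o <= size P * tm o'].
Proof.
elim=> {o c o'}.
- move=> o P pre post s eP hr ht; exists 0, s; split=> //=.
  by rewrite cats0.
- move=> v m t r e hs P pre post s -> hr /= ht.
  eexists _, _; split; first apply: exec_code.
  + by rewrite all_cat ecode_straight.
  + exact: asg_ok.
  + rewrite mulnS !size_cat; lia.
- move=> v m t a e1 e2 hs1 hs2 hi P pre post s -> hr /= ht.
  eexists _, _; split; first apply: exec_code.
  + by rewrite !all_cat !ecode_straight; case: (a).
  + exact: sto_ok.
  + rewrite mulnS !size_cat; lia.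
- move=> o1 o2 o3 c1 c2 r1 IH1 r2 IH2 P pre post s eP hr ht.
  have tm3 := run_tm r2.
  set l1 := ccode (size pre) c1; set l2 := ccode (size pre + size l1) c2.
  have eP1 : P = pre ++ l1 ++ (l2 ++ post) by rewrite eP /= -catA.
  have [|t1 [s1 [x1 hr1 ht1]]] := IH1 P pre _ s eP1 hr; first by lia.
  have eP2 : P = (pre ++ l1) ++ ccode (size (pre ++ l1)) c2 ++ post.
    by rewrite size_cat -catA -/l2.
  have [t2 [s2 [x2 hr2 ht2]]] := IH2 P _ _ s1 eP2 hr1 ht.
  exists (t1 + t2), s2; split=> //; last by lia.
  rewrite (exec_trans x1 x2); congr (Some (State _ _ _)).
  by rewrite /= -/l1 !size_cat addnA.
- move=> v m t e c1 c2 o' hs r1 IH P pre post s eP hr ht.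
  have tm3 := run_tm r1; rewrite /= in tm3.
  set l0 := ecode 8 e; set l1 := ccode (size pre + size l0).+1 c1.
  set q := ((size pre + size l0).+1 + size l1).+1.
  set l2 := ccode q c2; set J := IJump (q + size l2).
  have eP0 : P = pre ++ l0 ++ (IJumpZ (tmp 8) q :: l1 ++ J :: l2 ++ post).
    by rewrite eP /= -/l0 -/l1 -/q -/l2 -!catA /= -!catA.
  have [|s0 x1 hr0] := test_ok hr _ hs eP0; first by lia.
  have sz : size P = size pre + size l0 + 2 + size l1 + size l2 + size post.
    by rewrite eP0 !size_cat /= !size_cat /= size_cat; lia.
  have sc : size (ccode (size pre) (If e c1 c2)) = size l0 + 2 + size l1 + size l2.
    by rewrite /= -/l0 -/l1 -/q -/l2 !size_cat /= size_cat /=; lia.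
  rewrite size_cat sc; case: ifP r1 IH x1 => e0 r1 IH x1.
    pose pre2 := pre ++ l0 ++ IJumpZ (tmp 8) q :: l1 ++ [:: J].
    have eq : size pre2 = q by rewrite !size_cat /= !size_cat /= /q; lia.
    have [|//|//|t2 [s2 [x2 hr2 ht2]]] := IH P pre2 post s0.
      by rewrite eq eP0 -!catA /= -!catA.
    rewrite eq in x2; exists (size l0 + 1 + t2), s2.
    split; first rewrite (exec_trans x1 x2).
    + by rewrite size_cat eq -/l2; congr (Some (State _ _ _)); rewrite /q; lia.
    + exact: hr2.
    + by move: ht2; rewrite /= mulnS; lia.
  pose pre1 := pre ++ l0 ++ [:: IJumpZ (tmp 8) q].
  have ep : size pre1 = (size pre + size l0).+1 by rewrite !size_cat /=; lia.
  have [|//|//|t2 [s2 [x2 hr2 ht2]]] := IH P pre1 (J :: l2 ++ post) s0.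
    by rewrite ep eP0 -!catA /=.
  have x3 := step_jump (pre1 ++ l1) (q + size l2) (l2 ++ post) s2.
  have eP3 : (pre1 ++ l1) ++ J :: l2 ++ post = P by rewrite eP0 -!catA /=.
  rewrite eP3 in x3; rewrite ep -/l1 in x2.
  exists (size l0 + 1 + (t2 + 1)), s2.
  split; first rewrite (exec_trans x1 (exec_trans x2 x3)).
  + by congr (Some (State _ _ _)); rewrite /q; lia.
  + exact: hr2.
  + by move: ht2; rewrite /= mulnS; lia.
- move=> v m t e c hs e0 P pre post s eP hr ht.
  set l0 := ecode 8 e; set l1 := ccode (size pre + size l0).+1 c.
  set q := ((size pre + size l0).+1 + size l1).+1.
  have eP0 : P = pre ++ l0 ++ (IJumpZ (tmp 8) q :: l1 ++ IJump (size pre) :: post).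
    by rewrite eP /= -/l0 -/l1 -/q -!catA /= -!catA.
  have [|s0 x1 hr0] := test_ok hr _ hs eP0; first by move: ht => /=; lia.
  have sz : size P = size pre + size l0 + 2 + size l1 + size post.
    by rewrite eP0 !size_cat /= !size_cat /=; lia.
  exists (size l0 + 1), s0; split; first rewrite x1 e0 /=.
  + congr (Some (State _ _ _)).
    by rewrite -/l0 -/l1 -/q !size_cat /= size_cat /= /q; lia.
  + exact: hr0.
  + by rewrite /= mulnS; lia.
- move=> v m t e c o1 o2 hs e0 r1 IH1 r2 IH2 P pre post s eP hr ht.
  have tm3 := run_tm r1; rewrite /= in tm3; have tm4 := run_tm r2.
  set l0 := ecode 8 e; set l1 := ccode (size pre + size l0).+1 c.
  set q := ((size pre + size l0).+1 + size l1).+1; set J := IJump (size pre).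
  have eP0 : P = pre ++ l0 ++ (IJumpZ (tmp 8) q :: l1 ++ J :: post).
    by rewrite eP /= -/l0 -/l1 -/q -!catA /= -!catA.
  have [|s0 x1 hr0] := test_ok hr _ hs eP0; first by lia.
  have sz : size P = size pre + size l0 + 2 + size l1 + size post.
    by rewrite eP0 !size_cat /= !size_cat /=; lia.
  move/eqP/negbTE: (e0) => e0'; rewrite e0' in x1.
  pose pre1 := pre ++ l0 ++ [:: IJumpZ (tmp 8) q].
  have ep : size pre1 = (size pre + size l0).+1 by rewrite !size_cat /=; lia.
  have [|//||t2 [s2 [x2 hr2 ht2]]] := IH1 P pre1 (J :: post) s0.
  + by rewrite ep eP0 -!catA /=.
  + by lia.
  have x3 := step_jump (pre1 ++ l1) (size pre) post s2.
  have eP3 : (pre1 ++ l1) ++ J :: post = P by rewrite eP0 -!catA /=.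
  rewrite eP3 in x3; rewrite ep -/l1 in x2.
  have [t3 [s3 [x4 hr4 ht4]]] := IH2 P pre post s2 eP hr2 ht.
  exists (size l0 + 1 + (t2 + (1 + t3))), s3; split;
    first exact: (exec_trans x1 (exec_trans x2 (exec_trans x3 x4))).
  + exact: hr4.
  + by move: ht2 ht4; rewrite /= mulnS; lia.
Qed.

End Simulation.

(** Computes [out_limit n] into register 1, squaring [n.+1] twice, and sets [cnt] to 0. *)
Definition prologue : program :=
  [:: IConst 5 0; ILoad 5 5; IConst 7 1; IOp BAdd 5 5 7; IOp BMul 5 5 5;
      IOp BMul 5 5 5; IConst 7 4; IOp BMul 5 5 7; IConst 7 2; IOp BAdd 1 5 7;
      IConst 3 0].

Definition compile (c : cmd) : program := prologue ++ ccode (size prologue) c.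

(** Two words of header and four words for each of at most [n.+1 ^ 4] slabs: enough for the input
    and for the output. *)
Definition out_limit (n : nat) : nat := 4 * n.+1 ^ 4 + 2.

Lemma compile_correct w bd n input (s : state) c (Q : st -> Prop) :
  out_limit n + 48 * bd + 51 <= 2 ^ w ->
  initial w (n :: input) s ->
  (forall o, tm o = 0 -> ar o 0 = st_mem s -> (forall a x, ar o a.+1 x = 0) ->
     exists2 o', run bd (out_limit n) o c o' & tm o' <= bd /\ Q o') ->
  exists o t s', [/\ halts_in w (compile c) t s s', Q o,
    t <= size (compile c) * (tm o).+1 &
    forall x, x < out_limit n -> st_mem s' x = ar o 0 x].
Proof.
set off := out_limit n => hb [hpc hst hR hm] hrun.
case: s hpc hst hR hm hrun => p R m /= -> hst hR hm hrun.
have m0 : m 0 = n by rewrite hst.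
pose s1 := xblock w (R, m) prologue.
have x0 : exec w (compile c) (size prologue) (State 0 R m) =
          Some (State (size prologue) s1.1 s1.2).
  by have := @exec_block w [::] prologue (ccode (size prologue) c) (R, m) isT.
have hw1 : words w s1 by apply: words_xblock.
have [e1 e3 em] : [/\ s1.1 1 = off, s1.1 3 = 0 & s1.2 = m].
  rewrite /s1 /= /upd /= !mod0n m0.
  have hM x : x <= off -> x %% 2 ^ w = x by move=> h; rewrite modn_small //; lia.
  have ep : n.+1 ^ 4 = n.+1 * n.+1 * (n.+1 * n.+1) by rewrite !expnS expn0 muln1 mulnA.
  have eo : off = n.+1 * n.+1 * (n.+1 * n.+1) * 4 + 2 by rewrite /off /out_limit -ep; lia.
  have l1 : n.+1 <= n.+1 * n.+1 by rewrite leq_pmulr.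
  have l2 : n.+1 * n.+1 <= n.+1 * n.+1 * (n.+1 * n.+1) by rewrite leq_pmulr ?muln_gt0.
  rewrite !(hM 1, hM 4, hM 2) ?addn1; try lia.
  rewrite !(hM n.+1); last by lia.
  rewrite !(hM (n.+1 * n.+1)); last by lia.
  rewrite !(hM (n.+1 * n.+1 * (n.+1 * n.+1))); last by lia.
  by rewrite !(hM (n.+1 * n.+1 * (n.+1 * n.+1) * 4)) ?hM //; lia.
pose o0 := St (fun r => s1.1 (usr r))
  (fun a => if a is 0 then m else fun=> 0) 0.
have [||//|o' ho [ht hQ]] := hrun o0; first by [].
  by [].
have hr0 : rel w bd off o0 s1.
  split=> //; last by rewrite e3.
  split; [by [] | exact: e1 |].
  split=> [x hx|a x ha hx]; first by rewrite em.
  (* With [cnt = 0] no cell is valid, so the virtual arrays read as zero whatever the memory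
     contains. *)
  by rewrite /vvalid e3 ltn0.
have [|t1 [s2 [x1 [[h1 h2 [h3 _]] _ _] ht1]]] :=
  sim_run hb ho (P := compile c) (pre := prologue) (post := [::]) _ hr0 ht.
  by rewrite /= cats0.
exists o', (size prologue + t1), (State (size (compile c)) s2.1 s2.2).
split; [|exact: hQ| |by move=> x /h3].
- split; first exact: exec_trans x0 x1.
  rewrite /step; have -> // : onth (compile c) (size (compile c)) = None.
    by elim: (compile c).
- have : size (compile c) = size prologue + size (ccode (size prologue) c).
    by rewrite size_cat.
  move: ht1; rewrite muln0 addn0 mulnS => h e.
  by apply: leq_add => //; rewrite e leq_addr.
Qed.

(** * Total correctness by weakest preconditions *)

Definition tick (o : st) : st := St (vr o) (ar o) (tm o).+1.

Fixpoint wregs (c : cmd) : seq nat :=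
  match c with
  | Asg r _ => [:: r]
  | Seq c1 c2 | If _ c1 c2 => wregs c1 ++ wregs c2
  | While _ c => wregs c
  | _ => [::]
  end.

Fixpoint warrs (c : cmd) : seq nat :=
  match c with
  | Sto a _ _ => [:: a]
  | Seq c1 c2 | If _ c1 c2 => warrs c1 ++ warrs c2
  | While _ c => warrs c
  | _ => [::]
  end.

(** Whole arrays are equated as functions, so that a part of an invariant about unwritten arrays is
    transported by one rewriting. *)
Definition agree (c : cmd) (o o' : st) : Prop :=
  (forall r, r \notin wregs c -> vr o' r = vr o r) /\
  (forall a, a \notin warrs c -> ar o' a = ar o a).

Section WeakestPre.
Variables bd lim : nat.
Implicit Types (c : cmd) (o : st) (Q : st -> Prop).

Definition wp c Q o : Prop := exists2 o', run bd lim o c o' & Q o'.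

Fixpoint wpc c Q o : Prop :=
  match c with
  | Skip => Q o
  | Asg r e => safe bd lim (vr o) (ar o) e /\
      Q (St (rupd (vr o) r (eval (vr o) (ar o) e)) (ar o) (tm o).+1)
  | Sto a e1 e2 => [/\ safe bd lim (vr o) (ar o) e1,
      safe bd lim (vr o) (ar o) e2,
      idx_safe bd lim a (eval (vr o) (ar o) e1) &
      Q (St (vr o) (aupd (ar o) a (eval (vr o) (ar o) e1)
                                  (eval (vr o) (ar o) e2)) (tm o).+1)]
  | Seq c1 c2 => wpc c1 (wpc c2 Q) o
  | If e c1 c2 => safe bd lim (vr o) (ar o) e /\
      if eval (vr o) (ar o) e == 0 then wpc c2 Q (tick o)
      else wpc c1 Q (tick o)
  | While _ _ => wp c Q o
  end.

Lemma wpcP c Q o : wpc c Q o <-> wp c Q o.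
Proof.
elim: c Q o => //= [|r e|a e1 e2|c1 IH1 c2 IH2|e c1 IH1 c2 IH2] Q o.
- split=> [h|[o' h]]; first by exists o => //; apply: run_skip.
  by inversion h; subst.
- case: o => v m t /=; split=> [[h1 h2]|[o' h]].
    by exists (St (rupd v r (eval v m e)) m t.+1) => //; apply: run_asg.
  by inversion h; subst.
- case: o => v m t /=; split=> [[h1 h2 h3 h4]|[o' h]].
    by eexists; last exact: h4; apply: run_sto.
  by inversion h; subst.
- split=> [/IH1[o1 r1 /IH2[o2 r2 h]]|[o' h hQ]].
    by exists o2 => //; apply: run_seq r1 r2.
  inversion h; subst; apply/IH1; exists s2 => //.
  by apply/IH2; exists o'.
- case: o => v m t /=; split=> [[h]|[o' h hQ]].
    move=> h'; have [o' hr hQ]: wp (if eval v m e == 0 then c2 else c1) Q (tick (St v m t)).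
      by case: ifP h' => _; [move/IH2 | move/IH1].
    by exists o' => //; apply: run_if.
  inversion h; subst; split=> //.
  match goal with H : run _ _ _ (if _ then _ else _) _ |- _ => move: H end.
  by case: ifP => _ hr; [apply/IH2 | apply/IH1]; exists o'.
Qed.

Lemma run_agree o c o' : run bd lim o c o' -> agree c o o'.
Proof.
elim=> {o c o'} //=.
- move=> v m t r e _; split=> //= r'; rewrite inE /rupd => /negbTE h.
  by case: (PeanoNat.Nat.eqb_spec r' r) => // hr; rewrite hr eqxx in h.
- move=> v m t a e1 e2 _ _ _; split=> //= b; rewrite inE /aupd => /negbTE h.
  by case: (PeanoNat.Nat.eqb_spec b a) => // hr; rewrite hr eqxx in h.
- move=> s1 s2 s3 c1 c2 _ [a1 b1] _ [a2 b2]; split=> x /=;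
    rewrite mem_cat negb_or => /andP[h1 h2]; first by rewrite a2 // a1.
  by rewrite b2 // b1.
- move=> v m t e c1 c2 s' _ _ [h1 h2]; split=> x /=;
    rewrite mem_cat negb_or => /andP[k1 k2].
    by apply: h1; case: ifP.
  by apply: h2; case: ifP.
- move=> v m t e c s1 s2 _ _ _ [a1 b1] _ [a2 b2]; split=> x /= h.
    by rewrite a2 // a1.
  by rewrite b2 // b1.
Qed.

Lemma run_pure o c o' : run bd lim o c o' -> warrs c = [::] -> ar o' = ar o.
Proof.
elim=> {o c o'} //=.
- move=> s1 s2 s3 c1 c2 _ IH1 _ IH2.
  by case e1: (warrs c1) => // e2; rewrite IH2 // IH1.
- move=> v m t e c1 c2 s' _ _ IH.
  by case e1: (warrs c1) => // e2; rewrite IH //; case: ifP.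
- by move=> v m t e c s1 s2 _ _ _ IH1 _ IH2 h; rewrite IH2 // IH1.
Qed.

Lemma wp_agree c Q o : wp c Q o -> wp c (fun o' => Q o' /\ agree c o o') o.
Proof. by case=> o' h hQ; exists o' => //; split=> //; apply: run_agree h. Qed.

Lemma wp_consequence c Q Q' o : wp c Q o ->
  (forall o', Q o' -> agree c o o' -> Q' o') -> wp c Q' o.
Proof. by move=> /wp_agree[o' h [h1 h2]] hQ; exists o' => //; apply: hQ. Qed.

Lemma wp_seq c1 c2 Q o : wp c1 (wp c2 Q) o -> wp (Seq c1 c2) Q o.
Proof. by move=> [o1 r1 [o2 r2 h]]; exists o2 => //; apply: run_seq r1 r2. Qed.

Lemma wp_if e c1 c2 Q o : safe bd lim (vr o) (ar o) e ->
  (eval (vr o) (ar o) e <> 0 -> wp c1 Q (tick o)) ->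
  (eval (vr o) (ar o) e = 0 -> wp c2 Q (tick o)) -> wp (If e c1 c2) Q o.
Proof.
by move=> hs h1 h2; apply/wpcP; split=> //; case: eqP => h; apply/wpcP; auto.
Qed.

Lemma wp_while (I : nat -> st -> Prop) e c Q o k :
  I k o ->
  (forall j o', I j o' -> agree c o o' ->
     safe bd lim (vr o') (ar o') e /\
     if eval (vr o') (ar o') e == 0 then Q (tick o')
     else wp c (fun o2 => exists2 j', j' < j & I j' o2) (tick o')) ->
  wp (While e c) Q o.
Proof.
move=> hI hstep.
have : agree c o o by [].
elim/ltn_ind: k {-2}o hI => k IH o1 hI ha.
have [hs] := hstep k o1 hI ha.
case: o1 hI ha hs => v m t hI ha /= hs; case: eqP => e0.
  by move=> hQ; exists (St v m t.+1) => //; apply: run_while0.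
case=> o2 hr [j hj hI2].
have [a1 b1] := run_agree hr.
have ha2 : agree c o o2.
  case: ha => a2 b2; split=> x hx; first exact: etrans (a1 x hx) (a2 x hx).
  exact: etrans (b1 x hx) (b2 x hx).
have [o3 h3 hQ] := IH j hj o2 hI2 ha2.
by exists o3 => //; apply: run_while1 h3.
Qed.

End WeakestPre.

(** * Van Emde Boas trees *)

Implicit Types S T : pred nat.

(** [prv S x] and [fst1 S u] are the greatest element below [x] and the least
    element, plus one, so that [0] stands for none. *)
Fixpoint prv (S : pred nat) (x : nat) : nat :=
  if x is y.+1 then if S y then y.+1 else prv S y else 0.

Fixpoint fst1 (S : pred nat) (u : nat) : nat :=
  if u is v.+1 then
    if fst1 S v is m.+1 then m.+1 else if S v then v.+1 else 0
  else 0.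

Variant prv_spec (S : pred nat) x : nat -> Type :=
| PrvNone : (forall y, y < x -> ~~ S y) -> prv_spec S x 0
| PrvSome y : y < x -> S y -> (forall z, y < z < x -> ~~ S z) ->
    prv_spec S x y.+1.

Lemma prvP S x : prv_spec S x (prv S x).
Proof.
elim: x => [|x IH] /=; first by constructor.
case: ifP => hx; first by constructor=> // z; lia.
case: IH => [h|y hy Sy h].
  constructor=> y; rewrite ltnS leq_eqVlt => /orP[/eqP->|/h //].
  by rewrite hx.
constructor=> // [|z]; first lia.
case/andP=> h1; rewrite ltnS leq_eqVlt => /orP[/eqP->|h2]; first by rewrite hx.
by apply: h; rewrite h1.
Qed.

Variant fst_spec (S : pred nat) u : nat -> Type :=
| FstNone : (forall y, y < u -> ~~ S y) -> fst_spec S u 0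
| FstSome y : y < u -> S y -> (forall z, z < y -> ~~ S z) -> fst_spec S u y.+1.

Lemma fstP S u : fst_spec S u (fst1 S u).
Proof.
elim: u => [|x IH] /=; first by constructor.
case: IH => [h|y hy Sy h]; last by constructor=> //; lia.
case: ifP => hx; first by constructor.
constructor=> y; rewrite ltnS leq_eqVlt => /orP[/eqP->|/h //].
by rewrite hx.
Qed.

Lemma eq_prv S S' x : S =1 S' -> prv S x = prv S' x.
Proof. by move=> e; elim: x => //= x ->; rewrite e. Qed.

Lemma eq_fst1 S S' x : S =1 S' -> fst1 S x = fst1 S' x.
Proof. by move=> e; elim: x => //= x ->; rewrite e. Qed.

Definition bounded (S : pred nat) (u : nat) : Prop := forall y, S y -> y < u.

Lemma prvE S x y : y < x -> S y -> (forall z, y < z < x -> ~~ S z) ->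
  prv S x = y.+1.
Proof.
move=> h1 h2 h3; case: prvP => [h|z hz Sz h]; first by have := h y h1; rewrite h2.
case: (ltngtP y z) => [k|k|-> //].
  by have := h3 z; rewrite Sz k hz => /(_ isT).
by have := h y; rewrite h2 k h1 => /(_ isT).
Qed.

Lemma prv0 S x : (forall y, y < x -> ~~ S y) -> prv S x = 0.
Proof. by move=> h; case: prvP => // y hy Sy _; have := h y hy; rewrite Sy. Qed.

Lemma fstE S u y : y < u -> S y -> (forall z, z < y -> ~~ S z) ->
  fst1 S u = y.+1.
Proof.
move=> h1 h2 h3; case: fstP => [h|z hz Sz h]; first by have := h y h1; rewrite h2.
case: (ltngtP y z) => [k|k|-> //].
  by have := h y k; rewrite h2.
by have := h3 z k; rewrite Sz.
Qed.

Lemma fst0 S x : (forall y, y < x -> ~~ S y) -> fst1 S x = 0.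
Proof. by move=> h; case: fstP => // y hy Sy _; have := h y hy; rewrite Sy. Qed.

Lemma prv_widen S u v : bounded S u -> u <= v -> prv S v = prv S u.
Proof.
move=> hb huv; case: (prvP S u) => [h|y hy Sy h].
  by apply: prv0 => y _; apply/negP=> Sy; have := h y (hb y Sy); rewrite Sy.
apply: prvE => // [|z /andP[h1 _]]; first lia.
apply/negP=> Sz; have := h z; rewrite Sz h1 hb // => /(_ isT) //.
Qed.

Lemma fst_widen S u v : bounded S u -> u <= v -> fst1 S v = fst1 S u.
Proof.
move=> hb huv; case: (fstP S u) => [h|y hy Sy h].
  by apply: fst0 => y _; apply/negP=> Sy; have := h y (hb y Sy); rewrite Sy.
by apply: fstE => //; lia.
Qed.

Lemma fst_prv0 S u : (fst1 S u == 0) = (prv S u == 0).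
Proof.
case: fstP => [h|y hy Sy h]; first by rewrite prv0.
by case: prvP => // h'; have := h' y hy; rewrite Sy.
Qed.

(** A node of the tree stores both its extrema outside of its children, so that
    insertion and deletion each recurse into a single child. *)
Definition inner (u : nat) (S : pred nat) : pred nat :=
  fun y => [&& S y, y.+1 != fst1 S u & y.+1 != prv S u].

Definition cluster (q : nat) (T : pred nat) (h : nat) : pred nat :=
  fun l => (l < q) && T (h * q + l).

Definition summary (q : nat) (T : pred nat) : pred nat :=
  fun h => has (fun l => T (h * q + l)) (iota 0 q).

Definition child (q : nat) (T : pred nat) (c : nat) : pred nat :=
  if c is h.+1 then cluster q T h else summary q T.

(** One relation serves both directions: insertion leads from [A] to [B], deletion from [B] to
    [A]. *)
Definition add1 (A : pred nat) (x : nat) (B : pred nat) : Prop :=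
  ~~ A x /\ forall y, B y = (y == x) || A y.

Lemma summaryP q T h :
  reflect (exists2 l, l < q & T (h * q + l)) (summary q T h).
Proof.
apply: (iffP hasP) => [[l]|[l h1 h2]].
  by rewrite mem_iota /= => ? ?; exists l.
by exists l; rewrite ?mem_iota.
Qed.

Lemma bounded_inner u S v : bounded S v -> bounded (inner u S) v.
Proof. by move=> h y /and3P[/h]. Qed.

Lemma eq_inner u S S' : S =1 S' -> inner u S =1 inner u S'.
Proof. by move=> e y; rewrite /inner e (eq_prv _ e) (eq_fst1 _ e). Qed.

Lemma eq_child q T T' c : T =1 T' -> child q T c =1 child q T' c.
Proof.
move=> e; case: c => [|h] y /=; last by rewrite /cluster e.
by apply: eq_has => l; rewrite e.
Qed.

Lemma bounded_child q T c : bounded T (q * q) -> bounded (child q T c) q.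
Proof.
move=> hb; case: c => [|h] y /=; last by case/andP.
case/summaryP=> l hl /hb h; rewrite ltnNge; apply/negP=> hy.
have := leq_mul hy (leqnn q); lia.
Qed.

(** * Adding one element, seen from a node and from its children *)

Section Node.
Variables (u : nat) (A B : pred nat) (x : nat).
Hypotheses (hx : x < u) (hA : bounded A u) (hAB : add1 A x B).

Lemma add1_fst : fst1 B u = if fst1 A u == 0 then x.+1 else minn (fst1 A u) x.+1.
Proof.
case: hAB => nx e; case: (fstP A u) => [h|y hy Ay h] /=.
  by apply: fstE; rewrite ?e ?eqxx // => z hz; rewrite e negb_or h //; lia.
have nyx : y != x by apply: contraNneq nx => <-.
case: (ltngtP y x) => k; last by rewrite k eqxx in nyx.
  rewrite (minn_idPl _) ?ltnS; last by lia.
  apply: fstE; rewrite ?e ?Ay ?orbT // => z hz; rewrite e negb_or h //; lia.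
rewrite (minn_idPr _); last by lia.
apply: fstE; rewrite ?e ?eqxx // => z hz; rewrite e negb_or h //; lia.
Qed.

Lemma add1_prv : prv B u = maxn (prv A u) x.+1.
Proof.
case: hAB => nx e; case: (prvP A u) => [h|y hy Ay h] /=.
  rewrite max0n; apply: prvE; rewrite ?e ?eqxx // => z hz.
  by rewrite e negb_or h //; lia.
have nyx : y != x by apply: contraNneq nx => <-.
case: (ltngtP y x) => k; last by rewrite k eqxx in nyx.
  rewrite (maxn_idPr _) ?ltnS; last by lia.
  by apply: prvE; rewrite ?e ?eqxx // => z hz; rewrite e negb_or h //; lia.
rewrite (maxn_idPl _); last by lia.
apply: prvE; rewrite ?e ?Ay ?orbT // => z hz; rewrite e negb_or h //; lia.
Qed.

Lemma inner_single S v : bounded S v -> fst1 S v = prv S v ->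
  forall y, inner v S y = false.
Proof.
move=> hS e y; apply/negP=> /and3P[Sy]; rewrite e => n1 _.
move: e n1; case: fstP => [h|a ha Sa h]; first by have := h y (hS y Sy); rewrite Sy.
case: prvP => // b hb Sb h' [eab]; rewrite eqSS -eab => n1.
case: (ltngtP y a) => [k|k|k]; last by rewrite k eqxx in n1.
  by have := h y k; rewrite Sy.
have := h' y; rewrite Sy -eab k hS // => /(_ isT) //.
Qed.

(** For this reason, comparing the minimum with the maximum detects, in a deletion, the node that
    becomes empty. *)
Lemma add1_single : (fst1 A u == 0) = (fst1 B u == prv B u).
Proof.
rewrite add1_fst add1_prv; have := fst_prv0 A u.
case: hAB => nx _; case: fstP => [h _|y hy Ay h]; first by rewrite (prv0 h) max0n !eqxx.
rewrite /=; case: prvP => // z hz Az h' _.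
have nyx : y != x by apply: contraNneq nx => <-.
have nzx : z != x by apply: contraNneq nx => <-.
have : y <= z by rewrite leqNgt; apply/negP=> k; have := h z k; rewrite Az.
by move=> k; apply/esym/negbTE; lia.
Qed.

(** The element that enters or leaves a child when [x] enters or leaves the
    node. *)
Definition promoted : nat :=
  if x.+1 < fst1 A u then (fst1 A u).-1
  else if prv A u < x.+1 then (prv A u).-1 else x.

(** With two elements or more in [A], the new element either goes down itself or displaces an
    extremum that goes down instead. If [A] had one element, both elements of [B] would be extrema
    and nothing would go down. *)
Lemma add1_inner : fst1 A u != prv A u ->
  add1 (inner u A) promoted (inner u B) /\ promoted < u.
Proof.
move=> n; have b1 := add1_fst; have b2 := add1_prv.
have nz := fst_prv0 A u; rewrite /promoted /add1 /inner b1 b2 {b1 b2}.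
case: hAB => nx e.
move: n nz; case: fstP => [h|a ha Aa h]; first by rewrite prv0.
case: prvP => [h' _ /eqP //|b hb Ab h'] n _; rewrite /= in n *.
have nax : a != x by apply: contraNneq nx => <-.
have nbx : b != x by apply: contraNneq nx => <-.
have hab : a <= b by rewrite leqNgt; apply/negP=> k; have := h b k; rewrite Ab.
rewrite !ltnS.
case: (ltnP x a) => k1.
  split; last by lia.
  split; first by rewrite !eqSS eqxx /= andbF.
  move=> y; rewrite e; case: (y =P x) => [->|nyx].
    rewrite /= (negbTE nx) /=; lia.
  rewrite /=; case: (y =P a) => [->|nya] /=; first by rewrite Aa /=; lia.
  by case: (A y) => //=; lia.
case: (ltnP b x) => k2.
  split; last by lia.
  split; first by rewrite !eqSS eqxx /= !andbF.
  move=> y; rewrite e; case: (y =P x) => [->|nyx].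
    rewrite /= (negbTE nx) /=; lia.
  rewrite /=; case: (y =P b) => [->|nya] /=; first by rewrite Ab /=; lia.
  by case: (A y) => //=; lia.
split=> //; split; first by rewrite (negbTE nx).
move=> y; rewrite e; case: (y =P x) => [->|nyx] /=; first by lia.
by case: (A y) => //=; lia.
Qed.

End Node.

Section Children.
Variables (q : nat) (A B : pred nat) (x : nat).
Hypotheses (hq : 0 < q) (hAB : add1 A x B).
Let h := x %/ q.
Let l := x %% q.

Lemma add1_cluster_neq h' : h' != h -> cluster q A h' =1 cluster q B h'.
Proof.
case: hAB => _ e n y; rewrite /cluster e; case: ltnP => //= hy.
suff -> : (h' * q + y == x) = false by [].
by apply/negbTE; apply: contraNneq n => E; rewrite /h -E divnMDl // divn_small ?addn0.
Qed.

Lemma add1_cluster : add1 (cluster q A h) l (cluster q B h).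
Proof.
case: hAB => nx e; rewrite /add1 /cluster -divn_eq ltn_mod hq; split=> // y.
rewrite e; case: ltnP => /= hy.
  by rewrite {1}(divn_eq x q) eqn_add2l.
by rewrite orbF; apply/esym/negbTE; rewrite /l; have := ltn_pmod x hq; lia.
Qed.

(** The dichotomy behind the single recursion: an empty cluster becomes a singleton, with nothing in
    its children, while the summary changes; if the cluster is not empty, the summary does not
    change. *)
Lemma add1_summary0 : fst1 (cluster q A h) q = 0 ->
  add1 (summary q A) h (summary q B).
Proof.
case: hAB => nx e h0; have hE y : y < q -> ~~ A (h * q + y).
  move=> hy; apply/negP=> Ay; move: h0; case: fstP => // k _.
  by have := k y hy; rewrite /cluster hy Ay.
split; first by apply/summaryP=> -[y /hE/negbTE->].
move=> y; apply/summaryP/orP => [[z hz]|[/eqP->|/summaryP[z hz Az]]].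
- rewrite e => /orP[/eqP E|Az]; last by right; apply/summaryP; exists z.
  by left; rewrite /h -E divnMDl // divn_small ?addn0.
- by exists l; rewrite ?ltn_mod // -divn_eq e eqxx.
- by exists z => //; rewrite e Az orbT.
Qed.

Lemma add1_summary1 : fst1 (cluster q A h) q != 0 ->
  summary q A =1 summary q B.
Proof.
case: hAB => nx e; case: fstP => // a ha /andP[_ Aa] _ _ y.
apply/summaryP/summaryP=> -[z hz].
  by move=> Az; exists z => //; rewrite e Az orbT.
rewrite e => /orP[/eqP E|Az]; last by exists z.
exists a => //; suff -> : y = h by [].
by rewrite /h -E divnMDl // divn_small ?addn0.
Qed.

End Children.

(** Clusters are consecutive intervals of keys: the answer lies in the cluster of [x], or else is
    the greatest element of the last nonempty cluster before it. Adding one inside a cluster adds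
    one to the key, so the coding by successors is respected. *)
Lemma prv_cluster q T x : 0 < q ->
  prv T x = if prv (cluster q T (x %/ q)) (x %% q) is r.+1
            then x %/ q * q + r.+1
            else if prv (summary q T) (x %/ q) is r.+1
            then r * q + prv (cluster q T r) q else 0.
Proof.
move=> hq; set h := x %/ q; set l := x %% q.
have ex : x = h * q + l by apply: divn_eq.
have hl : l < q by rewrite ltn_mod.
have dec z : z = z %/ q * q + z %% q by apply: divn_eq.
have md z : z %% q < q by rewrite ltn_mod.
case: (prvP (cluster q T h)) => [n1|y hy /andP[hyq Ty] n1]; last first.
  rewrite addnS; apply: prvE => //; first by rewrite ex ltn_add2l.
  move=> z /andP[z1 z2]; have ez : z = h * q + (z - h * q) by lia.
  have := n1 (z - h * q); rewrite /cluster -ez negb_and => H.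
  by have /H /orP[|//] : y < z - h * q < l; lia.
case: (prvP (summary q T) h) => [n2|y hy /summaryP[l0 hl0 Tl0] n2]; last first.
  have hqy : y * q + q <= h * q by rewrite -mulSnr leq_mul2r hy orbT.
  case: (prvP (cluster q T y) q) => [n3|a ha /andP[_ Ta] n3].
    by have := n3 l0 hl0; rewrite /cluster hl0 Tl0.
  rewrite addnS; apply: prvE => //; first by lia.
  move=> z /andP[z1 z2]; apply/negP=> Tz.
  have yz : y <= z %/ q by rewrite leq_divRL //; lia.
  have zh : z %/ q <= h by apply: leq_div2r; lia.
  case: (ltngtP (z %/ q) y) => [|k1|k1]; first by lia.
    case: (ltngtP (z %/ q) h) => [k2||k2]; [|by lia|].
      have := n2 (z %/ q); rewrite k1 k2 => /(_ isT)/negP; apply.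
      by apply/summaryP; exists (z %% q); rewrite ?md // -dec.
    have hzl : z %% q < l by have := dec z; rewrite k2; lia.
    by have := n1 _ hzl; rewrite /cluster md -k2 -dec Tz.
  have h3 : a < z %% q by have := dec z; rewrite k1; lia.
  by have := n3 (z %% q); rewrite h3 md => /(_ isT); rewrite /cluster md -k1 -dec Tz.
apply: prv0 => z hz; apply/negP=> Tz.
have zh : z %/ q <= h by apply: leq_div2r; lia.
case: (ltngtP (z %/ q) h) => [k2||k2]; [|by lia|].
  have := n2 (z %/ q) k2 => /negP; apply.
  by apply/summaryP; exists (z %% q); rewrite ?md // -dec.
have hzl : z %% q < l by have := dec z; rewrite k2; lia.
by have := n1 _ hzl; rewrite /cluster md -k2 -dec Tz.
Qed.

Lemma fst_cluster q T : 0 < q -> bounded T (q * q) ->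
  fst1 T (q * q) = if fst1 (summary q T) q is r.+1
                   then r * q + fst1 (cluster q T r) q else 0.
Proof.
move=> hq hb.
have dec z : z = z %/ q * q + z %% q by apply: divn_eq.
have md z : z %% q < q by rewrite ltn_mod.
case: (fstP (summary q T) q) => [n|r hr /summaryP[l0 hl0 Tl0] n].
  apply: fst0 => z hz; apply/negP=> Tz.
  have hzq : z %/ q < q by rewrite ltn_divLR.
  have /negP := n _ hzq; apply.
  by apply/summaryP; exists (z %% q); rewrite ?md // -dec.
case: (fstP (cluster q T r) q) => [n3|a ha /andP[_ Ta] n3].
  by have := n3 l0 hl0; rewrite /cluster hl0 Tl0.
rewrite addnS; apply: fstE => //; first exact: hb.
move=> z hz; apply/negP=> Tz.
have zr : z %/ q <= r.
  by rewrite -ltnS ltn_divLR // mulSnr; lia.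
case: (ltngtP (z %/ q) r) => [k1||k1]; [|by lia|].
  have /negP := n _ k1; apply.
  by apply/summaryP; exists (z %% q); rewrite ?md // -dec.
have hza : z %% q < a by have := dec z; rewrite k1; lia.
by have := n3 _ hza; rewrite /cluster md -k1 -dec Tz.
Qed.

(** Here [x] is above the minimum and not above the maximum: the maximum cannot be the predecessor,
    and the minimum is it only if the inner set offers nothing. *)
Lemma prv_node S u x : bounded S u -> fst1 S u <= x < prv S u ->
  fst1 S u != 0 ->
  prv S x = if prv (inner u S) x is r.+1 then r.+1 else fst1 S u.
Proof.
have hin y : inner u S y = [&& S y, y.+1 != fst1 S u & y.+1 != prv S u] by [].
move=> hb; move: hin; case: fstP => // a ha Sa na.
case: (prvP S u) => [n|b hb' Sb nb] hin; first by lia.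
move=> /andP[ax xb] _.
case: (prvP (inner u S) x) => [n|y hy]; last rewrite hin => /and3P[Sy n1 n2] n.
  apply: prvE => // z /andP[z1 z2]; have := n z z2.
  by rewrite hin !negb_and !negbK => /or3P[//||]; lia.
apply: prvE => // z /andP[z1 z2]; have := n z; rewrite z1 z2 => /(_ isT).
rewrite hin !negb_and !negbK => /or3P[//||]; last by lia.
move=> /eqP [E]; have := na y; rewrite Sy -E z1 => /(_ isT) //.
Qed.

Lemma prv_ge S u x : bounded S u -> prv S u <= x -> prv S x = prv S u.
Proof.
move=> hb; case: prvP => [n|y hy Sy n] h.
  by apply: prv0 => z _; apply/negP=> Sz; have := n z (hb z Sz); rewrite Sz.
apply: prvE => // z /andP[z1 z2]; apply/negP=> Sz; have := n z.
by rewrite Sz z1 hb // => /(_ isT).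
Qed.

Lemma prv_lt S u x : x < fst1 S u -> prv S x = 0.
Proof.
by case: fstP => // y hy Sy n h; apply: prv0 => z hz; apply: n; lia.
Qed.

(** The stored minimum tells whether a cluster contains a predecessor, so the search can choose the
    one child that it enters. *)
Lemma fst_le_prv S u l : bounded S u ->
  (0 < fst1 S u <= l) = (prv S l != 0).
Proof.
move=> hb; case: fstP => [n|y hy Sy n] /=.
  rewrite prv0 ?eqxx // => z _; apply/negP=> Sz.
  by have := n z (hb z Sz); rewrite Sz.
case: prvP => [n'|z hz Sz n'].
  by apply/negbTE/negP=> h; have := n' y h; rewrite Sy.
by rewrite /= (leq_ltn_trans _ hz) // leqNgt; apply/negP=> /n; rewrite Sz.
Qed.

Lemma mem_between S v y : bounded S v -> S y -> fst1 S v <= y.+1 <= prv S v.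
Proof.
move=> hb Sy; case: fstP => [n|a ha Sa n].
  by have := n y (hb y Sy); rewrite Sy.
case: prvP => [n'|b hb' Sb n'].
  by have := n' y (hb y Sy); rewrite Sy.
rewrite !ltnS; apply/andP; split.
  by rewrite leqNgt; apply/negP=> /n; rewrite Sy.
by rewrite leqNgt; apply/negP=> kk; have := n' y; rewrite kk hb // Sy => /(_ isT).
Qed.

Lemma inner_between u S y : bounded S u -> inner u S y ->
  [&& 0 < fst1 S u, fst1 S u < y.+1 & y.+1 < prv S u].
Proof.
move=> hb; rewrite /inner; case: fstP => [n|a ha Sa n] /and3P[Sy].
  by have := n y (hb y Sy); rewrite Sy.
case: prvP => [n'|b hb' Sb n'] n1 n2.
  by have := n' y (hb y Sy); rewrite Sy.
have : a <= y by rewrite leqNgt; apply/negP=> /n; rewrite Sy.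
have : y <= b.
  by rewrite leqNgt; apply/negP=> k; have := n' y; rewrite k hb // Sy => /(_ isT).
by lia.
Qed.

Section NodeDelete.
Variables (u : nat) (A B : pred nat) (x : nat).
Hypotheses (hB : bounded B u) (hAB : add1 A x B).
Hypothesis hne : fst1 B u != prv B u.
Let fi := fst1 (inner u B) u.
Let pi := prv (inner u B) u.

Let inA y : A y = B y && (y != x).
Proof.
case: hAB => nx ->; case: eqP => [->|_] /=; first exact/negbTE.
by rewrite andbT.
Qed.

Lemma delete_min : x.+1 = fst1 B u ->
  fst1 A u = (if fi == 0 then prv B u else fi) /\ prv A u = prv B u.
Proof.
have hin y : inner u B y = [&& B y, y.+1 != fst1 B u & y.+1 != prv B u] by [].
move: hin hne; rewrite /fi; case: (fstP B u) => // a ha Ba na.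
case: (prvP B u) => [n0|b hb Bb nb] hin n;
  [by have := n0 a ha; rewrite Ba | move=> [ea]]; split; last first.
  by apply: prvE => // [|z hz]; rewrite inA ?Bb ?ea ?negb_and ?nb //=; lia.
case: (fstP (inner u B) u) => [nr|r hr] /=.
  apply: fstE => //; first by rewrite inA Bb ea /=; lia.
  move=> z hz; rewrite inA ea; have := nr z; rewrite hin eqSS.
  by case: (B z) => //=; lia.
rewrite hin => /and3P[Br r1 r2] nr.
have rb : r < b.
  case: (ltngtP r b) => [//|kk|e]; last by rewrite e eqxx in r2.
  by have := nb r; rewrite kk hr Br => /(_ isT).
apply: fstE => //; first by rewrite inA Br ea.
move=> z hz; rewrite inA ea; have := nr z hz; rewrite hin eqSS.
by case: (B z) => //=; lia.
Qed.

Lemma delete_max : x.+1 = prv B u ->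
  fst1 A u = fst1 B u /\ prv A u = if pi == 0 then fst1 B u else pi.
Proof.
have hin y : inner u B y = [&& B y, y.+1 != fst1 B u & y.+1 != prv B u] by [].
move: hin hne; rewrite /pi; case: (prvP B u) => [|b hb Bb nb]; first by [].
case: (fstP B u) => [n0|a ha Ba na] hin n;
  [by have := n0 b hb; rewrite Bb | move=> [eb]]; split.
  by apply: fstE => // [|z hz]; rewrite inA ?Ba ?eb ?negb_and ?na //=; lia.
case: (prvP (inner u B) u) => [nr|r hr] /=.
  apply: prvE => //; first by rewrite inA Ba eb /=; lia.
  move=> z /andP[z1 z2]; rewrite inA eb; have := nr z; rewrite hin eqSS.
  by case: (B z) => //=; lia.
rewrite hin => /and3P[Br r1 r2] nr.
have rb : a < r.
  by case: (ltngtP r a) => [kk|//|e]; [have := na r kk; rewrite Br | rewrite e eqxx in r1].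
apply: prvE => //; first by rewrite inA Br eb.
move=> z hz; rewrite inA eb; have := nr z hz; rewrite hin eqSS.
by case: (B z) => //=; lia.
Qed.

Lemma delete_mid : x.+1 != fst1 B u -> x.+1 != prv B u ->
  fst1 A u = fst1 B u /\ prv A u = prv B u.
Proof.
have Bx : B x by rewrite (proj2 hAB) eqxx.
have hx : x < u by apply: hB.
move: hne; case: (fstP B u) => [n0|a ha Ba na].
  by have := n0 x hx; rewrite Bx.
case: (prvP B u) => [n0|b hb Bb nb] n n1 n2.
  by have := n0 x hx; rewrite Bx.
split.
  by apply: fstE => // [|z hz]; rewrite inA ?Ba ?negb_and ?na //=; lia.
by apply: prvE => // [|z hz]; rewrite inA ?Bb ?negb_and ?nb //=; lia.
Qed.

Lemma inner_fst_prv0 : (fi == 0) = (pi == 0).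
Proof. exact: fst_prv0. Qed.

Lemma inner_range : fi != 0 ->
  [/\ fst1 B u < fi, fi < prv B u, fst1 B u < pi & pi < prv B u].
Proof.
move=> h; have := inner_fst_prv0; rewrite (negbTE h) => /esym/negbT h'.
move: h h'; rewrite /fi /pi; case: (fstP (inner u B) u) => // r hr Ir _ _.
case: prvP => // s hs Is _ _.
have /and3P[_ ? ?] := inner_between hB Ir.
by have /and3P[_ ? ?] := inner_between hB Is.
Qed.

Lemma delete_pair : fi = 0 ->
  (x.+1 == fst1 B u) || (x.+1 == prv B u) /\
  (fst1 A u = prv A u /\
   prv A u = if x.+1 == fst1 B u then prv B u else fst1 B u).
Proof.
move=> h0; have p0 : pi = 0 by apply/eqP; rewrite -inner_fst_prv0 h0.
have Bx : B x by rewrite (proj2 hAB) eqxx.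
have hx : x < u by apply: hB.
have hor : (x.+1 == fst1 B u) || (x.+1 == prv B u).
  move: h0; rewrite /fi; case: fstP => // n _; have := n x hx.
  by rewrite /inner Bx /=; case: eqP => //= _; case: eqP.
split=> //; case: eqP hor => [e _|_ /= /eqP e].
  by have [-> ->] := delete_min e; rewrite h0.
by have [-> ->] := delete_max e; rewrite p0.
Qed.

(** Deleting [x] from [B] is inserting it into [A] read backwards: what leaves the children is the
    element that the insertion would have pushed into them. It is expressed here by the extrema of
    [B] and of its inner set, which a deletion can read. *)
Lemma delete_promoted : fi != 0 -> fst1 A u != prv A u /\
  if x.+1 == fst1 B u then
    [/\ fst1 A u = fi, prv A u = prv B u & promoted u A x = fi.-1]
  else if x.+1 == prv B u then
    [/\ fst1 A u = fst1 B u, prv A u = pi & promoted u A x = pi.-1]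
  else [/\ fst1 A u = fst1 B u, prv A u = prv B u & promoted u A x = x].
Proof.
move=> h0; have [r1 r2 r3 r4] := inner_range h0.
have p0 : pi != 0 by rewrite -inner_fst_prv0.
rewrite /promoted; case: (x.+1 =P fst1 B u) => [e|n1].
  have [-> ->] := delete_min e; rewrite (negbTE h0); split; first by lia.
  by rewrite e r1.
case: (x.+1 =P prv B u) => [e|n2].
  have [-> ->] := delete_max e; rewrite (negbTE p0); split; first by lia.
  by rewrite e; split=> //; case: ltnP => // k1; rewrite ?r4 //; lia.
have [-> ->] := delete_mid (introN eqP n1) (introN eqP n2); split=> //.
have Bx : B x by rewrite (proj2 hAB) eqxx.
have /andP[k1 k2] := mem_between hB Bx.
by split=> //; case: ltnP => [|_]; [lia | case: ltnP => //; lia].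
Qed.

End NodeDelete.

Lemma prv_le S u : prv S u <= u.
Proof. by case: prvP. Qed.

(** * The tree as a table of extrema, and its updates *)

Section Tree.
Variables (k : nat) (q u : nat -> nat).
Hypotheses (q_gt0 : forall d, 0 < q d)
  (u_sq : forall d, d <= k -> u d <= q d * q d)
  (uS : forall d, u d.+1 = q d) (uk : u k <= 2).

(** Node [id] of depth [e] has the children [id * (q e).+1] (the summary) and
    [id * (q e).+1 + h.+1] (cluster [h]) of depth [e.+1]. *)
Fixpoint cont (S : pred nat) (d id : nat) : pred nat :=
  if d is e.+1 then
    child (q e) (inner (u e) (cont S e (id %/ (q e).+1))) (id %% (q e).+1)
  else if id == 0 then S else pred0.

Definition nodeval (S : pred nat) (d id : nat) : nat * nat :=
  (fst1 (cont S d id) (u d), prv (cont S d id) (u d)).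

Fixpoint anc (d d' id : nat) : nat :=
  if d' == d then id else
  if d' is e.+1 then anc d e (id %/ (q e).+1) else 0.

Definition upd2 (V : nat -> nat -> nat * nat) d id v d' id' :=
  if (d' == d) && (id' == id) then v else V d' id'.

Definition sub d id d' id' := (d <= d') && (anc d d' id' == id).

Lemma anc_id d id : anc d d id = id.
Proof. by case: d => [|d] //=; rewrite eqxx. Qed.

Lemma ancS d d' id : d < d' -> anc d d' id = anc d.+1 d' id %/ (q d).+1.
Proof.
elim: d' id => // e IH id; rewrite ltnS leq_eqVlt => /orP[/eqP<-|h].
  rewrite anc_id /=; case: eqP => [|_]; first by lia.
  by rewrite anc_id.
rewrite /= eqSS; case: eqP => [|_]; first by lia.
case: eqP => [|_]; [by lia | exact: IH].
Qed.

(** The content of a node is computed along the path from the root, hence from the content of any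
    ancestor; this confines an update to one subtree. *)
Lemma cont_anc X Y d d' id : d <= d' ->
  cont X d (anc d d' id) =1 cont Y d (anc d d' id) ->
  cont X d' id =1 cont Y d' id.
Proof.
elim: d' id => [|e IH] id; first by rewrite leqn0 => /eqP->; rewrite anc_id.
rewrite leq_eqVlt => /orP[/eqP->|h]; first by rewrite anc_id.
rewrite /= (_ : e.+1 == d = false); last by lia.
by move=> /(IH _ h) E; apply/eq_child/eq_inner.
Qed.

Lemma eq_nodeval X Y d id : cont X d id =1 cont Y d id ->
  nodeval X d id = nodeval Y d id.
Proof. by move=> e; rewrite /nodeval (eq_fst1 _ e) (eq_prv _ e). Qed.

Lemma cont_child S d id c : c <= q d ->
  cont S d.+1 (id * (q d).+1 + c) = child (q d) (inner (u d) (cont S d id)) c.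
Proof.
by move=> hc; rewrite /= divnMDl // modnMDl divn_small ?modn_small // addn0.
Qed.

Lemma cont_bounded S d id : bounded S (u 0) -> d <= k.+1 ->
  bounded (cont S d id) (u d).
Proof.
move=> hb; elim: d id => [|d IH] id hd; first by move=> y /=; case: eqP => // _ /hb.
rewrite uS; apply/bounded_child/bounded_inner => y hy.
by apply: leq_trans (u_sq _) => //; apply: IH hy; apply: ltnW.
Qed.

Lemma inner_leaf S id y : bounded S (u 0) -> inner (u k) (cont S k id) y = false.
Proof.
move=> hb; apply/negP=> h.
have := inner_between (cont_bounded (id := id) hb (leqnSn k)) h.
have := prv_le (cont S k id) (u k); lia.
Qed.

(** Deletion and search thus need no base case: at depth [k] they read the children like any others
    and find them empty. *)
Lemma cont_leaf S id y : bounded S (u 0) -> cont S k.+1 id y = false.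
Proof.
move=> hb; rewrite /=; set I := inner _ _.
have hI z : I z = false by apply: inner_leaf.
case: (id %% _) => [|c] /=; last by rewrite /cluster hI andbF.
by apply/negP=> /summaryP[l _]; rewrite hI.
Qed.

(** The state of the table in the course of an update from [X] to [Y] that still
    has to treat the subtree of node [id] of depth [d]. *)
Definition partial X Y (V : nat -> nat -> nat * nat) d id : Prop :=
  forall d' id', d' <= k.+1 ->
    V d' id' = if sub d id d' id' then nodeval X d' id' else nodeval Y d' id'.

Definition node_ok A B d id x : Prop :=
  [/\ d <= k.+1, x < u d & add1 (cont A d id) x (cont B d id)].

Lemma partial_id X Y V d id : d <= k.+1 -> partial X Y V d id ->
  V d id = nodeval X d id.
Proof. by move=> hd ->; rewrite // /sub leqnn anc_id eqxx. Qed.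

Lemma sub_child d id c d' id' : c <= q d -> d < d' ->
  sub d id d' id' -> anc d.+1 d' id' %% (q d).+1 = c ->
  sub d.+1 (id * (q d).+1 + c) d' id'.
Proof.
move=> hc hd /andP[_ /eqP<-] <-; rewrite /sub hd (ancS _ hd).
by rewrite -divn_eq eqxx.
Qed.

Lemma child_sub d id c d' id' : c <= q d ->
  sub d.+1 (id * (q d).+1 + c) d' id' -> sub d id d' id' /\ d < d'.
Proof.
move=> hc /andP[hd /eqP e]; split=> //; rewrite /sub ltnW // ancS // e.
by rewrite divnMDl // divn_small ?addn0 ?eqxx.
Qed.

Lemma partial_val_child X Y V d id c : d <= k -> c <= q d ->
  partial X Y V d id ->
  V d.+1 (id * (q d).+1 + c) =
  (fst1 (child (q d) (inner (u d) (cont X d id)) c) (q d),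
   prv (child (q d) (inner (u d) (cont X d id)) c) (q d)).
Proof.
move=> hd hc -> //; rewrite /sub leqnSn ancS // anc_id divnMDl //.
by rewrite divn_small // addn0 eqxx /nodeval cont_child // uS.
Qed.

(** Descendants depend on a node only through its inner set; if this set does not change, writing
    the extrema of the node completes the update. *)
Lemma finish X Y V d id v : d <= k -> partial X Y V d id ->
  inner (u d) (cont X d id) =1 inner (u d) (cont Y d id) ->
  v = nodeval Y d id ->
  forall d' id', d' <= k.+1 -> upd2 V d id v d' id' = nodeval Y d' id'.
Proof.
move=> hd hp hi -> d' id' hd'; rewrite /upd2.
case: eqP => [->|nd] /=; first case: eqP => [-> //|nid].
  by rewrite hp ?(leqW hd) // /sub leqnn anc_id; case: eqP.
rewrite hp //; case: ifP => // hs; apply: eq_nodeval.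
have hlt : d < d' by case/andP: hs; rewrite leq_eqVlt => /orP[/eqP|//]; lia.
apply: (cont_anc hlt); move: hs; rewrite /sub ancS // => /andP[_ /eqP e].
by rewrite /= e; apply/eq_child.
Qed.

Lemma descend X Y V V' d id c : d <= k -> partial X Y V d id -> c <= q d ->
  (forall d' id', d' <= k.+1 ->
     V' d' id' = upd2 V d id (nodeval Y d id) d' id') ->
  (forall c', c' <= q d -> c' != c ->
    child (q d) (inner (u d) (cont X d id)) c' =1
    child (q d) (inner (u d) (cont Y d id)) c') ->
  partial X Y V' d.+1 (id * (q d).+1 + c).
Proof.
move=> hd hp hc hV hch d' id' hd'; rewrite hV // /upd2.
case: ifP => [/andP[/eqP-> /eqP->]|hn].
  by rewrite /sub ltnn.
rewrite hp //; case: ifP => hs; last first.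
  by case: ifP => // /(child_sub hc)[]; rewrite hs.
case: ifP => // hns; apply: eq_nodeval.
have hlt : d < d'.
  case/andP: (hs); rewrite leq_eqVlt => /orP[/eqP e|//].
  by move: hn; rewrite -e anc_id eqxx /= => ->.
apply: (cont_anc hlt); have ha := divn_eq (anc d.+1 d' id') (q d).+1.
rewrite -ancS // (eqP (andP hs).2) in ha.
have hm : anc d.+1 d' id' %% (q d).+1 <= q d by rewrite -ltnS ltn_mod.
rewrite ha !cont_child //; apply: hch => //.
by apply/eqP=> e; move: hns; rewrite (sub_child hc hlt hs e).
Qed.

(** Serves a cluster that passes between empty and a singleton: its inner set is empty before and
    after, so one write finishes its subtree and only the summary is left. *)
Lemma descend0 X Y V V' d id c : d < k -> partial X Y V d id -> c < q d ->
  (forall d' id', d' <= k.+1 -> V' d' id' =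
     upd2 (upd2 V d id (nodeval Y d id)) d.+1 (id * (q d).+1 + c.+1)
       (nodeval Y d.+1 (id * (q d).+1 + c.+1)) d' id') ->
  (forall c', c' < q d -> c' != c ->
    cluster (q d) (inner (u d) (cont X d id)) c' =1
    cluster (q d) (inner (u d) (cont Y d id)) c') ->
  inner (q d) (cluster (q d) (inner (u d) (cont X d id)) c) =1
  inner (q d) (cluster (q d) (inner (u d) (cont Y d id)) c) ->
  partial X Y V' d.+1 (id * (q d).+1).
Proof.
move=> hd hp hc hV hch hin d' id' hd'; rewrite hV // {1}/upd2.
set ch := id * _ + c.+1.
have cid : id * (q d).+1 = id * (q d).+1 + 0 by rewrite addn0.
case: ifP => [/andP[/eqP-> /eqP->]|hn1].
  by rewrite /sub leqnn anc_id; case: eqP => //; rewrite /ch; lia.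
rewrite /upd2; case: ifP => [/andP[/eqP-> /eqP->]|hn].
  by rewrite /sub ltnn.
rewrite hp //; case: ifP => hs; last first.
  by case: ifP => //; rewrite cid => /(child_sub (leq0n _))[]; rewrite hs.
case: ifP => // hns; apply: eq_nodeval.
have hlt : d < d'.
  case/andP: (hs); rewrite leq_eqVlt => /orP[/eqP e|//].
  by move: hn; rewrite -e anc_id eqxx /= => ->.
have ha := divn_eq (anc d.+1 d' id') (q d).+1.
rewrite -ancS // (eqP (andP hs).2) in ha.
have hm : anc d.+1 d' id' %% (q d).+1 <= q d by rewrite -ltnS ltn_mod.
case em : (anc d.+1 d' id' %% (q d).+1) => [|c'].
  by move: hns; rewrite cid (sub_child (leq0n _) hlt hs em).
rewrite em in ha hm.
case: (c' =P c) => [ec|/eqP nc]; last first.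
  by apply: (cont_anc hlt); rewrite ha !cont_child //; apply: hch.
rewrite ec -/ch in ha.
have hlt2 : d.+1 < d'.
  rewrite ltn_neqAle hlt andbT; apply/eqP=> e; move: hn1.
  by rewrite -ha -e anc_id !eqxx.
apply: (cont_anc hlt2); move: ha; rewrite /= -ancS // => ->.
apply: eq_child; have /= := @cont_child X d id c.+1 hc => ->.
by have /= := @cont_child Y d id c.+1 hc => ->; rewrite uS.
Qed.

Lemma eq_inner_pair S v y : bounded S v -> fst1 S v = prv S v ->
  inner v S y = false.
Proof. by move=> h e; apply: inner_single. Qed.

Lemma div_lt d x : d <= k -> x < u d -> x %/ q d < q d.
Proof. by move=> hd hx; rewrite ltn_divLR //; apply: leq_trans hx (u_sq hd). Qed.

Lemma node_leaf A B d id x : bounded B (u 0) -> node_ok A B d id x -> d <= k.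
Proof.
move=> hb [hd _ [_ e]]; move: hd; rewrite leq_eqVlt => /orP[/eqP ed|//].
by have := e x; rewrite eqxx ed cont_leaf.
Qed.

Section Step.
Variables (A B : pred nat) (d id x : nat).
Hypotheses (hA : bounded A (u 0)) (hB : bounded B (u 0)).
Hypothesis hn : node_ok A B d id x.

Let hd : d <= k. Proof. exact: node_leaf hB hn. Qed.
Let hA1 : bounded (cont A d id) (u d). Proof. by apply: cont_bounded => //; lia. Qed.
Let hB1 : bounded (cont B d id) (u d). Proof. by apply: cont_bounded => //; lia. Qed.
Let hadd : add1 (cont A d id) x (cont B d id). Proof. by case: hn. Qed.
Let hx : x < u d. Proof. by case: hn. Qed.

Definition prom (v : nat * nat) : nat :=
  if x.+1 < v.1 then v.1.-1 else if v.2 < x.+1 then v.2.-1 else x.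

Let x' := prom (nodeval A d id).
Let h := x' %/ q d.
Let l := x' %% q d.
Let sid := id * (q d).+1.
Let cid := sid + h.+1.

Lemma step_facts : (nodeval A d id).1 != (nodeval A d id).2 ->
  [/\ d < k, x' < u d, h < q d,
      add1 (inner (u d) (cont A d id)) x' (inner (u d) (cont B d id))
    & forall c', c' < q d -> c' != h ->
        cluster (q d) (inner (u d) (cont A d id)) c' =1
        cluster (q d) (inner (u d) (cont B d id)) c'].
Proof.
move=> hne; have [hi hx'] := add1_inner hx hadd hne.
split=> //.
(* At depth [k] inner sets are empty, whereas that of [B] has just gained an element. *)
- rewrite ltn_neqAle hd andbT; apply/eqP=> e.
  have [_ /(_ (promoted (u d) (cont A d id) x))] := hi.
  by rewrite eqxx {1 2}e inner_leaf.
- exact: div_lt.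
- by move=> c' _; apply: add1_cluster_neq hi _.
Qed.

Lemma step_child : (nodeval A d id).1 != (nodeval A d id).2 ->
  (nodeval A d.+1 cid).1 <> 0 -> node_ok A B d.+1 cid l /\
  forall c', c' <= q d -> c' != h.+1 ->
    child (q d) (inner (u d) (cont A d id)) c' =1
    child (q d) (inner (u d) (cont B d id)) c'.
Proof.
move=> hne hc; have [hk hx' hh hi hcl] := step_facts hne.
split; last first.
  move=> [|c'] h1 h2; last by apply: hcl => //; rewrite eqSS in h2.
  apply: add1_summary1 hi _ => //; apply/eqP.
  by move: hc; rewrite /nodeval cont_child // uS.
split; first by lia.
  by rewrite uS ltn_mod.
by rewrite !cont_child //; apply: add1_cluster.
Qed.

Lemma step_summary : (nodeval A d id).1 != (nodeval A d id).2 ->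
  (nodeval A d.+1 cid).1 = 0 -> [/\ node_ok A B d.+1 sid h,
    inner (q d) (cluster (q d) (inner (u d) (cont A d id)) h) =1
    inner (q d) (cluster (q d) (inner (u d) (cont B d id)) h)
  & nodeval A d.+1 cid = (0, 0) /\ nodeval B d.+1 cid = (l.+1, l.+1)].
Proof.
move=> hne; have [hk hx' hh hi hcl] := step_facts hne.
have hcl1 : add1 (cluster (q d) (inner (u d) (cont A d id)) h) l
           (cluster (q d) (inner (u d) (cont B d id)) h) by apply: add1_cluster.
have hl : l < q d by rewrite ltn_mod.
have bA : bounded (cluster (q d) (inner (u d) (cont A d id)) h) (q d).
  by move=> y /andP[].
have bB : bounded (cluster (q d) (inner (u d) (cont B d id)) h) (q d).
  by move=> y /andP[].
rewrite /nodeval !cont_child //= uS => hc.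
have hp0 : prv (cluster (q d) (inner (u d) (cont A d id)) h) (q d) = 0.
  by apply/eqP; rewrite -fst_prv0 hc.
split.
- split; first by lia.
    by rewrite uS.
  rewrite /sid -[id * _]addn0 !cont_child //; apply: add1_summary0 => //.
- move=> y; rewrite !eq_inner_pair // ?hc ?hp0 //.
  by apply/eqP; rewrite -(add1_single hl hcl1) hc.
- by rewrite hc hp0 (add1_fst hl hcl1) (add1_prv hl hcl1) hc hp0 max0n.
Qed.

Lemma insert_empty V : partial A B V d id -> (V d id).1 = 0 ->
  forall d' id', d' <= k.+1 ->
    upd2 V d id (x.+1, x.+1) d' id' = nodeval B d' id'.
Proof.
move=> hp; rewrite (partial_id _ hp) ?(leqW hd) // => h0.
have p0 : prv (cont A d id) (u d) = 0 by apply/eqP; rewrite -fst_prv0; apply/eqP.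
have b1 := add1_fst hx hadd; have b2 := add1_prv hx hadd.
rewrite /nodeval /= in h0; rewrite h0 p0 /= max0n in b1 b2.
apply: (finish hd hp); last by rewrite /nodeval b1 b2.
by move=> y; rewrite !eq_inner_pair // ?h0 ?p0 ?b1 ?b2.
Qed.

Lemma insert_single V m : partial A B V d id -> (V d id) = (m.+1, m.+1) ->
  forall d' id', d' <= k.+1 ->
    upd2 V d id (minn m.+1 x.+1, maxn m.+1 x.+1) d' id' = nodeval B d' id'.
Proof.
move=> hp; rewrite (partial_id _ hp) ?(leqW hd) // => -[h1 h2].
have b1 := add1_fst hx hadd; have b2 := add1_prv hx hadd.
rewrite h1 h2 /= in b1 b2.
apply: (finish hd hp); last by rewrite /nodeval b1 b2.
move=> y; rewrite (eq_inner_pair _ hA1) ?h1 ?h2 //.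
apply/esym/negP=> hy; have := inner_between hB1 hy; rewrite b1 b2.
case/and3P: hy; rewrite (proj2 hadd) => /orP[/eqP-> _ _|/(mem_between hA1)].
  by lia.
by rewrite h1 h2; lia.
Qed.

Lemma insert_val : (nodeval A d id).1 != (nodeval A d id).2 ->
  nodeval B d id = (minn (nodeval A d id).1 x.+1, maxn (nodeval A d id).2 x.+1).
Proof.
have b1 := add1_fst hx hadd; have b2 := add1_prv hx hadd.
move=> hne; have hz : fst1 (cont A d id) (u d) != 0.
  by apply: contraNneq hne => h0; rewrite /nodeval /= h0 eq_sym -fst_prv0 h0.
by rewrite /nodeval b1 b2 (negbTE hz).
Qed.

Lemma insert_child V V' : partial A B V d id -> (V d id).1 != (V d id).2 ->
  x' = prom (V d id) /\ d < k /\ h < q d /\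
  ((forall d' id', d' <= k.+1 -> V' d' id' = upd2 V d id
       (minn (V d id).1 x.+1, maxn (V d id).2 x.+1) d' id') ->
   (V d.+1 cid).1 <> 0 ->
   partial A B V' d.+1 cid /\ node_ok A B d.+1 cid l).
Proof.
move=> hp; rewrite (partial_id _ hp) ?(leqW hd) // => hne.
have [hk hx' hh hi hcl] := step_facts hne; do 3 split=> //.
  move=> hV' hc.
  have hce : V d.+1 cid = nodeval A d.+1 cid.
    rewrite hp // /sub leqnSn ancS // anc_id /cid /sid divnMDl //.
    by rewrite divn_small // addn0 eqxx.
  rewrite hce in hc; have [ho hch] := step_child hne hc; split=> //.
  apply: (descend (V := V)) => // d' id' hd'.
  by rewrite hV' // insert_val.
Qed.

Lemma insert_summary V V' : partial A B V d id -> (V d id).1 != (V d id).2 ->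
  (V d.+1 cid).1 = 0 ->
  (forall d' id', d' <= k.+1 -> V' d' id' = upd2 (upd2 V d id
       (minn (V d id).1 x.+1, maxn (V d id).2 x.+1)) d.+1 cid
       (l.+1, l.+1) d' id') ->
   partial A B V' d.+1 sid /\ node_ok A B d.+1 sid h.
Proof.
move=> hp; rewrite (partial_id _ hp) ?(leqW hd) // => hne.
have [hk hx' hh hi hcl] := step_facts hne.
have hce : V d.+1 cid = nodeval A d.+1 cid.
  rewrite hp // /sub leqnSn ancS // anc_id /cid /sid divnMDl //.
  by rewrite divn_small // addn0 eqxx.
rewrite hce => hc hV'; have [ho hin [_ hvB]] := step_summary hne hc; split=> //.
apply: (@descend0 A B V V' d id h) => // d' id' hd'.
by rewrite hV' // -insert_val // -hvB.
Qed.

Lemma delete_single V : partial B A V d id -> (V d id).1 = (V d id).2 ->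
  forall d' id', d' <= k.+1 ->
    upd2 V d id (0, 0) d' id' = nodeval A d' id'.
Proof.
move=> hp; rewrite (partial_id _ hp) ?(leqW hd) // => h0.
have f0 : fst1 (cont A d id) (u d) = 0.
  by apply/eqP; rewrite (add1_single hx hadd); apply/eqP.
have p0 : prv (cont A d id) (u d) = 0 by apply/eqP; rewrite -fst_prv0 f0.
apply: (finish hd hp); last by rewrite /nodeval f0 p0.
by move=> y; rewrite !eq_inner_pair // f0 p0.
Qed.

Let hB2 : bounded (inner (u d) (cont B d id)) (q d * q d).
Proof.
by apply: bounded_inner => y hy; apply: leq_trans (u_sq hd); apply: hB1.
Qed.

Lemma summary_val V : partial B A V d id ->
  V d.+1 sid = (fst1 (summary (q d) (inner (u d) (cont B d id))) (q d),
                prv (summary (q d) (inner (u d) (cont B d id))) (q d)).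
Proof.
by move=> hp; rewrite /sid -[id * _]addn0 (partial_val_child hd _ hp).
Qed.

Lemma inner_fst V : partial B A V d id ->
  fst1 (inner (u d) (cont B d id)) (q d * q d) =
  if (V d.+1 sid).1 is r.+1
  then r * q d + (V d.+1 (sid + r.+1)).1 else 0.
Proof.
move=> hp; rewrite (summary_val hp) fst_cluster //=.
case: fstP => // r hr _ _.
by rewrite (partial_val_child hd _ hp).
Qed.

Lemma inner_prv V : partial B A V d id ->
  prv (inner (u d) (cont B d id)) (q d * q d) =
  if (V d.+1 sid).2 is r.+1
  then r * q d + (V d.+1 (sid + r.+1)).2 else 0.
Proof.
move=> hp; rewrite (summary_val hp) (prv_cluster _ _ (q_gt0 d)) /=.
rewrite mulnK // modnMl /=; case: prvP => // r hr _ _.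
by rewrite (partial_val_child hd _ hp).
Qed.

(** The universe of a node may be smaller than the square that its clusters span; in the leaves of
    the actual tree it is 2 against 4. *)
Lemma inner_wide : fst1 (inner (u d) (cont B d id)) (q d * q d) =
    fst1 (inner (u d) (cont B d id)) (u d) /\
  prv (inner (u d) (cont B d id)) (q d * q d) =
    prv (inner (u d) (cont B d id)) (u d).
Proof.
have hb : bounded (inner (u d) (cont B d id)) (u d) by apply: bounded_inner.
by rewrite (fst_widen hb (u_sq hd)) (prv_widen hb (u_sq hd)).
Qed.

Lemma summary_fst0 V : partial B A V d id ->
  ((V d.+1 sid).1 == 0) = (fst1 (inner (u d) (cont B d id)) (u d) == 0).
Proof.
move=> hp; rewrite -(proj1 inner_wide) (inner_fst hp).
case e: (V d.+1 sid).1 => [|r] //.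
move: e; rewrite (summary_val hp) /=; case: fstP => // r' hr /summaryP[z hz Iz] _ [<-].
rewrite (partial_val_child hd _ hp) //=; case: fstP => [n|]; last by lia.
by have := n z hz; rewrite /cluster hz Iz.
Qed.

Lemma delete_two V v : partial B A V d id -> (V d id).1 != (V d id).2 ->
  (V d.+1 sid).1 = 0 ->
  v = (if x.+1 == (V d id).1 then (V d id).2 else (V d id).1) ->
  ((x.+1 == (V d id).1) || (x.+1 == (V d id).2)) /\
  forall d' id', d' <= k.+1 ->
    upd2 V d id (v, v) d' id' = nodeval A d' id'.
Proof.
move=> hp + /eqP; rewrite (summary_fst0 hp) (partial_id _ hp) ?(leqW hd) //.
move=> hne /eqP h0; rewrite /nodeval /= => ev.
have [hor [e1 e2]] := delete_pair hB1 hadd hne h0; split=> //.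
apply: (finish hd hp); last by rewrite /nodeval e1 e2 ev.
move=> y; rewrite (eq_inner_pair _ hA1) //; apply/negP=> hy.
move: h0; case: fstP => // n _; have := n y; rewrite hy.
by case/and3P: hy => /hB1 -> _ _ /(_ isT).
Qed.

(** The extrema of the inner set are read off the summary and its first and last nonempty clusters,
    all of them still in their old state. *)
Lemma delete_step V fi pi v x2 : partial B A V d id ->
  (V d id).1 != (V d id).2 -> (V d.+1 sid).1 <> 0 ->
  fi = ((V d.+1 sid).1).-1 * q d + (V d.+1 (sid + (V d.+1 sid).1)).1 ->
  pi = ((V d.+1 sid).2).-1 * q d + (V d.+1 (sid + (V d.+1 sid).2)).2 ->
  x2 = (if x.+1 == (V d id).1 then fi.-1
        else if x.+1 == (V d id).2 then pi.-1 else x) ->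
  v = (if x.+1 == (V d id).1 then (fi, (V d id).2)
       else if x.+1 == (V d id).2 then ((V d id).1, pi) else V d id) ->
  [/\ x2 = x', v = nodeval A d id & (nodeval A d id).1 != (nodeval A d id).2].
Proof.
move=> hp; rewrite {1 2}(partial_id _ hp) ?(leqW hd) // => hne hs efi epi.
have hI : fst1 (inner (u d) (cont B d id)) (u d) != 0.
  by rewrite -(summary_fst0 hp); apply/eqP.
have hPI : prv (inner (u d) (cont B d id)) (u d) != 0 by rewrite -fst_prv0.
have hfi : fi = fst1 (inner (u d) (cont B d id)) (u d).
  rewrite -(proj1 inner_wide) (inner_fst hp) efi.
  by case: (V d.+1 sid).1 hs.
have hpi : pi = prv (inner (u d) (cont B d id)) (u d).
  move: hPI; rewrite -(proj2 inner_wide) (inner_prv hp) epi.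
  by case: (V d.+1 sid).2.
rewrite (partial_id _ hp) ?(leqW hd) // /x' /prom.
have [hneA] := delete_promoted hB1 hadd hne hI.
rewrite /promoted -hfi -hpi /nodeval /=.
by case: ifP => _; [|case: ifP => _] => -[e1 e2 e3] -> ->;
  split; rewrite ?e3 // ?e1 ?e2.
Qed.

Lemma delete_child V V' : partial B A V d id ->
  (nodeval A d id).1 != (nodeval A d id).2 ->
  (V d.+1 cid).1 != (V d.+1 cid).2 ->
  (forall d' id', d' <= k.+1 -> V' d' id' = upd2 V d id
       (nodeval A d id) d' id') ->
  partial B A V' d.+1 cid /\ node_ok A B d.+1 cid l.
Proof.
move=> hp hne; have [hk hx' hh hi hcl] := step_facts hne.
have hce : V d.+1 cid = nodeval B d.+1 cid.
  rewrite hp // /sub leqnSn ancS // anc_id /cid /sid divnMDl //.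
  by rewrite divn_small // addn0 eqxx.
rewrite hce => hc hV'.
(* If the cluster were empty in [A], it would be a singleton in [B] and its extrema would
   coincide. *)
have hc' : (nodeval A d.+1 cid).1 <> 0.
  move=> /(step_summary hne)[_ _ [_ e]].
  by rewrite e eqxx in hc.
have [ho hch] := step_child hne hc'; split=> //.
apply: (descend (V := V)) => // c' h1 h2 y; apply/esym; exact: hch.
Qed.

Lemma delete_summary V V' : partial B A V d id ->
  (nodeval A d id).1 != (nodeval A d id).2 ->
  (V d.+1 cid).1 = (V d.+1 cid).2 ->
  (forall d' id', d' <= k.+1 -> V' d' id' =
     upd2 (upd2 V d id (nodeval A d id)) d.+1 cid (0, 0) d' id') ->
  partial B A V' d.+1 sid /\ node_ok A B d.+1 sid h.
Proof.
move=> hp hne; have [hk hx' hh hi hcl] := step_facts hne.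
have hce : V d.+1 cid = nodeval B d.+1 cid.
  rewrite hp // /sub leqnSn ancS // anc_id /cid /sid divnMDl //.
  by rewrite divn_small // addn0 eqxx.
have hcl1 : add1 (cluster (q d) (inner (u d) (cont A d id)) h) l
           (cluster (q d) (inner (u d) (cont B d id)) h) by apply: add1_cluster.
have hl : l < q d by rewrite ltn_mod.
rewrite hce => hc hV'.
have hc' : (nodeval A d.+1 cid).1 = 0.
  apply/eqP; move/eqP: hc; rewrite /nodeval !cont_child //= uS.
  by rewrite -(add1_single hl hcl1).
have [ho hin [hvA _]] := step_summary hne hc'; split=> //.
apply: (@descend0 B A V V' d id h) => //.
- by move=> d' id' hd'; rewrite hV' // hvA.
- by move=> c' h1 h2 y; apply/esym; apply: hcl.
Qed.

End Step.

(** * Predecessor search *)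

Section Predecessor.
Variables (S : pred nat) (V : nat -> nat -> nat * nat).
Hypothesis hS : bounded S (u 0).
Hypothesis hV : forall d id, d <= k.+1 -> V d id = nodeval S d id.

(** Climbs from node [id] of depth [d], where the predecessor is [r], to the
    predecessor in the whole set: the path to the root is read off [id]. *)
Fixpoint unwind (d id r : nat) : nat :=
  if d is e.+1 then
    let pid := id %/ (q e).+1 in
    unwind e pid
      (if id %% (q e).+1 is h.+1 then h * q e + r
       else if r is r'.+1
            then r' * q e + (V e.+1 (pid * (q e).+1 + r'.+1)).2
            else (V e pid).1)
  else r.

Lemma pred_none d id x : d <= k.+1 -> (V d id).1 = 0 -> prv (cont S d id) x = 0.
Proof.
move=> hd; rewrite hV //= => h0; have hb := cont_bounded (id := id) hS hd.
apply: prv0 => y _; apply/negP=> hy; move: h0; case: fstP => // n _.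
by have := n y (hb y hy); rewrite hy.
Qed.

Lemma pred_max d id x : d <= k.+1 -> (V d id).2 <= x ->
  prv (cont S d id) x = (V d id).2.
Proof.
move=> hd; rewrite hV //= => h; apply: prv_ge h; exact: cont_bounded.
Qed.

Lemma pred_min d id x : d <= k.+1 -> x < (V d id).1 -> prv (cont S d id) x = 0.
Proof. by move=> hd; rewrite hV //=; apply: prv_lt. Qed.

(** The value after unwinding is invariant under a step down. This makes the recursion iterative:
    the work pending at each ancestor can be reconstructed from [id] and the table. *)
Lemma pred_step d id x : d <= k.+1 -> (V d id).1 != 0 ->
  (V d id).1 <= x < (V d id).2 ->
  let h := x %/ q d in let l := x %% q d in
  let sid := id * (q d).+1 in let cid := sid + h.+1 in
  [/\ d <= k, h < q d & 
      unwind d id (prv (cont S d id) x) =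
      if 0 < (V d.+1 cid).1 <= l
      then unwind d.+1 cid (prv (cont S d.+1 cid) l)
      else unwind d.+1 sid (prv (cont S d.+1 sid) h)].
Proof.
move=> hd; rewrite (hV _ hd) /= => h0 hx.
have hb := cont_bounded (id := id) hS hd.
have hdk : d <= k.
  move: hd; rewrite leq_eqVlt => /orP[/eqP ed|//].
  by move: h0; rewrite ed; case: fstP => // y hy; rewrite cont_leaf.
have hxu : x < u d by have := prv_le (cont S d id) (u d); lia.
have hh := div_lt hdk hxu.
split=> //; set I := inner (u d) (cont S d id).
have hbI : bounded I (q d * q d).
  by apply: bounded_inner => y hy; apply: leq_trans (u_sq hdk); apply: hb.
have hc : V d.+1 (id * (q d).+1 + (x %/ q d).+1) =
    (fst1 (cluster (q d) I (x %/ q d)) (q d), prv (cluster (q d) I (x %/ q d)) (q d)).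
  by rewrite hV // /nodeval cont_child // uS.
rewrite hc /= fst_le_prv; last by move=> y /andP[].
rewrite (prv_node hb hx h0) -/I (prv_cluster _ _ (q_gt0 d)) -/I.
have E1 : (id * (q d).+1 + (x %/ q d).+1) %/ (q d).+1 = id.
  by rewrite divnMDl // divn_small ?addn0.
have E2 : (id * (q d).+1 + (x %/ q d).+1) %% (q d).+1 = (x %/ q d).+1.
  by rewrite modnMDl modn_small.
rewrite !E1 !E2 modnMl mulnK //= -/I.
case e1: (prv (cluster (q d) I (x %/ q d)) (x %% q d)) => [|r] /=; last first.
  by rewrite addnS.
rewrite -/(summary (q d) I).
case e2: (prv (summary (q d) I) (x %/ q d)) => [|r] /=; first by rewrite hV.
have hr : r < q d.
  by move: e2; case: prvP => // r' hr' _ _ [<-]; apply: ltn_trans hr' hh.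
rewrite hV // /nodeval cont_child // uS /= -/I; congr unwind.
move: e2; case: prvP => // r' hr' /summaryP[z hz Iz] _ [er].
rewrite -er; case e3: (prv (cluster (q d) I r') (q d)) => [|m].
  move: e3; case: prvP => // n; have := n z hz.
  by rewrite /cluster hz Iz.
by rewrite addnS.
Qed.

End Predecessor.
End Tree.

(** * Strips and columns *)

Definition top (s : slab) := s.1.1.1.
Definition bot (s : slab) := s.1.1.2.
Definition lft (s : slab) := s.1.2.
Definition rgt (s : slab) := s.2.

Lemma in_slabE s x y :
  in_slab s x y = (top s <= x <= bot s) && (lft s <= y <= rgt s).
Proof. by case: s => [[[a b] c] e]. Qed.

Section Columns.
Variables (n : nat) (M : 'M[bool]_n) (K : seq slab).
Hypothesis hK : slab_decomposition M K.

Definition active c : seq slab := [seq s <- K | lft s <= c <= rgt s].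
Definition cell c x : bool := has (fun s => top s <= x <= bot s) (active c).
Definition tops c x : bool := has (fun s => top s == x) (active c).
Definition bots c x : bool := has (fun s => (bot s).+1 == x) (active c).
(** Slabs of [K] may be stacked in a column without a gap, hence the second
    conditions in [startc] and [endc].  Ends of strips are exclusive. *)
Definition startc c : pred nat := fun x => tops c x && ~~ bots c x.
Definition endc c : pred nat := fun x => bots c x && ~~ tops c x.

Definition strip c a e : Prop :=
  [/\ a < e, forall x, a <= x < e -> cell c x, ~~ cell c a.-1 & ~~ cell c e].

Definition touched c x : bool :=
  has (fun s => ((lft s == c) || ((rgt s).+1 == c)) &&
                ((x == top s) || (x == (bot s).+1))) K.

Lemma slab_bounds s : s \in K ->
  [/\ 1 <= top s, top s <= bot s, bot s <= n, 1 <= lft s & lft s <= rgt s <= n].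
Proof.
case: hK => _ h _ _ /h; case: s => [[[a b] c] e] /and5P[? ? ? ? /and3P[? ? _]].
by split=> //; apply/andP.
Qed.

Lemma active_disjoint c s t x : s \in active c -> t \in active c ->
  top s <= x <= bot s -> top t <= x <= bot t -> s = t.
Proof.
rewrite !mem_filter => /andP[sc sK] /andP[tc tK] hs ht.
case: (s =P t) => // ne; case: hK => _ _ hd _.
by case: (hd s t sK tK ne x c); rewrite !in_slabE hs ht sc tc.
Qed.

Lemma active_bounds c s : s \in active c ->
  [/\ s \in K, 1 <= top s, top s <= bot s, bot s <= n & 1 <= c <= n].
Proof.
rewrite mem_filter => /andP[h sK]; have [? ? ? ? ?] := slab_bounds sK.
by split=> //; lia.
Qed.

Lemma cellP c x :
  reflect (exists2 s, s \in active c & top s <= x <= bot s) (cell c x).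
Proof. exact: hasP. Qed.

Lemma cell_bounds c x : cell c x -> 1 <= x <= n /\ 1 <= c <= n.
Proof. by case/cellP=> s /active_bounds[_ h1 h2 h3 h4] ?; split=> //; lia. Qed.

Lemma cell0 c : cell c 0 = false.
Proof. by apply/negP=> /cell_bounds[]. Qed.

Lemma topsP c x : reflect (exists2 s, s \in active c & x = top s) (tops c x).
Proof.
apply: (iffP hasP) => -[s hs]; first by move/eqP; exists s.
by move=> ->; exists s.
Qed.

Lemma botsP c x :
  reflect (exists2 s, s \in active c & x = (bot s).+1) (bots c x).
Proof.
apply: (iffP hasP) => -[s hs]; first by move/eqP; exists s.
by move=> ->; exists s.
Qed.

(** If a slab begins at [x], another one covering [x.-1] would either cover [x] too, against
    disjointness, or end just before [x], against the second condition of [startc]. *)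
Lemma startcP c x : startc c x = cell c x && ~~ cell c x.-1.
Proof.
apply/andP/andP=> -[].
  move=> /topsP[s hs ex] /botsP hb.
  have [_ h1 h2 _ _] := active_bounds hs.
  split; first by apply/cellP; exists s => //; lia.
  apply/cellP=> -[t ht hx]; case: hb.
  have [_ k1 k2 _ _] := active_bounds ht.
  case: (leqP x (bot t)) => k.
    have : s = t by apply: (@active_disjoint c s t x) => //; lia.
    by move=> e; rewrite -e in hx; lia.
  by exists t => //; lia.
move=> /cellP[s hs hx] hn; have [_ h1 h2 _ _] := active_bounds hs.
have ex : x = top s.
  case: (x =P top s) => // ne; case/negP: hn; apply/cellP; exists s => //; lia.
split; first by apply/topsP; exists s.
apply/botsP=> -[t ht et]; have [_ k1 k2 _ _] := active_bounds ht.
by case/negP: hn; apply/cellP; exists t => //; lia.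
Qed.

Lemma endcP c x : 0 < x -> endc c x = cell c x.-1 && ~~ cell c x.
Proof.
move=> x0; apply/andP/andP=> -[].
  move=> /botsP[s hs ex] /topsP hb.
  have [_ h1 h2 _ _] := active_bounds hs.
  split; first by apply/cellP; exists s => //; lia.
  apply/cellP=> -[t ht hx]; case: hb.
  have [_ k1 k2 _ _] := active_bounds ht.
  case: (leqP (top t) x.-1) => k.
    have : s = t by apply: (@active_disjoint c s t x.-1) => //; lia.
    by move=> e; rewrite -e in hx; lia.
  by exists t => //; lia.
move=> /cellP[s hs hx] hn; have [_ h1 h2 _ _] := active_bounds hs.
have ex : x = (bot s).+1.
  case: (x =P (bot s).+1) => // ne; case/negP: hn; apply/cellP; exists s => //; lia.
split; first by apply/botsP; exists s.
apply/topsP=> -[t ht et]; have [_ k1 k2 _ _] := active_bounds ht.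
by case/negP: hn; apply/cellP; exists t => //; lia.
Qed.

Lemma endc0 c : endc c 0 = false.
Proof. by apply/negP=> /andP[/botsP[]]. Qed.

Lemma strip_bounds c a e : strip c a e -> [/\ 1 <= a, a < e, e <= n.+1 & 1 <= c <= n].
Proof.
case=> h1 h2 h3 h4.
have := h2 a; rewrite leqnn h1 => /(_ isT)/cell_bounds[? ?].
have := h2 e.-1; rewrite (_ : a <= e.-1 < e); last by lia.
move=> /(_ isT)/cell_bounds[? ?]; split=> //; lia.
Qed.

Lemma startc_bound c : bounded (startc c) n.+1.
Proof. by move=> x; rewrite startcP => /andP[/cell_bounds[? _] _]; lia. Qed.

Lemma strip_start c a e : strip c a e -> startc c a.
Proof.
move=> h; have [? ? ? ?] := strip_bounds h; case: h => h1 h2 h3 h4.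
by rewrite startcP h3 h2 // leqnn.
Qed.

Lemma strip_no_start c a e x : strip c a e -> a < x <= e -> ~~ startc c x.
Proof.
case=> h1 h2 h3 h4 hx; rewrite startcP negb_and negbK.
by rewrite (h2 x.-1) ?orbT //; lia.
Qed.

(** This turns the question whether [(a, e)] is a strip into two table lookups and one predecessor
    query. *)
Lemma stripE c a e : strip c a e <-> endc c e /\ prv (startc c) e = a.+1.
Proof.
split=> [h|[he hp]].
  have [? ? ? ?] := strip_bounds h; split.
    case: h => h1 h2 h3 h4; rewrite endcP; last by lia.
    by rewrite h4 andbT h2 //; lia.
  apply: prvE => //; first exact: strip_start h.
  by move=> z hz; apply: strip_no_start h _; lia.
have e0 : 0 < e by case: (e) he => //; rewrite endc0.
move: hp; case: prvP => // y hy Sy hn [ey]; rewrite -{}ey.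
move: he; rewrite endcP // => /andP[he1 he2].
move: (Sy); rewrite startcP => /andP[hy1 hy2]; split=> // x /andP[hx1 hx2].
(* From row [e.-1] towards [y]: a first zero on the way would make the row after it a start strictly
   between [y] and [e]. *)
have down m : y + m < e -> cell c (e.-1 - m).
  elim: m => [|m IH] hm; first by rewrite subn0.
  have {}IH : cell c (e.-1 - m) by apply: IH; lia.
  have := hn (e.-1 - m); rewrite startcP IH /= negbK.
  rewrite (_ : (e.-1 - m).-1 = e.-1 - m.+1); last by lia.
  by apply; lia.
by have := down (e.-1 - x); rewrite (_ : e.-1 - (e.-1 - x) = x); [apply; lia | lia].
Qed.

(** If [a] or [e] stopped delimiting a strip, then a slab present in one column
    only would have an end in [[a, e]], since slabs in a column are disjoint. *)
Lemma transition c c' a e : strip c a e ->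
  (forall s x, s \in K -> s \in active c \/ s \in active c' ->
     ~ (s \in active c /\ s \in active c') -> a <= x <= e ->
     (x == top s) || (x == (bot s).+1) -> False) ->
  strip c' a e.
Proof.
move=> hs hn; have [a0 ae _ _] := strip_bounds hs; case: hs => _ h2 h3 h4.
have keep s x : s \in active c -> a <= x < e -> top s <= x <= bot s ->
    s \in active c'.
  move=> sc hx hsx; have [sK k1 k2 k3 k4] := active_bounds sc.
  have ht : a <= top s.
    rewrite leqNgt; apply/negP=> k; case/negP: h3; apply/cellP.
    by exists s => //; lia.
  apply/negPn/negP=> nsc; apply: (hn s (top s)) => //; first by left.
  - by case=> _; apply/negP.
  - by lia.
  - by rewrite eqxx.
split=> //.
- move=> x hx; have /cellP[s hsc hsx] := h2 x hx.
  by apply/cellP; exists s => //; apply: keep hsx.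
- apply/cellP=> -[s sc' hsx]; have [sK k1 k2 k3 k4] := active_bounds sc'.
  case: (boolP (s \in active c)) => sc.
    by case/negP: h3; apply/cellP; exists s.
  case: (leqP (bot s).+1 e) => k.
    apply: (hn s (bot s).+1) => //; first (by right); last by rewrite eqxx orbT.
      by case=> h; rewrite h in sc.
    by lia.
  have ha : a <= a < e by rewrite leqnn.
  have /cellP[t tc hta] := h2 a ha.
  have tc' := keep t a tc ha hta.
  have e' : s = t by apply: (@active_disjoint c' s t a) => //; lia.
  by rewrite e' tc in sc.
- apply/cellP=> -[s sc' hsx]; have [sK k1 k2 k3 k4] := active_bounds sc'.
  case: (boolP (s \in active c)) => sc.
    by case/negP: h4; apply/cellP; exists s.
  case: (leqP a (top s)) => k.
    apply: (hn s (top s)) => //; first (by right); last by rewrite eqxx.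
      by case=> h; rewrite h in sc.
    by lia.
  have he : a <= e.-1 < e by lia.
  have /cellP[t tc hta] := h2 e.-1 he.
  have tc' := keep t e.-1 tc he hta.
  have e' : s = t by apply: (@active_disjoint c' s t e.-1) => //; lia.
  by rewrite e' tc in sc.
Qed.

Lemma active_change c s : s \in K ->
  ((s \in active c) != (s \in active c.+1)) =
  ((lft s == c.+1) || ((rgt s).+1 == c.+1)).
Proof.
move=> sK; have [? ? ? ? ?] := slab_bounds sK.
by rewrite !mem_filter sK !andbT; case: eqP; case: eqP => /=; lia.
Qed.

Lemma strip_keep c a e : strip c a e ->
  (forall x, a <= x <= e -> ~~ touched c.+1 x) -> strip c.+1 a e.
Proof.
move=> hs ht; apply: (transition hs) => s x sK h1 h2 hx hx2.
apply: (negP (ht x hx)); apply/hasP; exists s => //.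
rewrite -active_change // hx2 andbT.
by case: (s \in active c) h1 h2; case: (s \in active c.+1) => // -[] // _ [].
Qed.

Lemma strip_keep_back c a e : strip c.+1 a e ->
  (forall x, a <= x <= e -> ~~ touched c.+1 x) -> strip c a e.
Proof.
move=> hs ht; apply: (transition hs) => s x sK h1 h2 hx hx2.
apply: (negP (ht x hx)); apply/hasP; exists s => //.
rewrite -active_change // hx2 andbT.
by case: (s \in active c) h1 h2; case: (s \in active c.+1) => // -[] // _ [].
Qed.

Lemma untouched_tops c x : ~~ touched c.+1 x ->
  tops c x = tops c.+1 x /\ bots c x = bots c.+1 x.
Proof.
move=> ht; have same s : s \in K -> (x == top s) || (x == (bot s).+1) ->
    (s \in active c) = (s \in active c.+1).
  move=> sK hx; apply/eqP/negPn/negP; rewrite active_change // => h.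
  by case/negP: ht; apply/hasP; exists s => //; rewrite h.
split.
  by apply/topsP/topsP=> -[s hs ex]; have [sK _ _ _ _] := active_bounds hs;
    have := same s sK; rewrite ex eqxx => /(_ isT) e; exists s => //;
    first [by rewrite -e | by rewrite e].
by apply/botsP/botsP=> -[s hs ex]; have [sK _ _ _ _] := active_bounds hs;
    have := same s sK; rewrite ex eqxx orbT => /(_ isT) e; exists s => //;
    first [by rewrite -e | by rewrite e].
Qed.

(** Walking from the end towards smaller rows must meet a start, because row 0 holds no one. *)
Lemma end_prv c e : endc c e -> exists2 a, prv (startc c) e = a.+1 & strip c a e.
Proof.
move=> he; case ep: (prv (startc c) e) => [|a]; last by exists a => //; apply/stripE.
have e0 : 0 < e by case: (e) he => //; rewrite endc0.
move: ep; case: prvP => // hn _; move: he; rewrite endcP // => /andP[he1 _].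
have down m : m < e -> cell c (e.-1 - m).
  elim: m => [|m IH] hm; first by rewrite subn0.
  have {}IH : cell c (e.-1 - m) by apply: IH; lia.
  have := hn (e.-1 - m); rewrite startcP IH /= negbK.
  rewrite (_ : (e.-1 - m).-1 = e.-1 - m.+1); last by lia.
  by apply; lia.
by have := down e.-1; rewrite subnn cell0 prednK // => /(_ (leqnn _)).
Qed.

Lemma touched_start c x : startc c x != startc c.+1 x -> touched c.+1 x.
Proof.
apply: contraNT => /untouched_tops[e1 e2]; by rewrite /startc e1 e2.
Qed.

Lemma strip_lost c a e : strip c a e -> ~ strip c.+1 a e ->
  exists2 x, touched c.+1 x & a <= x <= e.
Proof.
move=> hs hn; case: (boolP (has (touched c.+1) (iota a (e - a).+1))).
  by case/hasP=> x; rewrite mem_iota => hx ht; exists x => //; case: hs; lia.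
move/hasPn=> h; case: hn; apply: strip_keep hs _ => x hx; apply: h.
by rewrite mem_iota; lia.
Qed.

(** If [e] is not touched, it also ended an old strip [(a', e)]. Some row of [[a, e]] is touched; if
    it is not known to lie in [[a', e]], then [a < a'], so [a'] has ceased to be a start and is
    itself touched. *)
Lemma strip_new c a e : strip c.+1 a e -> ~ strip c a e ->
  touched c.+1 e \/
  exists a' x, [/\ strip c a' e, touched c.+1 x & a' <= x <= e].
Proof.
move=> hs hn; case: (boolP (touched c.+1 e)) => hte; [by left | right].
have [x hx hax] : exists2 x, touched c.+1 x & a <= x <= e.
  case: (boolP (has (touched c.+1) (iota a (e - a).+1))).
    by case/hasP=> x; rewrite mem_iota => hx ht; exists x => //; case: hs; lia.
  move/hasPn=> h; case: hn; apply: strip_keep_back hs _ => x hx; apply: h.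
  by rewrite mem_iota; lia.
have he : endc c e.
  have [he _] := (stripE c.+1 a e).1 hs.
  have [e1 e2] := untouched_tops hte; by rewrite /endc e1 e2.
have [a' _ hs'] := end_prv he; exists a'.
case: (leqP a' a) => ha; first by exists x; split=> //; lia.
have [_ ? _ _] := strip_bounds hs'.
exists a'; split=> //; last by lia.
apply: touched_start; rewrite (strip_start hs') eq_sym.
by rewrite (negbTE (strip_no_start hs _)) //; lia.
Qed.

(** The key is [x.+1] so that a start at [x] itself is found; the exclusive end [e] is allowed
    because no strip of the column starts there. *)
Lemma strip_query c a e x : strip c a e -> a <= x <= e ->
  prv (startc c) x.+1 = a.+1.
Proof.
move=> hs hx; apply: prvE; [by lia | exact: strip_start hs|].
by move=> z hz; apply: strip_no_start hs _; lia.
Qed.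

(** * Canonical slabs as maximal runs of one strip *)

Definition canon (r : slab) : Prop :=
  [/\ lft r <= rgt r,
      forall c, lft r <= c <= rgt r -> strip c (top r) (bot r).+1,
      ~ strip (lft r).-1 (top r) (bot r).+1
    & ~ strip (rgt r).+1 (top r) (bot r).+1].

Lemma cellE x y (i j : 'I_n) : x = i.+1 -> y = j.+1 -> cell y x = M i j.
Proof.
move=> -> ->; case: hK => _ hs _ hc; apply/cellP/idP => [[s]|/hc[s sK]].
  rewrite mem_filter => /andP[h1 sK] h2; have := hs s sK.
  case: s {sK} h1 h2 => [[[a b] c] e] /= h1 h2.
  rewrite /is_slab => /and5P[_ _ _ _ /and3P[_ _ /forallP/(_ i)/forallP/(_ j)]].
  by move/implyP; apply; rewrite /in_slab h1 h2.
rewrite in_slabE => /andP[h1 h2]; exists s => //.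
by rewrite mem_filter h2 sK.
Qed.

Lemma is_slabE a b c e : is_slab M (a, b, c, e) <->
  [/\ a <= b, c <= e & forall x y, a <= x <= b -> c <= y <= e -> cell y x].
Proof.
split=> [|[hab hce hxy]].
  rewrite /is_slab => /and5P[h1 h2 h3 h4 /and3P[h5 h6 h7]]; split=> // x y hx hy.
  have hx1 : x.-1 < n by lia.
  have hy1 : y.-1 < n by lia.
  rewrite (@cellE x y (Ordinal hx1) (Ordinal hy1)) /=; try lia.
  move/forallP/(_ (Ordinal hx1))/forallP/(_ (Ordinal hy1))/implyP: h7; apply.
  by rewrite /= !prednK; lia.
have hc1 : cell c a by apply: hxy; lia.
have hc2 : cell e b by apply: hxy; lia.
have [k1 k2] := cell_bounds hc1; have [k3 k4] := cell_bounds hc2.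
apply/and5P; split; [lia|lia|lia|lia|apply/and3P; split; [lia|lia|]].
apply/forallP=> i; apply/forallP=> j; apply/implyP=> /andP[h1 h2].
by rewrite -(@cellE i.+1 j.+1) //; apply: hxy.
Qed.

Lemma istripE i s : is_istrip M i s <->
  exists a b, s = (a, b, i, i) /\ strip i a b.+1.
Proof.
split=> [[a [b [-> h1 h2 h3]]]|[a [b [-> hs]]]]; exists a, b; split=> //.
- have [hab _ hc] := (is_slabE _ _ _ _).1 h1; split; first by rewrite ltnS.
  + by move=> x hx; apply: hc; lia.
  + apply/negP=> h; case/negP: h2; apply/is_slabE; split=> //; first lia.
    move=> x y hx hy; have -> : y = i by lia.
    by case: (x =P a.-1) => [-> //|ne]; apply: hc; lia.
  + apply/negP=> h; case/negP: h3; apply/is_slabE; split=> //; first lia.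
    move=> x y hx hy; have -> : y = i by lia.
    by case: (x =P b.+1) => [-> //|ne]; apply: hc; lia.
- case: hs => h1 h2 h3 h4; apply/is_slabE; split=> // x y hx hy.
  by have -> : y = i by [lia]; apply: h2; lia.
- case: hs => h1 h2 h3 h4; apply/negP=> /is_slabE[_ _ h].
  by case/negP: h3; apply: h; lia.
- case: hs => h1 h2 h3 h4; apply/negP=> /is_slabE[_ _ h].
  by case/negP: h4; apply: h; lia.
Qed.

Lemma siblingsE a b i t : siblings M (a, b, i, i) t <->
  exists2 j, t = (a, b, j, j) &
    forall k, minn i j <= k <= maxn i j -> strip k a b.+1.
Proof.
split=> [[a' [b' [i' [j [[<- <- <- _] -> h]]]]]|[j -> h]].
  exists j => // k /h /istripE[a2 [b2 [[<- <-]]]] //.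
exists a, b, i, j; split=> // k /h hs; apply/istripE.
by exists a, b.
Qed.

(** The union of a sibling class is given pointwise only. Evaluating it at corners of the slab and
    at the ends of the strip determines the rows; evaluating it one column outside yields
    maximality. *)
Lemma canonP r : canonical_slab M r <-> canon r.
Proof.
case: r => [[[p q] c] e]; split.
- case=> /is_slabE[hpq hce _] [s [i hi /istripE[a [b [-> hs]]]] hxy].
  have cls x y : in_slab (p, q, c, e) x y <->
      (a <= x <= b /\ forall k, minn i y <= k <= maxn i y -> strip k a b.+1).
    rewrite hxy; split=> [[t [_ /siblingsE[j -> hj] /andP[h1 h2]]]|[h1 h2]].
      by have -> : y = j by lia.
    exists (a, b, y, y); split; last by rewrite /= h1 !leqnn.
      exists y; last by apply/istripE; exists a, b; split=> //; apply: h2; lia.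
      by have /strip_bounds[] : strip y a b.+1 by apply: h2; lia.
    by apply/siblingsE; exists y.
  have hself k : minn i i <= k <= maxn i i -> strip k a b.+1.
    by move=> h; have -> : k = i by lia.
  have hab : a <= b by case: hs.
  have /cls[h1 _] : in_slab (p, q, c, e) p c by rewrite /=; lia.
  have /cls[h2 _] : in_slab (p, q, c, e) q c by rewrite /=; lia.
  have : in_slab (p, q, c, e) a i by apply/cls; split=> //; lia.
  have : in_slab (p, q, c, e) b i by apply/cls; split=> //; lia.
  rewrite /= => h3 h4.
  have [ep eq] : p = a /\ q = b by lia.
  rewrite /canon /top /bot /lft /rgt /= ep eq; split=> //.
  + move=> y hy; have /cls[_] : in_slab (p, q, c, e) a y by rewrite /=; lia.
    by apply; lia.
  + move=> hl; have : in_slab (p, q, c, e) a c.-1.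
      apply/cls; split=> [|k hk]; first by lia.
      case: (k =P c.-1) => [-> //|ne].
      have /cls[_] : in_slab (p, q, c, e) a c by rewrite /=; lia.
      by apply; lia.
    (* A strip lies in a column at least 1, so [c.-1] is the true predecessor of [c] and cannot
       belong to the slab. *)
    have := strip_bounds hl; rewrite /= => -[_ _ _ hc] h; lia.
  + move=> hl; have : in_slab (p, q, c, e) a e.+1.
      apply/cls; split=> [|k hk]; first by lia.
      case: (k =P e.+1) => [-> //|ne].
      have /cls[_] : in_slab (p, q, c, e) a e by rewrite /=; lia.
      by apply; lia.
    by rewrite /=; lia.
- rewrite /canon /top /bot /lft /rgt /= => -[hce hs hl hr].
  have hc := hs c; rewrite leqnn hce in hc; have {hc} hc := hc isT.
  have [k1 k2 k3 k4] := strip_bounds hc.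
  split.
    apply/is_slabE; split=> // x y hx /hs[_ h _ _]; apply: h; lia.
  exists (p, q, c, c); first by exists c => //; apply/istripE; exists p, q.
  move=> x y; split=> [/andP[h1 h2]|[t [_ /siblingsE[j -> hj] /andP[h1 h2]]]].
    exists (p, q, y, y); split; last by rewrite /= h1 !leqnn.
      exists y; last by apply/istripE; exists p, q; split=> //; apply: hs.
      by have [] := strip_bounds (hs y h2).
    by apply/siblingsE; exists y => // k hk; apply: hs; lia.
  rewrite /= h1 /=; have -> : y = j by lia.
  apply/andP; split; rewrite leqNgt; apply/negP=> k.
    by apply: hl; apply: hj; lia.
  by apply: hr; apply: hj; lia.
Qed.

(** * Events and parities *)

Definition pair_of (s : slab) : nat * nat := (top s, (bot s).+1).

(** The same event opens a slab in its first column and closes it after its last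
    one: it toggles both ends, so that only parities matter. *)
Definition events (L : seq slab) c : seq (nat * nat) :=
  flatten [seq nseq ((lft s == c) + ((rgt s).+1 == c)) (pair_of s) | s <- L].

(** The potential to which the time of the sweep is charged: the events in columns before [c]. *)
Definition evcount (L : seq slab) c : nat :=
  sumn [seq (lft s < c) + ((rgt s).+1 < c) | s <- L].

Lemma evcountS L c : evcount L c.+1 = evcount L c + size (events L c).
Proof.
elim: L => //= s L IH; rewrite /evcount /events /= size_cat size_nseq.
rewrite /evcount /events in IH; rewrite IH.
have e x : (x < c.+1 : nat) = (x < c) + (x == c) by rewrite ltnS; case: ltngtP.
by rewrite !e; lia.
Qed.

Lemma evcount_le L c : evcount L c <= (size L).*2.
Proof. by elim: L => //= s L IH; rewrite /evcount /=; rewrite /evcount in IH; lia. Qed.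

(** The order is reversed because events are pushed at the head of the list of their column. Column
    [n.+1] is included: slabs that reach column [n] are closed there. *)
Lemma evcount_total : evcount (rev K) n.+2 = (size K).*2.
Proof.
have h : forall s, s \in rev K -> lft s < n.+2 /\ (rgt s).+1 < n.+2.
  by move=> s; rewrite mem_rev => /slab_bounds[]; lia.
rewrite -(size_rev K); elim: (rev K) h => //= s L IH h.
rewrite /evcount /=; rewrite /evcount in IH; rewrite IH; last first.
  by move=> t ht; apply: h; rewrite inE ht orbT.
have [-> ->] := h s (mem_head _ _); lia.
Qed.

Lemma mem_events c x y : (x, y) \in events (rev K) c <->
  exists2 s, s \in K & [/\ (lft s == c) || ((rgt s).+1 == c), x = top s & y = (bot s).+1].
Proof.
split=> [/flattenP[l /mapP[s]]|[s sK [hc -> ->]]].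
  rewrite mem_rev => sK -> ; rewrite mem_nseq => /andP[h /eqP[-> ->]].
  by exists s => //; split=> //; case: eqP h; case: eqP.
apply/flattenP; exists (nseq ((lft s == c) + ((rgt s).+1 == c)) (pair_of s)).
  by apply/mapP; exists s; rewrite ?mem_rev.
by rewrite mem_nseq eqxx andbT; case: eqP hc; case: eqP.
Qed.

Lemma events_bound c x y : (x, y) \in events (rev K) c ->
  [/\ 1 <= x, x <= n, y <= n.+1, 1 <= y & 1 <= c <= n.+1].
Proof.
case/mem_events=> s /slab_bounds[? ? ? ? ?] [h -> ->].
by split; lia.
Qed.

Lemma touchedP c x : reflect (exists2 p, p \in events (rev K) c &
  (x == p.1) || (x == p.2)) (touched c x).
Proof.
apply: (iffP hasP) => [[s sK /andP[h1 h2]]|[[p1 p2] /mem_events[s sK [h1 -> ->]] h2]].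
  by exists (pair_of s) => //; apply/mem_events; exists s.
by exists s => //; rewrite h1 h2.
Qed.

Lemma count_active c p : count p (active c) =
  count (fun s => p s && (lft s <= c <= rgt s)) K.
Proof. by rewrite count_filter. Qed.

(** Being active in column [c.+1] is being active in column [c], flipped once by each event of the
    slab; modulo 2 this adds up over all slabs. *)
Lemma active_toggle c (p : pred slab) (r : pred (nat * nat)) :
  (forall s, r (pair_of s) = p s) ->
  odd (count p (active c.+1)) =
  odd (count p (active c)) (+) odd (count r (events (rev K) c.+1)).
Proof.
move=> hr; have -> : odd (count r (events (rev K) c.+1)) =
    odd (count r (events K c.+1)).
  congr (odd _); apply/permP; rewrite /events.
  by apply: perm_flatten; apply: perm_map; rewrite perm_rev.
rewrite !count_active; have := slab_bounds; elim: K => //= s L IH h.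
have hs := h s (mem_head _ _).
rewrite /events /= count_cat !oddD IH; last by move=> t ht; apply: h; rewrite inE ht orbT.
rewrite /events count_nseq hr; case: (p s) => //=.
rewrite ?mul1n oddD !oddb; case: hs => ? ? ? ? ?.
have -> : (lft s <= c.+1 <= rgt s) =
    (lft s <= c <= rgt s) (+) (lft s == c.+1) (+) ((rgt s).+1 == c.+1).
  by case: (ltngtP (lft s) c.+1) => h1; case: (ltngtP (rgt s).+1 c.+1) => h2 /=; lia.
case: (odd (count _ L)); case: (odd (count r _)); case: (lft s <= c <= rgt s);
  by case: (lft s == c.+1); case: (_ == c.+1).
Qed.

(** Disjointness allows at most one active slab with top [x], so the count is 0 or 1 and its parity
    is [tops] itself. *)
Lemma count_top c x : count (fun s => top s == x) (active c) = tops c x.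
Proof.
have : uniq (active c) by apply: filter_uniq; case: hK.
have : forall s t, s \in active c -> t \in active c -> top s == x -> top t == x -> s = t.
  move=> s t sc tc /eqP e1 /eqP e2; apply: (@active_disjoint c s t x) => //.
    by have [_ ? ? ? ?] := active_bounds sc; lia.
  by have [_ ? ? ? ?] := active_bounds tc; lia.
rewrite /tops; elim: (active c) => //= s L IH h /andP[sL uL].
rewrite IH //; last by move=> t t' h1 h2; apply: h; rewrite inE ?h1 ?h2 orbT.
case e: (top s == x) => //=; case: hasP => //= -[t tL et].
by rewrite (h s t) ?inE ?eqxx ?tL ?orbT // ?e // in sL; rewrite tL in sL.
Qed.

Lemma count_bot c x : count (fun s => (bot s).+1 == x) (active c) = bots c x.
Proof.
have : uniq (active c) by apply: filter_uniq; case: hK.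
have : forall s t, s \in active c -> t \in active c ->
    (bot s).+1 == x -> (bot t).+1 == x -> s = t.
  move=> s t sc tc /eqP e1 /eqP e2; apply: (@active_disjoint c s t x.-1) => //.
    by have [_ ? ? ? ?] := active_bounds sc; lia.
  by have [_ ? ? ? ?] := active_bounds tc; lia.
rewrite /bots; elim: (active c) => //= s L IH h /andP[sL uL].
rewrite IH //; last by move=> t t' h1 h2; apply: h; rewrite inE ?h1 ?h2 orbT.
case e: ((bot s).+1 == x) => //=; case: hasP => //= -[t tL et].
by rewrite (h s t) ?inE ?eqxx ?tL ?orbT // ?e // in sL; rewrite tL in sL.
Qed.

Lemma tops_toggle c x : tops c.+1 x =
  tops c x (+) odd (count (fun p => p.1 == x) (events (rev K) c.+1)).
Proof.
rewrite -(oddb (tops c.+1 x)) -(oddb (tops c x)) -!count_top.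
exact: active_toggle.
Qed.

Lemma bots_toggle c x : bots c.+1 x =
  bots c x (+) odd (count (fun p => p.2 == x) (events (rev K) c.+1)).
Proof.
rewrite -(oddb (bots c.+1 x)) -(oddb (bots c x)) -!count_bot.
exact: active_toggle.
Qed.

Lemma tops0 x : tops 0 x = false.
Proof. by apply/negP=> /topsP[s /active_bounds[_ _ _ _]]; lia. Qed.

Lemma bots0 x : bots 0 x = false.
Proof. by apply/negP=> /botsP[s /active_bounds[_ _ _ _]]; lia. Qed.

End Columns.

Lemma uniq_slabs_size N (R : seq slab) : uniq R ->
  (forall r, r \in R -> [/\ top r <= N, bot r <= N, lft r <= N & rgt r <= N]) ->
  size R <= N.+1 ^ 4.
Proof.
move=> uR hR.
pose f (r : slab) : 'I_N.+1 * 'I_N.+1 * 'I_N.+1 * 'I_N.+1 :=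
  (inord (top r), inord (bot r), inord (lft r), inord (rgt r)).
have uf : uniq (map f R).
  rewrite map_inj_in_uniq // => r t /hR[h1 h2 h3 h4] /hR[k1 k2 k3 k4].
  case: r t h1 h2 h3 h4 k1 k2 k3 k4 => [[[a b] c] e] [[[a' b'] c'] e'].
  rewrite /f /top /bot /lft /rgt /= => h1 h2 h3 h4 k1 k2 k3 k4 [].
  by do 4 (move=> /(congr1 val); rewrite /= !inordK //; move=> ->).
rewrite -(size_map f) -(card_uniqP uf); apply: leq_trans (max_card _) _.
by rewrite !card_prod card_ord !expnS expn0 muln1 !mulnA.
Qed.

(** * Invariants of the sweep *)

Section Sweep.
Variables (n : nat) (M : 'M[bool]_n) (K : seq slab).
Hypothesis hK : slab_decomposition M K.

Lemma canon_bounds r : canon K r ->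
  [/\ top r <= n, bot r <= n, lft r <= n & rgt r <= n].
Proof.
case=> h1 h2 _ _; have h3 := h2 (lft r); have h4 := h2 (rgt r).
rewrite leqnn h1 in h3; rewrite leqnn h1 in h4.
have [k1 k2 k3 k4] := strip_bounds hK (h3 isT).
have [k5 k6 k7 k8] := strip_bounds hK (h4 isT).
by split; lia.
Qed.

Lemma canon_size R : uniq R -> (forall r, r \in R -> canon K r) ->
  size R <= n.+1 ^ 4.
Proof. by move=> uR h; apply: uniq_slabs_size => // r /h/canon_bounds. Qed.

Lemma touched_bound c x : touched K c x -> 1 <= x <= n.+1.
Proof.
by case/touchedP=> -[p1 p2] /(events_bound hK)[? ? ? ? ?] /= /orP[]/eqP->; lia.
Qed.

Lemma strip_inj c s e e' : strip K c s e -> strip K c s e' -> e = e'.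
Proof.
move=> [h1 h2 h3 h4] [g1 g2 g3 g4]; case: (ltngtP e e') => // h.
  by rewrite g2 // in h4; lia.
by rewrite h2 // in g4; lia.
Qed.

Lemma strip_dec c s e : strip K c s e \/ ~ strip K c s e.
Proof.
case: (boolP (endc K c e && (prv (startc K c) e == s.+1))).
  by case/andP=> e1 /eqP e2; left; apply/(stripE hK).
move/negP=> hn; right=> /(stripE hK)[e1 e2]; apply: hn; by rewrite e1 e2 eqxx.
Qed.

Lemma no_strip0 s e : ~ strip K 0 s e.
Proof. by move=> h; have [_ _ _] := strip_bounds hK h. Qed.

(** The value 0 is free to mark rows where no strip starts, since ends of strips are positive. *)
Definition ends_ok c (E : nat -> nat) : Prop :=
  (forall s e, strip K c s e -> E s = e) /\
  (forall s, E s != 0 -> strip K c s (E s)).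

Definition starts_ok c (F : nat -> nat) : Prop :=
  forall s e, strip K c s e -> [/\ 1 <= F s <= c,
    forall j, F s <= j <= c -> strip K j s e & ~ strip K (F s).-1 s e].

Definition out_ok c (R : seq slab) : Prop :=
  uniq R /\ forall r, r \in R <-> canon K r /\ rgt r < c.

(** The table between [flush] and [create]: it knows exactly the strips common to both columns. *)
Definition kept c (E : nat -> nat) : Prop :=
  (forall s e, strip K c s e -> strip K c.+1 s e -> E s = e) /\
  (forall s, E s != 0 -> strip K c s (E s) /\ strip K c.+1 s (E s)).

(** A slab has been written precisely when its entry of [E] has been cleared. The output is thus a
    function of the tables, and no slab can be written twice. *)
Definition flushed c (E F E' : nat -> nat) (r : slab) : Prop :=
  [/\ E (top r) != 0, E' (top r) = 0 & r = (top r, E (top r) - 1, F (top r), c)].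

Definition erased c (E E' : nat -> nat) : Prop :=
  forall s, E' s = E s \/ [/\ E' s = 0, E s != 0 & ~ strip K c.+1 s (E s)].

Lemma flushed_canon c E F E' r : ends_ok c E -> starts_ok c F ->
  erased c E E' -> flushed c E F E' r -> canon K r /\ rgt r = c.
Proof.
move=> [hE1 hE2] hF hE [f1 f2 f3]; have hs := hE2 _ f1.
have [_ hn] : E (top r) != 0 /\ ~ strip K c.+1 (top r) (E (top r)).
  by case: (hE (top r)) => [e|[]] //; rewrite e in f2; rewrite f2 in f1.
have [g1 g2 g3] := hF _ _ hs; have [k1 k2 k3 k4] := strip_bounds hK hs.
have eb : (E (top r) - 1).+1 = E (top r) by lia.
rewrite f3 /canon /top /bot /lft /rgt /= -/(top r) eb.
by split=> //; split=> //; lia.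
Qed.

Lemma run_unique c s e a b : a <= c -> b <= c -> 0 < a -> 0 < b ->
  (forall j, a <= j <= c -> strip K j s e) -> ~ strip K a.-1 s e ->
  (forall j, b <= j <= c -> strip K j s e) -> ~ strip K b.-1 s e -> a = b.
Proof.
move=> ac bc a0 b0 ha na hb nb; case: (ltngtP a b) => // h.
  by case: nb; apply: ha; lia.
by case: na; apply: hb; lia.
Qed.

Lemma canon_flushed c E F E' r : ends_ok c E -> starts_ok c F ->
  (forall s, E s != 0 -> ~ strip K c.+1 s (E s) -> E' s = 0) ->
  canon K r -> rgt r = c -> flushed c E F E' r.
Proof.
case: r => [[[a b] i] j] [hE1 hE2] hF hE'; rewrite /canon /flushed /top /bot /lft /rgt /=.
move=> [h1 h2 h3 h4] ej; rewrite {j}ej in h1 h2 h4 *.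
have hs : strip K c a b.+1 by apply: h2; rewrite h1 leqnn.
have ee := hE1 _ _ hs; have hi : strip K i a b.+1 by apply: h2; rewrite h1 leqnn.
have [_ _ _ /andP[i0 _]] := strip_bounds hK hi.
have [g1 g2 g3] := hF _ _ hs.
rewrite ee subn1 /=; split=> //; first by apply: hE'; rewrite ee.
by congr (_, _, _, _); apply: (@run_unique c a b.+1) => //; lia.
Qed.

End Sweep.

(** * Operations on the tree as programs *)

Arguments rupd f x v y /.
Arguments aupd f a i v b j /.

Declare Scope imp_scope.
Delimit Scope imp_scope with I.
Notation "x + y" := (EB Add x y) : imp_scope.
Notation "x - y" := (EB Sub x y) : imp_scope.
Notation "x * y" := (EB Mul x y) : imp_scope.
Notation "x %/ y" := (EB Div x y) : imp_scope.
Notation "x %% y" := (EB Mod x y) : imp_scope.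
Notation "x == y" := (EB Eq x y) : imp_scope.
Notation "x < y" := (EB Lt x y) : imp_scope.
Notation "a .[ e ]" := (EL a e) : imp_scope.
Notation "r <- e" := (Asg r e) (at level 70) : imp_scope.
Notation "c1 ;; c2" := (Seq c1 c2) (at level 90, right associativity) : imp_scope.
Bind Scope imp_scope with expr cmd.
(** In programs a bare numeral is a variable; constants carry [EC]. *)
Coercion EV : nat >-> expr.

(** Node [id] of depth [d] is stored at index [id * (k + 2) + d] of the arrays
    [aMN] (least element) and [aMX] (greatest element); [aPW] holds the [pw j]. *)
Notation vk := 2 (only parsing).
Notation vk2 := 4 (only parsing).
Notation vx := 20 (only parsing).
Notation vd := 21 (only parsing).
Notation vid := 22 (only parsing).
Notation vgo := 23 (only parsing).
Notation vix := 24 (only parsing).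
Notation vmn := 25 (only parsing).
Notation vmx := 26 (only parsing).
Notation vq := 27 (only parsing).
Notation vh := 28 (only parsing).
Notation vl := 29 (only parsing).
Notation vch := 30 (only parsing).
Notation vcix := 31 (only parsing).
Notation vr_ := 32 (only parsing).
Notation vsid := 33 (only parsing).
Notation vsix := 34 (only parsing).

Notation vsm := 35 (only parsing).
Notation vf := 36 (only parsing).

Notation aMN := 12 (only parsing).
Notation aMX := 13 (only parsing).
Notation aPW := 14 (only parsing).

Open Scope imp_scope.

Definition split_key : cmd :=
  vq <- aPW.[vk - EC 1 - vd];;
  vh <- vx %/ vq;;
  vl <- vx %% vq;;
  vsid <- vid * (vq + EC 1);;
  vch <- vsid + vh + EC 1;;
  vcix <- vch * vk2 + vd + EC 1.

Definition load_node : cmd :=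
  vix <- vid * vk2 + vd;;
  vmn <- aMN.[vix];;
  vmx <- aMX.[vix].

Definition insert_body : cmd :=
  load_node;;
  If (vmn == EC 0)
    (Sto aMN vix (vx + EC 1);; Sto aMX vix (vx + EC 1);; vgo <- EC 0)
  (If (vmn == vmx)
    (If (vx + EC 1 < vmn) (Sto aMN vix (vx + EC 1)) (Sto aMX vix (vx + EC 1));;
     vgo <- EC 0)
  (If (vx + EC 1 < vmn)
     (Sto aMN vix (vx + EC 1);; vx <- vmn - EC 1)
   (If (vmx < vx + EC 1)
     (Sto aMX vix (vx + EC 1);; vx <- vmx - EC 1)
     Skip);;
   split_key;;
   vd <- vd + EC 1;;
   If (aMN.[vcix] == EC 0)
     (Sto aMN vcix (vl + EC 1);; Sto aMX vcix (vl + EC 1);;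
      vid <- vsid;; vx <- vh)
     (vid <- vch;; vx <- vl))).

Definition insert : cmd :=
  vd <- EC 0;; vid <- EC 0;; vgo <- EC 1;; While vgo insert_body.

Definition delete_body : cmd :=
  load_node;;
  If (vmn == vmx)
    (Sto aMN vix (EC 0);; Sto aMX vix (EC 0);; vgo <- EC 0)
  (vq <- aPW.[vk - EC 1 - vd];;
   vsid <- vid * (vq + EC 1);;
   vsix <- vsid * vk2 + vd + EC 1;;
   vsm <- aMN.[vsix];;
   If (vx + EC 1 == vmn)
     (If (vsm == EC 0) (Sto aMN vix vmx;; vgo <- EC 0)
        (vf <- (vsm - EC 1) * vq + aMN.[(vsid + vsm) * vk2 + vd + EC 1];;
         Sto aMN vix vf;; vx <- vf - EC 1))
   (If (vx + EC 1 == vmx)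
     (If (vsm == EC 0) (Sto aMX vix vmn;; vgo <- EC 0)
        (vsm <- aMX.[vsix];;
         vf <- (vsm - EC 1) * vq + aMX.[(vsid + vsm) * vk2 + vd + EC 1];;
         Sto aMX vix vf;; vx <- vf - EC 1))
     Skip);;
   If vgo
     (vh <- vx %/ vq;; vl <- vx %% vq;; vch <- vsid + vh + EC 1;;
      vcix <- vch * vk2 + vd + EC 1;; vd <- vd + EC 1;;
      If (aMN.[vcix] == aMX.[vcix])
        (Sto aMN vcix (EC 0);; Sto aMX vcix (EC 0);; vid <- vsid;; vx <- vh)
        (vid <- vch;; vx <- vl))
     Skip).

Definition delete : cmd :=
  vd <- EC 0;; vid <- EC 0;; vgo <- EC 1;; While vgo delete_body.

Definition pred_down : cmd :=
  load_node;;
  If (vmn == EC 0) (vr_ <- EC 0;; vgo <- EC 0)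
  (If (vmx < vx + EC 1) (vr_ <- vmx;; vgo <- EC 0)
  (If (vx < vmn) (vr_ <- EC 0;; vgo <- EC 0)
    (split_key;; vd <- vd + EC 1;; vmn <- aMN.[vcix];;
     If ((EC 0 < vmn) * (vmn < vl + EC 1))
       (vid <- vch;; vx <- vl)
       (vid <- vsid;; vx <- vh)))).

(** Inverts the numbering of nodes: quotient and remainder by [q + 1] give the parent and the child
    from which the search returns. *)
Definition pred_up : cmd :=
  vd <- vd - EC 1;;
  vq <- aPW.[vk - EC 1 - vd];;
  vh <- vid %% (vq + EC 1);;
  vid <- vid %/ (vq + EC 1);;
  If (vh == EC 0)
    (If (vr_ == EC 0)
       (vr_ <- aMN.[vid * vk2 + vd])
       (vr_ <- (vr_ - EC 1) * vq
               + aMX.[(vid * (vq + EC 1) + vr_) * vk2 + vd + EC 1]))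
    (vr_ <- (vh - EC 1) * vq + vr_).

Definition predecessor : cmd :=
  vd <- EC 0;; vid <- EC 0;; vgo <- EC 1;;
  While vgo pred_down;;
  While vd pred_up.

Close Scope imp_scope.

Definition pw (j : nat) : nat := 2 ^ (2 ^ j).

(** Symbolic execution of loop-free code, leaving safety conditions and the postcondition. *)
Ltac wpexp := cbv beta iota zeta delta
  [wpc safe eval bopv bop_safe idx_safe vr ar tm rupd Nat.eqb tick].

Ltac wsafe :=
  lazymatch goal with
  | |- True => exact Logic.I
  | |- and3 _ _ _ => split; wsafe
  | |- and4 _ _ _ _ => split; wsafe
  | |- _ /\ _ => split; wsafe
  | _ => idtac
  end.

Ltac wsolve := wsafe;
  lazymatch goal with
  | |- is_true (leq _ _) => try first [by [] | lia]
  | |- _ => idtac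
  end.

(** * Correctness of the tree programs *)

Section Veb.
Variables (bd lim k : nat).
Hypothesis k_gt0 : 0 < k.
(** The square root of the universe at depth [d < k]. At depth [k] truncated subtraction gives
    [pw 0 = 2], in the program as well. *)
Definition qd d := pw (k - 1 - d).
Definition ud d := if d is e.+1 then qd e else pw k.
(** Identifiers of nodes at depth [d] stay below this number, which bounds the indices into the
    table. *)
Fixpoint width d := if d is e.+1 then width e * (qd e).+1 else 1.
Hypothesis bd_ok : forall d, d <= k.+1 -> width d * (k.+2) + k + 4 + pw k < bd.

Lemma pwS j : pw j.+1 = pw j * pw j.
Proof. by rewrite /pw expnS mul2n -addnn expnD. Qed.

Lemma pw_gt1 j : 1 < pw j.
Proof. by rewrite /pw -{1}(expn0 2) ltn_exp2l // expn_gt0. Qed.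

Lemma qd_gt0 d : 0 < qd d.
Proof. exact: ltnW (pw_gt1 _). Qed.

Lemma ud_sq d : d < k -> ud d = qd d * qd d.
Proof.
rewrite /qd; case: d => [|d] h /=; first by rewrite -pwS; congr pw; lia.
by rewrite /qd -pwS; congr pw; lia.
Qed.

Lemma ud_leaf : ud k = 2 /\ qd k = 2.
Proof.
split; last by rewrite /qd (_ : k - 1 - k = 0) //; lia.
rewrite -[X in ud X](prednK k_gt0) /= /qd.
by rewrite (_ : k - 1 - k.-1 = 0) //; lia.
Qed.

Lemma ud_le d : d <= k -> ud d <= qd d * qd d.
Proof.
rewrite leq_eqVlt => /orP[/eqP->|/ud_sq -> //].
by case: ud_leaf => -> ->.
Qed.

Lemma ud_S d : ud d.+1 = qd d. Proof. by []. Qed.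

Lemma ud_k : ud k <= 2.
Proof. by case: ud_leaf => ->. Qed.

Definition Vof (A : nat -> nat -> nat) d id :=
  (A 12 (id * k.+2 + d), A 13 (id * k.+2 + d)).

Definition veb (A : nat -> nat -> nat) (S : pred nat) : Prop :=
  forall d id, d <= k.+1 -> Vof A d id = nodeval qd ud S d id.

Definition env (o : st) : Prop :=
  [/\ vr o 2 = k, vr o 4 = k.+2 & forall j, j < k -> ar o 14 j = pw j].

(** Depths up to [k.+1] are digits in base [k.+2]. *)
Lemma idx_inj d id d' id' : d <= k.+1 -> d' <= k.+1 ->
  (id' * k.+2 + d' == id * k.+2 + d) = (d' == d) && (id' == id).
Proof.
move=> h h'; apply/eqP/andP=> [e|[/eqP-> /eqP->] //].
have : (id' * k.+2 + d') %% k.+2 = (id * k.+2 + d) %% k.+2 by rewrite e.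
rewrite !modnMDl !modn_small // => ed; split; first exact/eqP.
move: e; rewrite ed => /addIn/eqP; rewrite eqn_pmul2r //.
Qed.

Lemma Vof_upd A ix d id a b d' id' : ix = id * k.+2 + d -> d <= k.+1 ->
  d' <= k.+1 ->
  Vof (aupd (aupd A 12 ix a) 13 ix b) d' id' = upd2 (Vof A) d id (a, b) d' id'.
Proof. by move=> -> h h'; rewrite /Vof /upd2 /= idx_inj //; case: ifP. Qed.

Lemma Vof_upd12 A ix d id a d' id' : ix = id * k.+2 + d -> d <= k.+1 ->
  d' <= k.+1 ->
  Vof (aupd A 12 ix a) d' id' = upd2 (Vof A) d id (a, (Vof A d id).2) d' id'.
Proof.
move=> -> h h'; rewrite /Vof /upd2 /= idx_inj //.
by case: ifP => // /andP[/eqP-> /eqP->].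
Qed.

Lemma Vof_upd13 A ix d id a d' id' : ix = id * k.+2 + d -> d <= k.+1 ->
  d' <= k.+1 ->
  Vof (aupd A 13 ix a) d' id' = upd2 (Vof A) d id ((Vof A d id).1, a) d' id'.
Proof.
move=> -> h h'; rewrite /Vof /upd2 /= idx_inj //.
by case: ifP => // /andP[/eqP-> /eqP->].
Qed.

Lemma width_idx d id c : d <= k -> id < width d -> c <= qd d ->
  id * (qd d).+1 + c < width d.+1 /\
  (id * (qd d).+1 + c) * k.+2 + d + 1 + k + 4 < bd.
Proof.
move=> hd hid hc /=; have h : id * (qd d).+1 + c < width d * (qd d).+1.
  have : id.+1 * (qd d).+1 <= width d * (qd d).+1 by rewrite leq_mul2r hid orbT.
  by rewrite mulSn; lia.
split=> //; have := bd_ok (d := d.+1) hd => /=.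
have : (id * (qd d).+1 + c).+1 * k.+2 <= width d * (qd d).+1 * k.+2.
  by rewrite leq_mul2r h orbT.
rewrite mulSn; lia.
Qed.

Lemma qd_le d : qd d < bd /\ (qd d).+1 < bd /\ qd d <= pw k.
Proof.
have h : qd d <= pw k by rewrite /qd /pw leq_exp2l // leq_exp2l //; lia.
by have := bd_ok (d := 0) isT; lia.
Qed.

Lemma ud_le_pw d : ud d <= pw k.
Proof. by case: d => //= d; case: (qd_le d) => _ []. Qed.

Lemma node_le S d id : (nodeval qd ud S d id).1 <= (nodeval qd ud S d id).2 /\
  (nodeval qd ud S d id).2 <= pw k.
Proof.
rewrite /nodeval /=; split; last by apply: leq_trans (prv_le _ _) (ud_le_pw d).
case: fstP => // y hy Sy n; case: prvP => [n'|z hz Sz n'].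
  by have := n' y hy; rewrite Sy.
by rewrite ltnS leqNgt; apply/negP=> /n; rewrite Sz.
Qed.

Section Insert.
Variables (A B : pred nat) (o : st) (x : nat).
Hypotheses (henv : env o) (hA : bounded A (pw k)) (hv : veb (ar o) A)
  (hx : vr o 20 = x) (hxk : x < pw k) (hadd : add1 A x B).

Lemma insert_ok : wp bd lim insert (fun o' => veb (ar o') B /\
  tm o' <= tm o + 25 * k.+2 + 4) o.
Proof.
have [h2 h4 h14] := henv.
have hB : bounded B (pw k).
  by case: hadd => _ e y; rewrite e => /orP[/eqP->|/hA].
have b0 := bd_ok (d := 0) isT.
have [t0 et0] : exists t, t = tm o by exists (tm o).
rewrite -et0; apply/wpcP; do 3 (split; first by rewrite /=; lia).
(* Each iteration takes at most 25 ticks and either stops or increases the depth by one. *)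
pose I j o' := (vr o' 23 = 0 /\ j = 0 /\ veb (ar o') B /\
     tm o' <= t0 + 25 * k.+2 + 3) \/
  (vr o' 23 = 1 /\ j = k.+2 - vr o' 21 /\
   node_ok k qd ud A B (vr o' 21) (vr o' 22) (vr o' 20) /\
   partial k qd ud A B (Vof (ar o')) (vr o' 21) (vr o' 22) /\
   vr o' 22 < width (vr o' 21) /\ tm o' <= t0 + 25 * vr o' 21 + 3).
rewrite /=; apply: (@wp_while _ _ I _ _ _ _ k.+2).
  right=> /=; rewrite subn0 muln0 hx; split=> //; split=> //; split.
    by split.
  split; last by split; lia.
  move=> d' id' hd'; rewrite hv //; case: ifP => // hs.
  apply: eq_nodeval; apply: (cont_anc ud_k (leq0n d')) => //.
  move=> y; move: hs; rewrite /sub leq0n /=.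
  by case: (anc _ _ _ _) => [|?] //; rewrite eqxx.
move=> j [v m t] hI [hr ha]; split=> //.
have {}h2 : v 2 = k := etrans (hr 2 isT) h2.
have {}h4 : v 4 = k.+2 := etrans (hr 4 isT) h4.
have {}h14 i : i < k -> m 14 i = pw i.
  by move=> hi; have := congr1 (fun f => f i) (ha 14 isT) => /= ->; apply: h14.
case: hI => /=.
  by case=> -> [_ [h ht]] /=; split=> //; lia.
case=> e23 [ej [hn [hp [hid ht]]]]; rewrite /= e23 /=.
have hd := node_leaf ud_le ud_S ud_k hB hn.
move ed : (v 21) ej hn hp hid ht hd => d ej hn hp hid ht hd.
move eid : (v 22) hn hp hid => id hn hp hid.
move ey : (v 20) hn => y hn.
have hdk : d <= k.+1 by lia.
have bi := bd_ok hdk.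
have bix : id * k.+2 + d < bd.
  have : id.+1 * k.+2 <= width d * k.+2 by rewrite leq_mul2r hid orbT.
  by rewrite mulSn; lia.
have by_ : y + k < bd.
  by case: hn => _ hy _; have := ud_le_pw d; lia.
have wix : id * k.+2 + d = id * k.+2 + d by [].
apply: wp_seq; apply/wpcP; rewrite /load_node; wpexp; rewrite ?ed ?eid ?h4.
wsolve.
apply: wp_if; wpexp; [by wsolve | |].
  case: eqP => // hmn _; apply/wpcP; wpexp; rewrite ?ey; wsolve.
  exists 0; first by lia.
  rewrite /I; left; wpexp; do !split=> //; last by lia.
  move=> d' id' hd'; rewrite (@Vof_upd _ _ d id _ _ _ _ wix hdk hd').
  rewrite addn1; exact: (insert_empty ud_le ud_S ud_k hA hB hn hp hmn).
case: eqP => // hmn _.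
apply: wp_if; wpexp; [by wsolve | |].
  case: eqP => // hmm _.
  have [mm emm] : exists mm, Vof m d id = (mm.+1, mm.+1).
    exists (m 12 (id * k.+2 + d)).-1.
    by rewrite /Vof -hmm prednK //; case: (m 12 _) hmn.
  have hfin := insert_single ud_le ud_S ud_k hA hB hn hp emm.
  case: emm => e1 e2.
  apply/wpcP; wpexp; rewrite ?ey ?e1 ?e2.
  wsolve.
  rewrite eqb0; case: ltnP => hlt; cbv beta iota delta [negb]; wsolve; (exists 0; first by lia);
    rewrite /I; left; wpexp; do !split=> //; try lia; move=> d' id' hd'.
    rewrite (@Vof_upd12 _ _ d id _ _ _ wix hdk hd') -hfin // /upd2 /Vof e2.
    by case: ifP => // _; congr (_, _) => /=; lia.
  rewrite (@Vof_upd13 _ _ d id _ _ _ wix hdk hd') -hfin // /upd2 /Vof e1.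
  by case: ifP => // _; congr (_, _) => /=; lia.
case: eqP => // hne _.
have hne2 : (Vof m d id).1 != (Vof m d id).2 by apply/eqP.
have [ex2 [hdlt [hh _]]] := insert_child qd_gt0 ud_le ud_S ud_k hB hn (Vof m) hp hne2.
have [_ hxu _ _ _] := step_facts qd_gt0 ud_le ud_S ud_k hB hn
  (etrans (congr1 (fun z => z.1 != z.2) (esym (partial_id hdk hp))) hne2).
have hch := insert_child qd_gt0 ud_le ud_S ud_k hB hn _ hp hne2.
have hsm := insert_summary qd_gt0 ud_le ud_S ud_k hB hn hp hne2.
rewrite ex2 in hh hxu hch hsm.
set x2 := prom y (Vof m d id) in hh hxu hch hsm.
set V1 := (minn (Vof m d id).1 y.+1, maxn (Vof m d id).2 y.+1) in hch hsm.
have hval := @node_le A d id; rewrite -(partial_id hdk hp) /Vof /= in hval.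
apply: wp_seq.
(* The three branches meet in one postcondition: the node has its final extrema and [x2] is the
   element to push down. *)
apply: (@wp_consequence _ _ _ (fun o' => [/\ vr o' 20 = x2,
  forall d' id', d' <= k.+1 -> Vof (ar o') d' id' = upd2 (Vof m) d id V1 d' id'
  & tm o' <= t + 10])).
  apply/wpcP; wpexp; rewrite ?ey.
  wsolve.
  rewrite eqb0; case: ltnP => hlt; cbv beta iota delta [negb]; wsolve.
  - rewrite /x2 /prom /Vof /= -[y.+1]addn1 hlt subn1 //.
  - move=> d' id' hd'; rewrite (@Vof_upd12 _ _ d id _ _ _ wix hdk hd').
    by rewrite /V1 /upd2 /Vof; case: ifP => // _; congr (_, _) => /=; lia.
  rewrite eqb0; case: ltnP => hlt2; cbv beta iota delta [negb]; wsolve.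
  - rewrite /x2 /prom /Vof /= -[y.+1]addn1 ltnNge hlt /= hlt2 subn1 //.
  - move=> d' id' hd'; rewrite (@Vof_upd13 _ _ d id _ _ _ wix hdk hd').
    by rewrite /V1 /upd2 /Vof; case: ifP => // _; congr (_, _) => /=; lia.
  - by rewrite /x2 /prom /Vof /= -[y.+1]addn1 !ltnNge hlt hlt2.
  - move=> d' id' hd'; rewrite /V1 /upd2; case: ifP => // /andP[/eqP-> /eqP->].
    by rewrite /Vof /=; congr (_, _); lia.
move=> [v1 m1 t1] [/= ex20 hV1 ht1] [a1 b1].
have e2 : v1 2 = k := etrans (a1 2 isT) h2.
have e4 : v1 4 = k.+2 := etrans (a1 4 isT) h4.
have e21 : v1 21 = d := etrans (a1 21 isT) ed.
have e22 : v1 22 = id := etrans (a1 22 isT) eid.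
have e23' : v1 23 = 1 := etrans (a1 23 isT) e23.
have eq : m1 14 (k - 1 - d) = qd d.
  have := congr1 (fun f => f (k - 1 - d)) (b1 14 isT) => /= ->.
  by apply: h14; lia.
have [q1 [q2 q3]] := qd_le d.
set h := x2 %/ qd d in hh hch hsm; set l := x2 %% qd d in hch hsm.
have hl : l < qd d by rewrite ltn_mod qd_gt0.
have [w1 w2] := width_idx hd hid hh.
have [w3 w4] := width_idx hd hid (leq0n (qd d)).
rewrite addn0 in w3 w4.
set cid := id * (qd d).+1 + h.+1 in w1 w2 hch hsm.
have ecid : id * (qd d + 1) + h + 1 = cid by rewrite /cid addn1; lia.
have esid : id * (qd d + 1) = id * (qd d).+1 by rewrite addn1.
apply: wp_seq; apply/wpcP; rewrite /split_key; wpexp.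
rewrite e2 e4 e21 e22 eq ex20 -/h -/l ecid esid.
have hmul z : z <= z * k.+2 by rewrite leq_pmulr.
have m1_ := hmul cid; have m2_ := hmul (id * (qd d).+1).
have hcs : cid = id * (qd d).+1 + h.+1 by [].
wsolve.
have hval2 : Vof m1 d.+1 cid = Vof m d.+1 cid.
  by rewrite hV1 // /upd2 (_ : d.+1 == d = false) //; lia.
have ecix : cid * k.+2 + d + 1 = cid * k.+2 + d.+1 by rewrite addn1 addnS.
apply: wp_seq; apply/wpcP; wpexp; rewrite e21 ecix; wsolve.
apply: wp_if; wpexp; [by wsolve | |].
  case: eqP => // hz _; have {}hz : (Vof m d.+1 cid).1 = 0 by rewrite -hval2.
  apply/wpcP; wpexp; rewrite ?e21; wsolve.
  exists (k.+2 - d.+1); first by lia.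
  set m2 := aupd _ _ _ _.
  have [|hp2 hn2] := hsm (Vof m2) hz.
    move=> d' id' hd'; rewrite /m2 (@Vof_upd _ _ d.+1 cid _ _ _ _ erefl) //.
    by rewrite !addn1 /upd2; case: ifP => // _; rewrite hV1.
  rewrite /I; right; wpexp; rewrite ?e21 ?e23'.
  rewrite !addn1; do !split=> //; try lia.
case: eqP => // hz _; have {}hz : (Vof m d.+1 cid).1 <> 0 by rewrite -hval2.
apply/wpcP; wpexp; rewrite ?e21; wsolve.
exists (k.+2 - d.+1); first by lia.
have [_ [_ [_ /(_ hV1 hz)[hp2 hn2]]]] := hch (Vof m1).
rewrite /I; right; wpexp; rewrite ?e21 ?e23' ?addn1; do !split=> //; try lia.
Qed.
End Insert.

Section Delete.
Variables (A B : pred nat) (o : st) (x : nat).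
Hypotheses (henv : env o) (hB : bounded B (pw k)) (hv : veb (ar o) B)
  (hx : vr o 20 = x) (hadd : add1 A x B).

Lemma delete_ok : wp bd lim delete (fun o' => veb (ar o') A /\
  tm o' <= tm o + 30 * k.+2 + 4) o.
Proof.
have [h2 h4 h14] := henv.
have hA : bounded A (pw k).
  by case: hadd => _ e y hy; apply: hB; rewrite e hy orbT.
have hxk : x < pw k by apply: hB; rewrite (proj2 hadd) eqxx.
have b0 := bd_ok (d := 0) isT.
have [t0 et0] : exists t, t = tm o by exists (tm o).
rewrite -et0; apply/wpcP; do 3 (split; first by rewrite /=; lia).
(* The table moves from [B] to [A], while [node_ok] keeps the order in which [x] is added. *)
pose I j o' := (vr o' 23 = 0 /\ j = 0 /\ veb (ar o') A /\
     tm o' <= t0 + 30 * k.+2 + 3) \/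
  (vr o' 23 = 1 /\ j = k.+2 - vr o' 21 /\
   node_ok k qd ud A B (vr o' 21) (vr o' 22) (vr o' 20) /\
   partial k qd ud B A (Vof (ar o')) (vr o' 21) (vr o' 22) /\
   vr o' 22 < width (vr o' 21) /\ tm o' <= t0 + 30 * vr o' 21 + 3).
rewrite /=; apply: (@wp_while _ _ I _ _ _ _ k.+2).
  right=> /=; rewrite subn0 muln0 hx; split=> //; split=> //; split.
    by split.
  split; last by split; lia.
  move=> d' id' hd'; rewrite hv //; case: ifP => // hs.
  apply: eq_nodeval; apply: (cont_anc ud_k (leq0n d')) => //.
  move=> y; move: hs; rewrite /sub leq0n /=.
  by case: (anc _ _ _ _) => [|?] //; rewrite eqxx.
move=> j [v m t] hI [hr ha]; split=> //.
have {}h2 : v 2 = k := etrans (hr 2 isT) h2.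
have {}h4 : v 4 = k.+2 := etrans (hr 4 isT) h4.
have {}h14 i : i < k -> m 14 i = pw i.
  by move=> hi; have := congr1 (fun f => f i) (ha 14 isT) => /= ->; apply: h14.
case: hI => /=.
  by case=> -> [_ [h ht]] /=; split=> //; lia.
case=> e23 [ej [hn [hp [hid ht]]]]; rewrite /= e23 /=.
have hd := node_leaf ud_le ud_S ud_k hB hn.
move ed : (v 21) ej hn hp hid ht hd => d ej hn hp hid ht hd.
move eid : (v 22) hn hp hid => id hn hp hid.
move ey : (v 20) hn => y hn.
have hdk : d <= k.+1 by lia.
have bi := bd_ok hdk.
have bix : id * k.+2 + d < bd.
  have : id.+1 * k.+2 <= width d * k.+2 by rewrite leq_mul2r hid orbT.
  by rewrite mulSn; lia.
have by_ : y + k < bd.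
  by case: hn => _ hy _; have := ud_le_pw d; lia.
have wix : id * k.+2 + d = id * k.+2 + d by [].
apply: wp_seq; apply/wpcP; rewrite /load_node; wpexp; rewrite ?ed ?eid ?h4.
wsolve.
apply: wp_if; wpexp; [by wsolve | |].
  case: eqP => // hmm _.
  have hfin := delete_single ud_le ud_S ud_k hA hB hn hp hmm.
  apply/wpcP; wpexp; wsolve.
  exists 0; first by lia.
  rewrite /I; left; wpexp; do !split=> //; last by lia.
  by move=> d' id' hd'; rewrite (@Vof_upd _ _ d id _ _ _ _ wix hdk hd'); exact: hfin.
case: eqP => // hne _.
have hne2 : (Vof m d id).1 != (Vof m d id).2 by apply/eqP.
have [hv1 hv2] := @node_le B d id; rewrite -(partial_id hdk hp) /Vof /= in hv1 hv2.
have eq : m 14 (k - 1 - d) = qd d by apply: h14; lia.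
have [q1 [q2 q3]] := qd_le d.
set sid := id * (qd d).+1.
have esid : id * (qd d + 1) = sid by rewrite addn1.
have hc c : c <= qd d -> (Vof m d.+1 (sid + c)).1 <= qd d /\
    (Vof m d.+1 (sid + c)).2 <= qd d.
  move=> hcq; rewrite (partial_val_child ud_S ud_k hd hcq hp) /=.
  by split; [case: fstP | apply: prv_le].
have [hs1 hs2] := hc 0 (leq0n _); rewrite addn0 in hs1 hs2.
have hmul z : z <= z * k.+2 by rewrite leq_pmulr.
have hw c : c <= qd d -> sid + c < bd /\ (sid + c) * k.+2 + d + 1 + k + 4 < bd.
  move=> hcq; have [_ w] := width_idx hd hid hcq.
  by have := hmul (sid + c); rewrite -/sid in w; lia.
have [w1 w2] := hw 0 (leq0n _); rewrite addn0 in w1 w2.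
have idx c : (sid + c) * k.+2 + d + 1 = (sid + c) * k.+2 + d.+1.
  by rewrite addn1 addnS.
have idx0 := idx 0; rewrite addn0 in idx0.
apply: wp_seq; apply/wpcP; wpexp; rewrite h2 ed eq; wsolve.
apply: wp_seq; apply/wpcP; wpexp; rewrite eid esid; wsolve.
apply: wp_seq; apply/wpcP; wpexp; rewrite h4 ed idx0; wsolve.
apply: wp_seq; apply/wpcP; wpexp; wsolve.
set sm := m 12 (sid * k.+2 + d.+1).
have esm : (Vof m d.+1 sid).1 = sm by [].
set pm := m 13 (sid * k.+2 + d.+1).
have hpm : pm <= qd d := hs2.
have hsm : sm <= qd d := hs1.
have [ws1 ws2] := hw sm hsm; have [wp1 wp2] := hw pm hpm.
have [na1 na2] := @node_le A d id.
apply: wp_seq.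
apply: (@wp_consequence _ _ _ (fun o' => tm o' <= t + 18 /\
  ((vr o' 23 = 0 /\ veb (ar o') A) \/
   [/\ vr o' 23 = 1, (nodeval qd ud A d id).1 != (nodeval qd ud A d id).2,
      vr o' 20 = prom y (nodeval qd ud A d id)
    & forall d' id', d' <= k.+1 -> Vof (ar o') d' id' =
       upd2 (Vof m) d id (nodeval qd ud A d id) d' id']))).
  case: (sm =P 0) => [sm0|smn].
    have htwo v' := @delete_two _ _ _ qd_gt0 ud_le ud_S ud_k _ _ _ _ _ hA hB hn
      (Vof m) v' hp hne2 sm0.
    have [hor hfin] := htwo _ erefl; rewrite /Vof /= in hor hfin.
    apply/wpcP; wpexp; rewrite ey sm0; wsolve.
    rewrite !eqb0 !addn1 (eqxx 0); case: eqP hor hfin => hmn hor hfin;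
      cbv beta iota delta [negb]; wsolve.
      left; split=> // d' id' hd'.
      rewrite (@Vof_upd12 _ _ d id _ _ _ wix hdk hd') -hfin //.
    move/eqP: hor => hor; wsolve.
    rewrite hor eqxx; cbv beta iota delta [negb].
    wsolve.
    left; split=> // d' id' hd'.
    by rewrite (@Vof_upd13 _ _ d id _ _ _ wix hdk hd') -hfin.
  pose fi := sm.-1 * qd d + m 12 ((sid + sm) * k.+2 + d.+1).
  pose pi := pm.-1 * qd d + m 13 ((sid + pm) * k.+2 + d.+1).
  have [] := @delete_step _ _ _ qd_gt0 ud_le ud_S ud_k _ _ _ _ _ hB hn
      (Vof m) fi pi _ _ hp hne2 smn erefl erefl erefl erefl.
  move=> e1 e2 e3; rewrite /Vof /= in e1 e2.
  have efi : m 12 ((sid + sm) * k.+2 + d).+1 = m 12 ((sid + sm) * k.+2 + d.+1).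
    by rewrite addnS.
  have epi : m 13 ((sid + pm) * k.+2 + d).+1 = m 13 ((sid + pm) * k.+2 + d.+1).
    by rewrite addnS.
  apply/wpcP; wpexp; rewrite ey h4 ed; wsolve.
  rewrite !eqb0 !addn1 !subn1 efi epi (introF eqP smn); case: eqP e1 e2 => hmn e1 e2;
    cbv beta iota delta [negb].
    have hfi : fi <= pw k by move: na1 na2; rewrite -e2 /=; apply: leq_trans.
    have hfi2 : sm.-1 * qd d <= fi by rewrite leq_addr.
    rewrite -/fi; wsolve.
    right; split=> // d' id' hd'.
    by rewrite (@Vof_upd12 _ _ d id _ _ _ wix hdk hd') -e2.
  wsolve.
  case: eqP e1 e2 => hmx e1 e2; cbv beta iota delta [negb].
    have hpi : pi <= pw k by move: na2; rewrite -e2.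
    have hpi2 : pm.-1 * qd d <= pi by rewrite leq_addr.
    rewrite -/pm -/pi; wsolve.
    right; split=> // d' id' hd'.
    by rewrite (@Vof_upd13 _ _ d id _ _ _ wix hdk hd') -e2.
  split; first by lia.
  right; split=> // d' id' hd'.
  by rewrite -e2 /upd2 /Vof; case: ifP => // /andP[/eqP-> /eqP->].
move=> [v1 m1 t1] [/= ht1 hor] [a1 b1].
have e2 : v1 2 = k := etrans (a1 2 isT) h2.
have e4 : v1 4 = k.+2 := etrans (a1 4 isT) h4.
have e21 : v1 21 = d := etrans (a1 21 isT) ed.
have e22 : v1 22 = id := etrans (a1 22 isT) eid.
have e27 : v1 27 = qd d := a1 27 isT.
have e33 : v1 33 = sid := a1 33 isT.
apply: wp_if; wpexp; [by [] | |]; last first.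
  case: hor => [[e0 hve] _|[-> //]].
  apply/wpcP; wpexp; exists 0; first by lia.
  by rewrite /I; left; wpexp; do !split=> //; lia.
case: hor => [[-> //]|[e23' hneA ex20 hV1] _].
have [hdlt hxu hh _ _] := step_facts qd_gt0 ud_le ud_S ud_k hB hn hneA.
have hch := delete_child qd_gt0 ud_le ud_S ud_k hB hn hp hneA.
have hsu := delete_summary qd_gt0 ud_le ud_S ud_k hB hn hp hneA.
set x2 := prom y (nodeval qd ud A d id) in ex20 hh hxu hch hsu.
set h := x2 %/ qd d in hh hch hsu; set l := x2 %% qd d in hch.
have hl : l < qd d by rewrite ltn_mod qd_gt0.
have [wc1 wc2] := hw h.+1 hh; rewrite -/sid in hch hsu.
set cid := sid + h.+1 in wc1 wc2 hch hsu.
have ecid : sid + h + 1 = cid by rewrite addn1 /cid addnS.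
have ecix : cid * k.+2 + d + 1 = cid * k.+2 + d.+1 by rewrite addn1 addnS.
have mc := hmul cid.
have [wid1 _] := width_idx hd hid (leq0n (qd d)).
have [wid2 _] := width_idx hd hid hh.
rewrite addn0 -/sid in wid1; rewrite -/sid -/cid in wid2.
do 5 (apply: wp_seq; apply/wpcP; wpexp;
  rewrite ?ex20 ?e27 ?e33 ?e4 ?e21 -/h -/l ?ecid ?ecix; wsolve).
have hval2 : Vof m1 d.+1 cid = Vof m d.+1 cid.
  by rewrite hV1 // /upd2 (_ : d.+1 == d = false) //; lia.
apply: wp_if; wpexp; [by wsolve | |].
  case: eqP => // hz _.
  have {}hz : (Vof m d.+1 cid).1 = (Vof m d.+1 cid).2 by rewrite -hval2.
  apply/wpcP; wpexp; wsolve.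
  exists (k.+2 - d.+1); first by lia.
  set m2 := aupd _ _ _ _.
  have [|hp2 hn2] := hsu (Vof m2) hz.
    move=> d' id' hd'; rewrite /m2 (@Vof_upd _ _ d.+1 cid _ _ _ _ erefl) //.
    by rewrite /upd2; case: ifP => // _; rewrite hV1.
  rewrite /I; right; wpexp; rewrite ?e23' ?e33 ?addn1.
  do !split=> //; try lia.
case: eqP => // hz _.
have {}hz : (Vof m d.+1 cid).1 != (Vof m d.+1 cid).2 by rewrite -hval2; apply/eqP.
have [hp2 hn2] := hch (Vof m1) hz hV1.
apply/wpcP; wpexp; wsolve.
exists (k.+2 - d.+1); first by lia.
rewrite /I; right; wpexp; rewrite ?e23' ?e33 ?addn1; do !split=> //; try lia.
Qed.
End Delete.

Section Pred.
Variables (S : pred nat) (o : st) (x : nat).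
Hypotheses (henv : env o) (hS : bounded S (pw k)) (hv : veb (ar o) S)
  (hx : vr o 20 = x) (hxb : x + 1 < bd).

Let V := Vof (ar o).
Let hV : forall d id, d <= k.+1 -> V d id = nodeval qd ud S d id := hv.

(** The factor 42 is 27 for a step down plus 15 for a step up. *)
Lemma pred_ok : wp bd lim predecessor (fun o' => vr o' 32 = prv S x /\
  tm o' <= tm o + 42 * k.+2 + 6) o.
Proof.
have [h2 h4 h14] := henv.
have b0 := bd_ok (d := 0) isT.
have [t0 et0] : exists t, t = tm o by exists (tm o).
have [A eA] : exists A, A = ar o by exists (ar o).
rewrite -et0; apply/wpcP; do 3 (split; first by rewrite /=; lia).
(* At depth [k.+1] only a summary is ever entered, with answer 0. This keeps the answer within the
   universe on the way up from there, where the bound by the square [qd k * qd k] would be too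
   weak. *)
pose J o' := [/\ vr o' 21 <= k.+1, vr o' 22 < width (vr o' 21),
   (vr o' 21 = k.+1 -> vr o' 22 %% (qd k).+1 = 0)
   & ar o' = A].
pose I j o' := J o' /\
  ((vr o' 23 = 0 /\ j = 0 /\ tm o' <= t0 + 27 * k.+2 + 3 /\
    unwind qd V (vr o' 21) (vr o' 22) (vr o' 32) = prv S x /\
    vr o' 32 <= ud (vr o' 21) /\ (vr o' 21 = k.+1 -> vr o' 32 = 0)) \/
   (vr o' 23 = 1 /\ j = k.+2 - vr o' 21 /\ tm o' <= t0 + 27 * vr o' 21 + 3 /\
    unwind qd V (vr o' 21) (vr o' 22)
      (prv (cont qd ud S (vr o' 21) (vr o' 22)) (vr o' 20)) = prv S x /\
    vr o' 20 + 1 < bd)).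
pose I2 j o' := J o' /\ j = vr o' 21 /\
    tm o' <= t0 + 27 * k.+2 + 4 + 15 * (k.+1 - vr o' 21) /\
    unwind qd V (vr o' 21) (vr o' 22) (vr o' 32) = prv S x /\
    vr o' 32 <= ud (vr o' 21) /\ (vr o' 21 = k.+1 -> vr o' 32 = 0).
rewrite /=; apply: (@wp_while _ _ I _ _ _ _ k.+2).
  rewrite /I /J /= hx eA; split; first by split.
  by right; wsafe => //; lia.
move=> j [v m t] hI [hr _]; split=> //.
have {}h2 : v 2 = k := etrans (hr 2 isT) h2.
have {}h4 : v 4 = k.+2 := etrans (hr 4 isT) h4.
have hn z d id : Vof z d id = (z 12 (id * k.+2 + d), z 13 (id * k.+2 + d)) by [].
case: hI => -[/= hdk hid hleaf hm].
have {}h14 i : i < k -> m 14 i = pw i by move=> hi; rewrite hm eA; apply: h14.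
have hVm : V = Vof m by rewrite /V hm eA.
case.
  case=> -> [_ [ht [hu [hrb hlf]]]] /=.
  apply: (@wp_while _ _ I2 _ _ _ _ (v 21)).
    by rewrite /I2 /J /=; wsafe => //; lia.
  move=> {}j [v1 m1 t1] hI [hr1 _]; split=> //.
  have {}h2 : v1 2 = k := etrans (hr1 2 isT) h2.
  have {}h4 : v1 4 = k.+2 := etrans (hr1 4 isT) h4.
  case: hI => -[/= hdk1 hid1 hleaf1 hm1] [ej [ht1 [hu1 [hrb1 hlf1]]]].
  rewrite -hm in hm1; clear hdk hid hleaf ht hu hrb hlf hr hr1 eA et0.
  case: eqP => e21.
    by split; [move: hu1; rewrite e21 | rewrite e21 in ht1; lia].
  move ed : (v1 21) e21 ej hdk1 hid1 hleaf1 ht1 hu1 hrb1 hlf1 => [//|d] _.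
  move=> ej hdk1 hid1 hleaf1 ht1 hu1 hrb1 hlf1.
  move eid : (v1 22) hid1 hleaf1 hu1 => id hid1 hleaf1 hu1.
  move er : (v1 32) hu1 hrb1 hlf1 => r hu1 hrb1 hlf1.
  have eq : m1 14 (k - 1 - d) = qd d by rewrite hm1; apply: h14; clear -k_gt0; lia.
  have [q1 [q2 q3]] := qd_le d.
  have hdk' : d <= k := hdk1.
  set c := id %% (qd d).+1; set pid := id %/ (qd d).+1.
  have hc : c <= qd d by rewrite -ltnS ltn_mod.
  have hpid : pid < width d by rewrite ltn_divLR.
  have hcd : d = k -> c = 0 by move=> e; rewrite /c e hleaf1 ?e.
  have hux : unwind qd V d pid (if c is h.+1 then h * qd d + r else
      if r is r'.+1 then r' * qd d + (V d.+1 (pid * (qd d).+1 + r'.+1)).2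
      else (V d pid).1) = prv S x by [].
  have hcr : (c - 1) * qd d + r <= ud d /\ (r - 1) * qd d + qd d <= ud d \/
             c = 0 /\ r = 0.
    case: (ltngtP d k) hdk' => // hd _; last by right; rewrite hcd // hlf1 ?hd.
    left; rewrite (ud_sq hd); rewrite /= in hrb1.
    have -> : qd d * qd d = (qd d - 1) * qd d + qd d.
      by rewrite mulnBl mul1n subnK // leq_pmulr // qd_gt0.
    by split; apply: leq_add; rewrite // leq_mul2r leq_sub2r ?orbT.
  have hup := ud_le_pw d.
  apply/wpcP; rewrite /pred_up; wpexp; rewrite h2 h4 ed eid er.
  rewrite !subn1 /= -subn1 eq !addn1 -/c -/pid; rewrite !subn1 in hcr.
  rewrite hVm hm1 in hux *.
  clearbody c pid.
  have hnv z id' : z <= k.+1 -> (Vof m z id').1 <= ud z /\ (Vof m z id').2 <= ud z.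
    move=> hz; rewrite -hVm hV //; have [n1 _] := node_le S z id'.
    by have n2 := prv_le (cont qd ud S z id') (ud z); split=> //; apply: leq_trans n1 n2.
  have bix : pid * k.+2 + d < bd.
    have := bd_ok (d := d) (leqW hdk').
    have : pid.+1 * k.+2 <= width d * k.+2 by rewrite leq_mul2r hpid orbT.
    by rewrite mulSn; clear -k_gt0 hdk'; lia.
  have hfin r' : r' <= ud d -> unwind qd (Vof m) d pid r' = prv S x ->
    forall t2, t2 <= t1 + 10 ->
    exists2 j' : nat, j' < j & I2 j' (St (fun y => if Nat.eqb y 32 then r' else
      if Nat.eqb y 22 then pid else if Nat.eqb y 28 then c else
      if Nat.eqb y 27 then qd d else if Nat.eqb y 21 then d else v1 y) m t2).
    move=> k1 k2 t2 k3; exists d; first by rewrite ej.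
    rewrite /I2 /J; cbv beta iota delta [vr ar tm Nat.eqb].
    have hnk : d <> k.+1 by move=> e; move: hdk1; rewrite e ltnn.
    rewrite hVm; split; first by split=> //; apply: ltnW.
    split; first by [].
    split; first by clear -ht1 hdk1 k3; lia.
    by split.
  clear hid1 hleaf1 hlf1 hcd ej.
  wsolve.
  rewrite eqb0; case: eqP hux hcr => hc0; cbv beta iota delta [negb]; last first.
    move: hc0; case: (c) => // c' _ /= hux [hcr|[//]].
    wsolve.
    by apply: hfin => //; lia.
  rewrite hc0 /= => hux hcr; wsolve.
  rewrite eqb0; case: eqP hux hcr => hr0; cbv beta iota delta [negb]; last first.
    move: hr0 hrb1; case: (r) => // r' _ /= hrb1 hux [hcr|[_ //]].
    have [w1 w2] := width_idx hdk' hpid hrb1.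
    have hmul z : z <= z * k.+2 by rewrite leq_pmulr.
    have w3 := hmul (pid * (qd d).+1 + r'.+1).
    have w4 := hmul (pid * (qd d).+1).
    have [_ n2] := hnv d.+1 (pid * (qd d).+1 + r'.+1) hdk1.
    rewrite /Vof /= addnS in n2.
    wsolve.
    apply: hfin => //; try lia.
    by move: hux; rewrite /Vof /= !addnS.
  rewrite hr0 => hux _; wsolve.
  apply: hfin => //; last by lia.
  by have [n1 _] := hnv d pid (leqW hdk').
case=> e23 [ej [ht [hu hyb]]]; rewrite /= e23 /=.
move ed : (v 21) ej hdk hid hleaf ht hu => d ej hdk hid hleaf ht hu.
move eid : (v 22) hid hleaf hu => id hid hleaf hu.
move ey : (v 20) hu hyb => y hu hyb.
have bi := bd_ok hdk.
have bix : id * k.+2 + d < bd.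
  have : id.+1 * k.+2 <= width d * k.+2 by rewrite leq_mul2r hid orbT.
  by rewrite mulSn; lia.
have hnode z : V z = Vof m z by rewrite hVm.
have hleaf0 id' : (Vof m k.+1 id').1 = 0.
  rewrite -hnode hV // -[LHS]/(fst1 (cont qd ud S k.+1 id') (ud k.+1)).
  apply: fst0 => z _.
  by rewrite (cont_leaf ud_le ud_S ud_k).
have hmx : m 13 (id * k.+2 + d) <= ud d.
  have := prv_le (cont qd ud S d id) (ud d).
  by rewrite -[prv _ _]/(nodeval qd ud S d id).2 -hV // hnode.
have hstop r : prv (cont qd ud S d id) y = r -> r <= ud d -> (d = k.+1 -> r = 0) ->
  forall v1 t1, v1 21 = d -> v1 22 = id -> v1 23 = 0 -> v1 32 = r -> t1 <= t + 20 ->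
  exists2 j', j' < j & I j' (St v1 m t1).
  move=> hr1 hr2 hr3 v1 t1 h21 h22 h23 h32 ht1; exists 0; first by lia.
  rewrite /I /J; cbv beta iota delta [vr ar tm]; rewrite h21 h22 h23 h32.
  split; first (split; [exact: hdk | exact: hid | exact: hleaf | exact: hm]).
  left; split; first by [].
  split; first by [].
  split; first by lia.
  by split; [rewrite -hu hr1 | split].
rewrite /pred_down.
apply: wp_seq; apply/wpcP; rewrite /load_node; wpexp; rewrite ?ed ?eid ?h4; wsolve.
apply: wp_if; wpexp; [by wsolve | |].
  case: eqP => // hmn _; apply/wpcP; wpexp; wsolve.
    by apply: (@hstop 0) => //; [apply: (pred_none ud_le ud_S hS hV y hdk); rewrite hnode | lia].
case: eqP => // hmn _.
apply: wp_if; wpexp; [by rewrite ?ey; wsolve | |].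
  rewrite ey; case: ltnP => // hmy _; apply/wpcP; wpexp; wsolve.
    apply: (@hstop (m 13 (id * k.+2 + d))) => //; last by lia.
      2: by move=> e; case: hmn; have h0 := hleaf0 id; rewrite -e in h0; exact: h0.
    by rewrite (pred_max ud_le ud_S hS hV hdk) hnode //; rewrite /Vof /=; lia.
rewrite ey; case: ltnP => // hmy _.
apply: wp_if; wpexp; [by rewrite ?ey; wsolve | |].
  rewrite ey; case: ltnP => // hyn _; apply/wpcP; wpexp; wsolve.
    by apply: (@hstop 0) => //; [apply: (pred_min hV hdk); rewrite hnode | lia].
rewrite ey; case: ltnP => // hyn _.
have [] := @pred_step _ _ _ qd_gt0 ud_le ud_S ud_k _ _ hS hV d id y hdk.
- by rewrite hnode; apply/eqP.
- by rewrite hnode /Vof /=; lia.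
have hl0 : y %% qd d < qd d by rewrite ltn_mod qd_gt0.
move eh : (y %/ qd d) => h; move el : (y %% qd d) hl0 => l hl hdk' hh.
rewrite hnode /=; set cid := id * (qd d).+1 + h.+1; set sid := id * (qd d).+1.
rewrite hu => hstep.
have eq : m 14 (k - 1 - d) = qd d by apply: h14; lia.
have [q1 [q2 q3]] := qd_le d.
have [w1 w2] := width_idx hdk' hid hh.
have [w3 w4] := width_idx hdk' hid (leq0n (qd d)).
rewrite addn0 -/sid in w3 w4; rewrite -/cid in w1 w2.
have hmul z : z <= z * k.+2 by rewrite leq_pmulr.
have n1 := hmul cid; have n2 := hmul sid.
have esid : id * (qd d + 1) = sid by rewrite addn1.
have ecid : sid + h + 1 = cid by rewrite addn1 /cid addnS.
have ecix : cid * k.+2 + d + 1 = cid * k.+2 + d.+1 by rewrite addn1 addnS.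
have hsid0 : sid %% (qd d).+1 = 0 by rewrite modnMl.
have ecs : sid + h < cid by rewrite /cid addnS.
have hgo id' y' : id' < width d.+1 -> y' + 1 < bd ->
  (d.+1 = k.+1 -> id' %% (qd k).+1 = 0) ->
  unwind qd V d.+1 id' (prv (cont qd ud S d.+1 id') y') = prv S x ->
  forall v1 t1, v1 21 = d + 1 -> v1 22 = id' -> v1 23 = 1 -> v1 20 = y' -> t1 <= t + 20 ->
  exists2 j', j' < j & I j' (St v1 m t1).
  move=> k1 k2 k3 k4 v1 t1 h21 h22 h23 h20 ht1; exists (k.+2 - d.+1).
    by clear -ej hdk'; lia.
  rewrite addn1 in h21.
  rewrite /I /J; cbv beta iota delta [vr ar tm]; rewrite h21 h22 h23 h20.
  split; first by split.
  right; split; first by [].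
  split; first by [].
  split; first by clear -ht ht1; lia.
  by split; [exact: k4 | exact: k2].
apply: wp_seq; apply/wpcP; rewrite /split_key; wpexp.
rewrite h2 h4 ed eid eq ey esid eh el ecid ecix.
clearbody cid sid; clear eh el hstop; wsolve.
apply: wp_seq; apply/wpcP; wpexp; rewrite ed; wsolve.
apply: wp_seq; apply/wpcP; wpexp; wsolve.
have hcond : ((0 < m 12 (cid * k.+2 + d.+1)) * (m 12 (cid * k.+2 + d.+1) < l + 1) != 0) =
    (0 < m 12 (cid * k.+2 + d.+1) <= l).
  by rewrite addn1 ltnS; case: (0 < _); case: (_ <= l).
apply: wp_if; wpexp; [by wsolve | move=> hz | move=> hz].
  have hc : 0 < m 12 (cid * k.+2 + d.+1) <= l by rewrite -hcond; apply/eqP.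
  rewrite hc in hstep.
  apply/wpcP; wpexp; wsolve; apply: (hgo cid l) => //; try lia.
  move=> [e]; have h0 := hleaf0 cid; rewrite -e in h0.
  by move: hc; rewrite -[m 12 _]/(Vof m d.+1 cid).1 h0.
have hc : 0 < m 12 (cid * k.+2 + d.+1) <= l = false by rewrite -hcond hz.
rewrite hc in hstep.
apply/wpcP; wpexp; wsolve; apply: (hgo sid h) => //; try lia.
by move=> [<-]; rewrite hsid0.
Qed.
End Pred.
End Veb.

(** * The column sweep *)

Open Scope imp_scope.

Notation wn := 0 (only parsing).
Notation wK := 1 (only parsing).
Notation wp_ := 3 (only parsing).
Notation wi := 5 (only parsing).
Notation wc := 6 (only parsing).
Notation wev := 7 (only parsing).
Notation wm := 8 (only parsing).
Notation wro := 9 (only parsing).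
Notation wx := 10 (only parsing).
Notation we := 11 (only parsing).
Notation ws := 12 (only parsing).
Notation wb := 13 (only parsing).

(** [aHD] and [aNX] are the linked lists of the events of each column, with ends
    in [aEA] and [aEB]; [aTop], [aBot] and [aIN] hold [tops], [bots] and the set in
    the tree.  [aXL] lists the touched rows, followed by the ends of the old
    strips that contain them, with starts in [aOL].  For the start [s] of a current
    strip, [aEN] holds its end and [aST] the first column where it occurs. *)
Notation aHD := 1 (only parsing).
Notation aNX := 2 (only parsing).
Notation aEA := 3 (only parsing).
Notation aEB := 4 (only parsing).
Notation aTop := 5 (only parsing).
Notation aBot := 6 (only parsing).
Notation aXL := 7 (only parsing).
Notation aOL := 8 (only parsing).
Notation aIN := 9 (only parsing).
Notation aEN := 10 (only parsing).
Notation aST := 11 (only parsing).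

(** The keys are rows up to [n + 1], hence a universe of at least [n + 2]; repeated squaring
    produces the sizes of all levels. *)
Definition init_levels : cmd :=
  wp_ <- EC 2;; vk <- EC 0;;
  While (wp_ < wn + EC 2)
    (Sto aPW vk wp_;; wp_ <- wp_ * wp_;; vk <- vk + EC 1);;
  vk2 <- vk + EC 2.

Definition add_event (col : nat) : cmd :=
  Sto aEA wev wx;; Sto aEB wev we;;
  Sto aNX wev (aHD.[col]);; Sto aHD col wev;; wev <- wev + EC 1.

(** Events are numbered from 1, so that 0 ends a list. After this loop the input is not read again,
    and the output may overwrite it in array 0. *)
Definition load_events : cmd :=
  wi <- EC 0;; wev <- EC 1;;
  While (wi < wK)
    (wx <- EL 0 (EC 2 + EC 4 * wi);;
     we <- EL 0 (EC 3 + EC 4 * wi) + EC 1;;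
     ws <- EL 0 (EC 4 + EC 4 * wi);;
     wb <- EL 0 (EC 5 + EC 4 * wi) + EC 1;;
     add_event ws;; add_event wb;;
     wi <- wi + EC 1).

(** A row may be listed several times. The loops over the list tolerate this: the tests on [aIN] and
    [aEN] make a second treatment harmless. *)
Definition collect : cmd :=
  wm <- EC 0;; wev <- aHD.[wc];;
  While wev
    (wx <- aEA.[wev];; we <- aEB.[wev];;
     Sto aTop wx (EC 1 - aTop.[wx]);;
     Sto aBot we (EC 1 - aBot.[we]);;
     Sto aXL wm wx;; Sto aXL (wm + EC 1) we;;
     wm <- wm + EC 2;; wev <- aNX.[wev]).

(** Runs while the tree and [aEN] still describe the previous column. A row outside every old strip
    is recorded by zeros, which later loops skip: no strip starts or ends at row 0. *)
Definition query : cmd :=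
  wi <- EC 0;;
  While (wi < wm)
    (wx <- aXL.[wi];; vx <- wx + EC 1;; predecessor;;
     ws <- vr_ - EC 1;; we <- aEN.[ws];;
     If ((vr_ == EC 0) + (we < wx))
       (Sto aOL wi (EC 0);; Sto aXL (wm + wi) (EC 0))
       (Sto aOL wi ws;; Sto aXL (wm + wi) we);;
     wi <- wi + EC 1).

Definition update : cmd :=
  wi <- EC 0;;
  While (wi < wm)
    (wx <- aXL.[wi];; wb <- aTop.[wx] * (EC 1 - aBot.[wx]);;
     vx <- wx;;
     If (wb == aIN.[wx]) Skip
       (If wb insert delete;; Sto aIN wx wb);;
     wi <- wi + EC 1).

(** Tree, [aTop] and [aBot] already belong to the new column, which decides whether the old strip
    persists; otherwise its slab ends in the column before [wc]. *)
Definition flush : cmd :=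
  wi <- EC 0;;
  While (wi < wm)
    (ws <- aOL.[wi];; we <- aEN.[ws];; vx <- we;; predecessor;;
     If ((we == EC 0) + aBot.[we] * (EC 1 - aTop.[we]) * (vr_ == ws + EC 1))
       Skip
       (Sto 0 (EC 1 + EC 4 * wro) ws;;
        Sto 0 (EC 2 + EC 4 * wro) (we - EC 1);;
        Sto 0 (EC 3 + EC 4 * wro) (aST.[ws]);;
        Sto 0 (EC 4 + EC 4 * wro) (wc - EC 1);;
        wro <- wro + EC 1;;
        Sto aEN ws (EC 0));;
     wi <- wi + EC 1).

(** An entry of [aEN] that survived [flush] belongs to a strip of both columns and must keep its
    first column, hence the test for 0. *)
Definition create : cmd :=
  wi <- EC 0;;
  While (wi < wm + wm)
    (we <- aXL.[wi];;
     If (aBot.[we] * (EC 1 - aTop.[we]))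
       (vx <- we;; predecessor;; ws <- vr_ - EC 1;;
        If (aEN.[ws] == EC 0) (Sto aEN ws we;; Sto aST ws wc) Skip)
       Skip;;
     wi <- wi + EC 1).

Definition sweep_column : cmd :=
  collect;; query;; update;; flush;; create;; wc <- wc + EC 1.

(** Column [n + 1] is swept too: no slab meets it, so all remaining runs are closed there. *)
Definition sweep : cmd :=
  load_events;;
  wc <- EC 1;; wro <- EC 0;;
  While (wc < wn + EC 2) sweep_column;;
  Sto 0 (EC 0) wro.

Definition decompose : cmd :=
  wn <- EL 0 (EC 0);; wK <- EL 0 (EC 1);; init_levels;; sweep.

Close Scope imp_scope.

(** * Correctness of the column sweep *)

Section Levels.
Variables (bd lim n : nat).

Lemma init_levels_ok o : vr o 0 = n -> (n + 2) * (n + 2) + 10 <= bd -> 0 < n ->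
  wp bd lim init_levels (fun o' =>
    exists k, [/\ vr o' 2 = k, vr o' 4 = k.+2,
      forall j, j < k -> ar o' 14 j = pw j,
      0 < k /\ pw k.-1 < n + 2 <= pw k & tm o' <= tm o + 4 * k + 4]) o.
Proof.
case: o => v0 m0 t0 /= hn hb n0.
pose I j o' := [/\ vr o' 3 = pw (vr o' 2), j = n + 2 - vr o' 2,
  forall i, i < vr o' 2 -> ar o' 14 i = pw i,
  (0 < vr o' 2 -> pw (vr o' 2).-1 < n + 2) & tm o' <= t0 + 4 * vr o' 2 + 2].
rewrite /init_levels; do 2 (apply: wp_seq; apply/wpcP; wpexp; split; first by lia).
apply: wp_seq; apply: (@wp_while _ _ I _ _ _ _ (n + 2)).
  by rewrite /I; wpexp; split=> //; lia.
move=> j [v m t] [/= h3 hj hPW hlow ht] [hr _].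
have {}hn : v 0 = n := etrans (hr 0 isT) hn.
have hk : v 2 < pw (v 2).
  by apply: ltn_trans (ltn_expl _ (isT : 1 < 2)) _; rewrite ltn_exp2l // ltn_expl.
split; first by rewrite hn; wsolve.
rewrite hn h3; case: ltnP => hlt /=.
  have hsq : pw (v 2) * pw (v 2) <= (n + 2) * (n + 2).
    by apply: leq_mul; apply: ltnW.
  have hle : n + 2 <= (n + 2) * (n + 2) by rewrite leq_pmulr //; lia.
  apply/wpcP; wpexp; rewrite h3; wsolve.
  exists (n + 2 - (v 2).+1); first by lia.
  rewrite /I; wpexp; rewrite !addn1; split=> //; try lia.
  - by rewrite pwS.
  - by move=> i hi; rewrite /=; case: eqP => [->|ne] //; apply: hPW; lia.
apply/wpcP; wpexp; wsolve.
  have : v 2 <= n + 2.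
    case: (posnP (v 2)) => [->//|h0]; have := hlow h0.
    have : (v 2).-1 < pw (v 2).-1.
      by apply: ltn_trans (ltn_expl _ (isT : 1 < 2)) _; rewrite ltn_exp2l // ltn_expl.
    by lia.
  have hle : n + 2 <= (n + 2) * (n + 2) by rewrite leq_pmulr //; lia.
  by lia.
(* At least one squaring has taken place, because [pw 0 = 2] is less than [n + 2]. *)
have h0 : 0 < v 2.
  by rewrite lt0n; apply/eqP=> e; move: hlt; rewrite e /pw /=; lia.
by exists (v 2); split=> //; try lia; split=> //; rewrite hlow.
Qed.
End Levels.

Fixpoint chain (A : nat -> nat -> nat) (ev h : nat) (l : seq (nat * nat)) : Prop :=
  if l is p :: l' then
    [/\ 0 < h < ev, A 3 h = p.1, A 4 h = p.2 & chain A ev (A 2 h) l']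
  else h = 0.

(** Lists already built use only numbers below [ev], so pushing a fresh event disturbs none of
    them. *)
Lemma chain_frame A A' ev ev' h l : chain A ev h l -> ev <= ev' ->
  (forall j, j < ev -> [/\ A' 2 j = A 2 j, A' 3 j = A 3 j & A' 4 j = A 4 j]) ->
  chain A' ev' h l.
Proof.
move=> + hev hA; elim: l h => //= p l IH h [h1 h2 h3 h4].
have [e1 e2 e3] := hA h (proj2 (andP h1)).
by split; [lia | rewrite e2 | rewrite e3 | rewrite e1; apply: IH].
Qed.

Lemma nth_encode_slabs (S : seq slab) s0 i : i < size S ->
  [/\ nth 0 (encode_slabs S) (4 * i) = top (nth s0 S i),
      nth 0 (encode_slabs S) (4 * i + 1) = bot (nth s0 S i),
      nth 0 (encode_slabs S) (4 * i + 2) = lft (nth s0 S i)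
    & nth 0 (encode_slabs S) (4 * i + 3) = rgt (nth s0 S i)].
Proof.
elim: S i => // -[[[a b] c] e] S IH [|i] hi; first by [].
have [h1 h2 h3 h4] := IH i hi.
have -> : encode_slabs ((a, b, c, e) :: S) = [:: a, b, c, e & encode_slabs S] by [].
have e4 x : 4 * i.+1 + x = (4 * i + x).+4 by lia.
by rewrite !e4 (_ : 4 * i.+1 = (4 * i).+4) //; lia.
Qed.

Lemma size_encode_slabs (S : seq slab) : size (encode_slabs S) = 4 * size S.
Proof.
elim: S => // -[[[a b] c] e] S IH.
have -> : encode_slabs ((a, b, c, e) :: S) = [:: a, b, c, e & encode_slabs S] by [].
by rewrite /= IH mulnS.
Qed.

Lemma encode_slabs_rcons (S : seq slab) a b c e :
  encode_slabs (rcons S (a, b, c, e)) = encode_slabs S ++ [:: a; b; c; e].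
Proof. by rewrite /encode_slabs map_rcons -cats1 flatten_cat. Qed.

Section Main.
Variables (n : nat) (M : 'M[bool]_n) (K : seq slab).
Hypothesis hK : slab_decomposition M K.
Variables (bd lim k : nat).
Hypotheses (n_gt0 : 0 < n) (k_gt0 : 0 < k) (hpw : n + 2 <= pw k).
Hypothesis bd_ok :
  forall d, d <= k.+1 -> width k d * (k.+2) + k + 4 + pw k < bd.
Hypotheses (bd_n : 20 * size K + 20 * n + 100 <= bd) (lim_bd : lim <= bd)
  (lim_K : 4 * size K + 2 <= lim).

Lemma load_events_ok o : vr o 1 = size K ->
  stores (ar o 0) (encode_input n K) -> (forall c, ar o 1 c = 0) ->
  wp bd lim load_events (fun o' =>
    (forall c, chain (ar o') (2 * size K + 1) (ar o' 1 c) (events (rev K) c)) /\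
    tm o' <= tm o + 17 * size K + 3) o.
Proof.
case: o => v0 m0 t0 /= h1 hin0 h0.
pose I j o' := [/\ vr o' 5 <= size K, vr o' 7 = 2 * vr o' 5 + 1,
  j = size K - vr o' 5,
  forall c, chain (ar o') (2 * vr o' 5 + 1) (ar o' 1 c)
                  (events (rev (take (vr o' 5) K)) c)
  & tm o' <= t0 + 17 * vr o' 5 + 2].
apply: wp_seq; apply/wpcP; wpexp; split; first by lia.
apply: wp_seq; apply/wpcP; wpexp; split; first by lia.
apply: (@wp_while _ _ I _ _ _ _ (size K)).
  rewrite /I; wpexp; split=> //; try lia.
  by move=> c; rewrite take0 /= h0.
move=> j [v m t] [/= hi hev hj hch ht] [hr ha].
have {}h1 : v 1 = size K := etrans (hr 1 isT) h1.
have hin x : m 0 x = m0 0 x := congr1 (fun f => f x) (ha 0 isT).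
split; first by wsolve.
rewrite h1; case: ltnP => hlt /=; last first.
  split; last by lia.
  by move=> c; have := hch c; have -> : v 5 = size K by [lia]; rewrite take_size.
move ei : (v 5) hi hev hj hch ht hlt => i hi hev hj hch ht hlt.
set s := nth (0, 0, 0, 0) K i.
have sK : s \in K by apply: mem_nth.
have [k1 k2 k3 k4 k5] := slab_bounds hK sK.
have [d1 d2 d3 d4] := nth_encode_slabs (0, 0, 0, 0) hlt; rewrite -/s in d1 d2 d3 d4.
have rd x y : nth 0 (encode_slabs K) x = y -> x < 4 * size K -> m 0 (2 + x) = y.
  by move=> <- hx; rewrite hin hin0 //= !ltnS size_encode_slabs.
have e0 : m 0 (2 + 4 * i) = top s by apply: rd => //; lia.
have e1 : m 0 (3 + 4 * i) = bot s.
  by rewrite (_ : 3 + 4 * i = 2 + (4 * i + 1)); [apply: rd => //; lia | lia].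
have e2 : m 0 (4 + 4 * i) = lft s.
  by rewrite (_ : 4 + 4 * i = 2 + (4 * i + 2)); [apply: rd => //; lia | lia].
have e3 : m 0 (5 + 4 * i) = rgt s.
  by rewrite (_ : 5 + 4 * i = 2 + (4 * i + 3)); [apply: rd => //; lia | lia].
rewrite /add_event; apply/wpcP; wpexp; rewrite ei e0 e1 e2 e3 hev.
clear hr ha; wsolve.
exists (size K - i.+1); first by lia.
set m' := aupd _ 1 _ _.
rewrite /I; wpexp; rewrite addn1; split=> //; try lia.
rewrite (take_nth (0, 0, 0, 0) hlt) -/s rev_rcons => c.
have f2 x : m' 2 x = if x == 2 * i + 2 then m 1 (rgt s).+1 else
    if x == 2 * i + 1 then m 1 (lft s) else m 2 x.
  rewrite /m' /= !addn1 addn2; case: eqP => // _; case: eqP => //; lia.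
have f3 x : m' 3 x = if x == 2 * i + 2 then top s else
    if x == 2 * i + 1 then top s else m 3 x.
  by rewrite /m' /= !addn1 addn2.
have f4 x : m' 4 x = if x == 2 * i + 2 then (bot s).+1 else
    if x == 2 * i + 1 then (bot s).+1 else m 4 x.
  by rewrite /m' /= !addn1 addn2.
have f1 x : m' 1 x = if x == (rgt s).+1 then 2 * i + 2 else
    if x == lft s then 2 * i + 1 else m 1 x.
  by rewrite /m' /= !addn1 addn2.
clearbody m'.
have old z l ev : chain m (2 * i + 1) z l -> 2 * i + 1 <= ev -> chain m' ev z l.
  move=> hz hle; apply: chain_frame hz hle _ => x hx; rewrite f2 f3 f4.
  by do 2 (case: eqP => [?|_]; first by lia).
have -> : events (s :: rev (take i K)) c =
    nseq ((lft s == c) + ((rgt s).+1 == c)) (pair_of s) ++ events (rev (take i K)) c.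
  by [].
rewrite f1 (eq_sym (lft s)) (eq_sym (rgt s).+1).
case: eqP => [->|n1]; last case: eqP => [->|n2] /=; last by apply: old => //; lia.
  have -> : ((rgt s).+1 == lft s) = false by lia.
  rewrite /= f2 f3 f4 eqxx; split=> //; first by lia.
  by apply: old => //; lia.
rewrite f2 f3 f4 eqxx; have -> : (2 * i + 1 == 2 * i + 2) = false by lia.
by split=> //; [lia | apply: old => //; lia].
Qed.

Definition evs c := events (rev K) c.

Lemma size_evs c : size (evs c) <= 2 * size K.
Proof.
have := evcountS (rev K) c; have := evcount_le (rev K) c.+1.
by rewrite size_rev /evs; lia.
Qed.

Definition touched_list (c m : nat) (X : nat -> nat) : Prop :=
  (forall j, j < m -> touched K c (X j)) /\
  (forall x, touched K c x -> exists2 j, j < m & X j = x).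

Lemma collect_ok c o : vr o 6 = c.+1 -> c <= n ->
  chain (ar o) (2 * size K + 1) (ar o 1 c.+1) (evs c.+1) ->
  (forall x, ar o 5 x = tops K c x) -> (forall x, ar o 6 x = bots K c x) ->
  wp bd lim collect (fun o' =>
    [/\ vr o' 8 = 2 * size (evs c.+1),
        touched_list c.+1 (2 * size (evs c.+1)) (ar o' 7),
        forall x, ar o' 5 x = tops K c.+1 x,
        forall x, ar o' 6 x = bots K c.+1 x
      & tm o' <= tm o + 9 * size (evs c.+1) + 3]) o.
Proof.
case: o => v0 m0 t0 /= h6 hcn hch hT hB.
have hsz := size_evs c.+1.
pose I j o' := exists p1 p2, [/\ evs c.+1 = p1 ++ p2, j = size p2,
   vr o' 8 = 2 * size p1,
   chain (ar o') (2 * size K + 1) (vr o' 7) p2 /\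
   tm o' <= t0 + 9 * size p1 + 2 &
   [/\ forall x, ar o' 5 x = tops K c x (+) odd (count (fun p => p.1 == x) p1),
       forall x, ar o' 6 x = bots K c x (+) odd (count (fun p => p.2 == x) p1),
       forall j, j < 2 * size p1 -> exists2 p, p \in p1 & (ar o' 7 j == p.1) || (ar o' 7 j == p.2)
     & forall p, p \in p1 -> (exists2 j, j < 2 * size p1 & ar o' 7 j = p.1) /\
        exists2 j, j < 2 * size p1 & ar o' 7 j = p.2]].
apply: wp_seq; apply/wpcP; wpexp; split; first by lia.
apply: wp_seq; apply/wpcP; wpexp; rewrite h6; wsolve.
apply: (@wp_while _ _ I _ _ _ _ (size (evs c.+1))).
  exists [::], (evs c.+1); wpexp; split=> //; first by split; [exact: hch|lia].
  by split=> // x; rewrite addbF.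
move=> j [v m t] [p1 [p2 [/= he hj h8 [hc ht] [h5 h6' hX1 hX2]]]] [hr _].
have {}h6 : v 6 = c.+1 := etrans (hr 6 isT) h6.
split; first by wsolve.
case: p2 he hj hc => [|[x y] p2] he hj /=.
  move=> -> /=; rewrite cats0 in he; rewrite /touched_list he; split=> //; last by lia.
  - split=> [i /hX1[p hp hpx]|x /touchedP[p hp hpx]].
      by apply/touchedP; exists p => //; rewrite -[events _ _]/(evs c.+1) he.
    rewrite -[events _ _]/(evs c.+1) he in hp; have [[i1 i2 i3] [i4 i5 i6]] := hX2 p hp.
    by case/orP: hpx => /eqP->; [exists i1 | exists i4].
  - by move=> x; rewrite h5 (tops_toggle hK) -[events _ _]/(evs c.+1) he.
  - by move=> x; rewrite h6' (bots_toggle hK) -[events _ _]/(evs c.+1) he.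
rewrite /= in hj; case=> hv7 e3 e4 hc; case: eqP => [?|_]; first by lia.
have hs : size (evs c.+1) = size p1 + (size p2).+1 by rewrite he size_cat.
have hxy : (x, y) \in events (rev K) c.+1.
  by rewrite -[events _ _]/(evs c.+1) he mem_cat inE eqxx orbT.
have [b1 b2 b3 b4 b5] := events_bound hK hxy.
apply/wpcP; wpexp; rewrite e3 e4 h8; clear hr; wsolve.
exists (size p2); first by lia.
exists (rcons p1 (x, y)), p2; wpexp; rewrite size_rcons; split.
- by rewrite cat_rcons.
- by [].
- by lia.
- split; last by lia.
  by apply: chain_frame hc _ _.
split.
- move=> z; rewrite /= -cats1 count_cat /= oddD addn0 oddb h5 addbA.
  by rewrite (eq_sym z); case: eqP => [->|_]; rewrite ?addbF // addbT; case: (_ (+) _).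
- move=> z; rewrite /= -cats1 count_cat /= oddD addn0 oddb h6' addbA.
  by rewrite (eq_sym z); case: eqP => [->|_]; rewrite ?addbF // addbT; case: (_ (+) _).
- move=> i hi; rewrite /=; case: eqP => [_|n1].
    by exists (x, y); rewrite ?mem_rcons ?mem_head //= eqxx orbT.
  case: eqP => [_|n2]; first by exists (x, y); rewrite ?mem_rcons ?mem_head //= eqxx.
  have [|p hp hpx] := hX1 i; first by lia.
  by exists p => //; rewrite mem_rcons inE hp orbT.
- move=> p; rewrite mem_rcons inE => /orP[/eqP->|hp] /=.
    split; [exists (2 * size p1) | exists (2 * size p1 + 1)]; try lia.
      by case: eqP => [?|_]; [lia | rewrite eqxx].
    by rewrite eqxx.
  have [[i1 i2 i3] [i4 i5 i6]] := hX2 p hp.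
  split; [exists i1; first by lia | exists i4; first by lia].
    by case: eqP => [?|_]; [lia|]; case: eqP => [?|_]; [lia | exact: i3].
  by case: eqP => [?|_]; [lia|]; case: eqP => [?|_]; [lia | exact: i6].
Qed.

(** A search writes no array and only its own registers, so the caller continues with the same
    [m]. *)
Lemma pred_call S v m t x Q :
  env k (St v m t) -> bounded S (pw k) -> veb k m S -> v 20 = x -> x + 1 < bd ->
  (forall v' t', (forall r, r \notin wregs predecessor -> v' r = v r) ->
     v' 32 = prv S x -> t' <= t + (42 * k.+2 + 6) -> Q (St v' m t')) ->
  wp bd lim predecessor Q (St v m t).
Proof.
move=> he hS hv hx hxb hQ.
have [o' hr [h32 ht]] := pred_ok lim k_gt0 bd_ok he hS hv hx hxb.
exists o' => //; have [a1 _] := run_agree hr.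
have hp := run_pure hr erefl.
case: o' {hr} h32 ht a1 hp => v' m' t' /= h32 ht a1 ->.
by apply: hQ => //; rewrite addnA.
Qed.

Lemma start_bounded c : bounded (startc K c) (pw k).
Proof. by move=> x /(startc_bound hK); lia. Qed.

Lemma env_frame o o' : vr o' 2 = vr o 2 -> vr o' 4 = vr o 4 ->
  ar o' 14 = ar o 14 -> env k o -> env k o'.
Proof. by rewrite /env => -> -> ->. Qed.

Lemma veb_frame A A' S : A' 12 = A 12 -> A' 13 = A 13 ->
  veb k A S -> veb k A' S.
Proof. by move=> e1 e2 h d id hd; rewrite -h // /Vof e1 e2. Qed.

(** Bounds one iteration of each loop that uses the tree: a search is the dearest operation, and the
    rest of the body is constant. *)
Definition cost := 42 * k.+2 + 30.

Lemma query_ok c o m : env k o -> veb k (ar o) (startc K c) -> vr o 8 = m ->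
  m <= 4 * size K -> (forall j, j < m -> 1 <= ar o 7 j <= n.+1) ->
  ends_ok K c (ar o 10) ->
  wp bd lim query (fun o' =>
    [/\ forall j, j < m -> ar o' 7 j = ar o 7 j,
        forall j, j < m -> (ar o' 8 j = 0 /\ ar o' 7 (m + j) = 0) \/
                           strip K c (ar o' 8 j) (ar o' 7 (m + j)),
        forall j s e, j < m -> strip K c s e -> s <= ar o 7 j <= e ->
          ar o' 8 j = s /\ ar o' 7 (m + j) = e
      & tm o' <= tm o + m * cost + 2]) o.
Proof.
case: o => v0 m0 t0 /= henv hv h8 hmb hX [hE1 hE2].
pose I j o' := let i := vr o' 5 in
  [/\ i <= m /\ j = m - i, forall l, l < m -> ar o' 7 l = m0 7 l,
      forall j, j < i -> (ar o' 8 j = 0 /\ ar o' 7 (m + j) = 0) \/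
                           strip K c (ar o' 8 j) (ar o' 7 (m + j)),
      forall j s e, j < i -> strip K c s e -> s <= m0 7 j <= e ->
          ar o' 8 j = s /\ ar o' 7 (m + j) = e
    & tm o' <= t0 + i * cost + 1].
apply: wp_seq; apply/wpcP; wpexp; split; first by lia.
apply: (@wp_while _ _ I _ _ _ _ m).
  by rewrite /I; wpexp; split=> //; lia.
move=> j [v m1 t] [/= [hi hj] hl hs1 hs2 ht] [hr ha].
have {}h8 : v 8 = m := etrans (hr 8 isT) h8.
have henv1 : env k (St v m1 t) := env_frame (hr 2 isT) (hr 4 isT) (ha 14 isT) henv.
have hv1 : veb k m1 (startc K c) := veb_frame (ha 12 isT) (ha 13 isT) hv.
have hE x : m1 10 x = m0 10 x := congr1 (fun f => f x) (ha 10 isT).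
clear ha; split; first by wsolve.
rewrite h8; case: ltnP => hlt /=; last first.
  have ei : v 5 = m by lia.
  by rewrite ei in hs1 hs2 ht; split=> //; lia.
move ei : (v 5) hi hj hs1 hs2 ht hlt => i hi hj hs1 hs2 ht hlt.
set x := m0 7 i; have hx := hX i hlt; rewrite -/x in hx.
have ex : m1 7 i = x by rewrite hl.
apply: wp_seq; apply/wpcP; wpexp; rewrite ei ex; wsolve.
apply: wp_seq; apply/wpcP; wpexp; wsolve.
apply: wp_seq; apply: (@pred_call (startc K c) _ _ _ (x + 1)) => //; try lia.
  exact: start_bounded.
move=> v2 t2 a1 h32 ht2.
have g5 : v2 5 = i := etrans (a1 5 isT) ei.
have g8 : v2 8 = m := etrans (a1 8 isT) h8.
have g10 : v2 10 = x := a1 10 isT.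
set r := prv (startc K c) (x + 1) in h32.
have hr1 : r <= n.+2 by have := prv_le (startc K c) (x + 1); rewrite -/r; lia.
have hE0 : m1 10 (r - 1) <= n.+1.
  rewrite hE; case: (m0 10 (r - 1) =P 0) => [-> //|/eqP/hE2 h].
  by have [] := strip_bounds hK h.
apply/wpcP; wpexp; rewrite h32 g5 g8 g10 hE; rewrite hE in hE0.
clear a1 hr ei h8; wsolve.
set E := m0 10 (r - 1) in hE0 *.
have hfin a b : ((a = 0 /\ b = 0) \/ strip K c a b) ->
    (forall s e, strip K c s e -> s <= x <= e -> a = s /\ b = e) ->
    forall v3 t3, v3 5 = i + 1 -> t3 <= t + cost ->
  exists2 j' : nat, j' < j & I j' (St v3 (aupd (aupd m1 8 i a) 7 (m + i) b) t3).
  move=> ha1 ha2 v3 t3 h5 ht3; exists (m - i.+1); first by lia.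
  rewrite /I; cbv beta iota zeta delta [vr ar tm]; rewrite h5 addn1; split.
  - by lia.
  - by move=> l hlm /=; rewrite (_ : (l == m + i) = false) ?hl //; lia.
  - move=> l; rewrite ltnS leq_eqVlt => /orP[/eqP->|hli] /=; first by rewrite !eqxx.
    have n1 : (l == i) = false by apply/eqP; lia.
    have n2 : (m + l == m + i) = false by apply/eqP; lia.
    rewrite n1 n2.
    exact: hs1.
  - move=> l s e; rewrite ltnS leq_eqVlt => /orP[/eqP->|hli] /=.
      by rewrite !eqxx; exact: ha2.
    have n1 : (l == i) = false by apply/eqP; lia.
    have n2 : (m + l == m + i) = false by apply/eqP; lia.
    rewrite n1 n2.
    exact: hs2.
  - by rewrite mulSn; lia.
have hcond : ((r == 0) + (E < x) == 0) = (0 < r) && (x <= E).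
  by rewrite lt0n; case: (r == 0); case: ltnP.
rewrite hcond; case: andP => [[r0 xE]|hn]; wsolve; apply: hfin; rewrite ?g5 //;
  try by rewrite /cost; lia.
- by right; apply: hE2; rewrite -lt0n; apply: leq_trans xE; case/andP: hx.
- move=> s e hs /(strip_query hK hs); rewrite -addn1 -/r => er.
  have es : r - 1 = s by rewrite er; lia.
  by rewrite es; split=> //; rewrite /E es; apply: hE1.
- move=> s e hs hse; have := strip_query hK hs hse; rewrite -addn1 -/r => er.
  have es : r - 1 = s by rewrite er; lia.
  by case: hn; rewrite /E es (hE1 _ _ hs) er; split=> //; case/andP: hse.
Qed.

Lemma veb_eq A S S' : S =1 S' -> veb k A S -> veb k A S'.
Proof.
move=> e h d id hd; rewrite h //; apply: eq_nodeval.
apply: (cont_anc (ud_k k_gt0) (leq0n d)) => y /=; by case: eqP.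
Qed.

(** The set in the tree when the first [i] listed rows have been brought to the new column. *)
Definition mixed c (X : nat -> nat) i : pred nat :=
  fun x => if has (fun j => X j == x) (iota 0 i)
           then startc K c.+1 x else startc K c x.

Lemma mixed_bounded c X i : bounded (mixed c X i) (pw k).
Proof. by move=> x; rewrite /mixed; case: ifP => _; apply: start_bounded. Qed.

Lemma mixedS c X i x :
  mixed c X i.+1 x = if x == X i then startc K c.+1 x else mixed c X i x.
Proof.
rewrite /mixed -addn1 iotaD has_cat /= orbF add0n (eq_sym x).
by case: eqP => [<-|_]; rewrite ?orbT // orbF.
Qed.

Lemma update_ok c o m : env k o -> veb k (ar o) (startc K c) -> vr o 8 = m ->
  m <= 4 * size K -> touched_list c.+1 m (ar o 7) ->
  (forall x, ar o 5 x = tops K c.+1 x) -> (forall x, ar o 6 x = bots K c.+1 x) ->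
  (forall x, ar o 9 x = startc K c x) ->
  wp bd lim update (fun o' =>
    [/\ veb k (ar o') (startc K c.+1), forall x, ar o' 9 x = startc K c.+1 x
      & tm o' <= tm o + m * cost + 2]) o.
Proof.
case: o => v0 m0 t0 /= henv hv h8 hmb [hX1 hX2] h5 h6 h9.
pose X := m0 7.
pose I j o' := let i := vr o' 5 in
  [/\ i <= m /\ j = m - i, veb k (ar o') (mixed c X i),
    forall x, ar o' 9 x = mixed c X i x & tm o' <= t0 + i * cost + 1].
apply: wp_seq; apply/wpcP; wpexp; split; first by lia.
apply: (@wp_while _ _ I _ _ _ _ m).
  by rewrite /I; wpexp; split=> //; lia.
move=> j [v m1 t] [/= [hi hj] hv1 hm9 ht] [hr ha].
have {}h8 : v 8 = m := etrans (hr 8 isT) h8.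
have henv1 : env k (St v m1 t) := env_frame (hr 2 isT) (hr 4 isT) (ha 14 isT) henv.
have {}h5 x : m1 5 x = tops K c.+1 x := etrans (congr1 (fun f => f x) (ha 5 isT)) (h5 x).
have {}h6 x : m1 6 x = bots K c.+1 x := etrans (congr1 (fun f => f x) (ha 6 isT)) (h6 x).
have h7 x : m1 7 x = X x := congr1 (fun f => f x) (ha 7 isT).
clear ha; split; first by wsolve.
rewrite h8; case: ltnP => hlt /=; last first.
  have ei : v 5 = m by lia.
  (* Starts change only at touched rows, and every touched row is on the list. *)
  have em : mixed c X m =1 startc K c.+1.
    move=> x; rewrite /mixed; case: ifP => // /negbT/hasPn hn.
    apply/eqP/negPn/negP => /(touched_start hK)/hX2[l hl el].
    by have := hn l; rewrite mem_iota hl -el eqxx => /(_ isT).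
  rewrite ei in hv1 hm9 ht; split; last by lia.
    exact: veb_eq hv1.
  by move=> x; rewrite hm9 em.
move ei : (v 5) hi hj hv1 hm9 ht hlt => i hi hj hv1 hm9 ht hlt.
set x := X i; have hx := touched_bound hK (hX1 i hlt); rewrite -/(X i) -/x in hx.
have eb : tops K c.+1 x * (1 - bots K c.+1 x) = startc K c.+1 x.
  by rewrite /startc; case: (tops _ _ _); case: (bots _ _ _).
have hfin v3 m3 t3 : v3 5 = i + 1 -> veb k m3 (mixed c X i.+1) ->
    (forall y, m3 9 y = mixed c X i.+1 y) -> t3 <= t + cost ->
    exists2 j' : nat, j' < j & I j' (St v3 m3 t3).
  move=> g5 gv g9 gt; exists (m - i.+1); first by lia.
  rewrite /I; cbv beta iota zeta delta [vr ar tm]; rewrite g5 addn1.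
  by split=> //; rewrite ?mulSn; lia.
apply: wp_seq; apply/wpcP; wpexp; rewrite ei h7 -/x; wsolve.
apply: wp_seq; apply/wpcP; wpexp; rewrite h5 h6 eb; wsolve.
apply: wp_seq; apply/wpcP; wpexp; wsolve.
apply: wp_seq; apply: wp_if; wpexp; rewrite ?hm9; [by wsolve | |].
  case: eqP => // hb _; apply/wpcP; wpexp; apply/wpcP; wpexp; rewrite ei; wsolve.
  have em : mixed c X i =1 mixed c X i.+1.
    move=> y; rewrite mixedS; case: eqP => [->|//].
    by move: hb; rewrite -/x; case: (startc _ _ _); case: (mixed _ _ _ _).
  by apply: hfin => //; [apply: veb_eq hv1 | move=> y; rewrite hm9 em | rewrite /cost; lia].
case: eqP => // hb _; have [hx1 hx2] := andP hx.
have xpw : x < pw k by lia.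
have em y : mixed c X i.+1 y = if y == x then startc K c.+1 x else mixed c X i y.
  by rewrite mixedS -/x; case: eqP => // ->.
have hend v2 m2 t2 : v2 5 = i -> v2 10 = x -> v2 13 = startc K c.+1 x ->
    veb k m2 (mixed c X i.+1) -> (forall y, m2 9 y = m1 9 y) ->
    t2 <= t + cost - 6 ->
    wp bd lim (Sto 9 10 13) (wp bd lim (Asg 5 (EB Add 5 (EC 1)))
       (fun o2 => exists2 j' : nat, j' < j & I j' o2)) (St v2 m2 t2).
  move=> g5 g10 g13 gv g9 gt; apply/wpcP; wpexp; rewrite g10 g13; wsolve.
  apply/wpcP; wpexp; rewrite g5; wsolve; apply: hfin => //.
  - by move=> y /=; rewrite em; case: eqP => // _; rewrite g9 hm9.
  - by rewrite /cost in gt *; lia.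
apply: wp_seq; apply: wp_if; wpexp; first by [].
  case e1: (startc K c.+1 x) hb => hb // _.
  have hadd : add1 (mixed c X i) x (mixed c X i.+1).
    split; first by move: hb; case: (mixed _ _ _ _).
    by move=> y; rewrite em e1; case: eqP.
  apply: wp_consequence (insert_ok lim k_gt0 bd_ok _ _ _ _ xpw hadd) _ => //.
    exact: mixed_bounded.
  move=> [v2 m2 t2] [/= g1 g2] [a1 b1]; apply: hend => //.
  - exact: etrans (a1 5 isT) ei.
  - exact: a1 10 isT.
  - by rewrite e1; exact: a1 13 isT.
  - by move=> y; rewrite (b1 9 isT : m2 9 = m1 9).
  - by rewrite /cost; lia.
case e1: (startc K c.+1 x) hb => hb // _.
have hadd : add1 (mixed c X i.+1) x (mixed c X i).
  split; first by rewrite em eqxx e1.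
  move=> y; rewrite em e1; case: eqP => // -> /=.
  by move: hb; case: (mixed _ _ _ _).
apply: wp_consequence (delete_ok lim k_gt0 bd_ok _ _ _ _ hadd) _ => //.
  exact: mixed_bounded.
move=> [v2 m2 t2] [/= g1 g2] [a1 b1]; apply: hend => //.
- exact: etrans (a1 5 isT) ei.
- exact: a1 10 isT.
- by rewrite e1; exact: a1 13 isT.
- by move=> y; rewrite (b1 9 isT : m2 9 = m1 9).
- by rewrite /cost; lia.
Qed.

Hypothesis lim_R : 4 * n.+1 ^ 4 + 2 <= lim.

Definition written (D : nat -> nat) (R : seq slab) : Prop :=
  forall l, l < 4 * size R -> D (1 + l) = nth 0 (encode_slabs R) l.

Lemma flush_ok c o m R : env k o -> veb k (ar o) (startc K c.+1) -> vr o 8 = m ->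
  vr o 6 = c.+1 -> m <= 4 * size K -> c <= n ->
  (forall x, ar o 5 x = tops K c.+1 x) -> (forall x, ar o 6 x = bots K c.+1 x) ->
  (forall j, j < m -> ar o 8 j <= n.+1) ->
  (forall s e, strip K c s e -> ~ strip K c.+1 s e ->
     exists2 j, j < m & ar o 8 j = s) ->
  ends_ok K c (ar o 10) -> starts_ok K c (ar o 11) ->
  out_ok K c R -> vr o 9 = size R -> written (ar o 0) R ->
  wp bd lim flush (fun o' =>
    [/\ exists R', [/\ out_ok K c.+1 R', vr o' 9 = size R' & written (ar o' 0) R'],
      kept K c (ar o' 10)
      & tm o' <= tm o + m * cost + 2]) o.
Proof.
case: o => v0 m0 t0 /= henv hv h8 h6 hmb hcn h5 h6' hOL hlost hE hF hR h9 hW.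
pose E := m0 10; pose F := m0 11.
pose I j o' := let i := vr o' 5 in exists R', [/\ i <= m /\ j = m - i,
  erased K c E (ar o' 10),
  (forall l, l < i -> E (m0 8 l) != 0 -> ~ strip K c.+1 (m0 8 l) (E (m0 8 l)) ->
     ar o' 10 (m0 8 l) = 0),
  [/\ uniq R', (forall r, r \in R' <-> r \in R \/ flushed c E F (ar o' 10) r),
    vr o' 9 = size R' & written (ar o' 0) R']
  & tm o' <= t0 + i * cost + 1].
apply: wp_seq; apply/wpcP; wpexp; split; first by lia.
apply: (@wp_while _ _ I _ _ _ _ m).
  exists R; wpexp; split=> //; try lia.
  - by move=> s; left.
  - case: hR => uR hR; split=> // r; split=> [|[//|[g1 g2 _]]]; first by left.
    by rewrite -/E in g2; rewrite g2 in g1.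
move=> j [v m1 t] [R' [/= [hi hj] her hl [uR' hR' h9' hW'] ht]] [hr ha].
have {}h8 : v 8 = m := etrans (hr 8 isT) h8.
have {}h6 : v 6 = c.+1 := etrans (hr 6 isT) h6.
have henv1 : env k (St v m1 t) := env_frame (hr 2 isT) (hr 4 isT) (ha 14 isT) henv.
have hv1 : veb k m1 (startc K c.+1) := veb_frame (ha 12 isT) (ha 13 isT) hv.
have {}h5 x : m1 5 x = tops K c.+1 x := etrans (congr1 (fun f => f x) (ha 5 isT)) (h5 x).
have {}h6' x : m1 6 x = bots K c.+1 x := etrans (congr1 (fun f => f x) (ha 6 isT)) (h6' x).
have hm8 x : m1 8 x = m0 8 x := congr1 (fun f => f x) (ha 8 isT).
have hm11 x : m1 11 x = F x := congr1 (fun f => f x) (ha 11 isT).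
clear ha; split; first by wsolve.
rewrite h8; case: ltnP => hlt /=; last first.
  have ei : v 5 = m by lia.
  rewrite ei in hl ht.
  (* The start of every lost strip is on the list ([hlost]), so the finished loop has cleared all of
     them. *)
  have hgone s : E s != 0 -> ~ strip K c.+1 s (E s) -> m1 10 s = 0.
    move=> e0 hn; have [l hlm el] := hlost s (E s) (proj2 hE s e0) hn.
    by rewrite -el; apply: hl => //; rewrite el.
  split; last by lia.
    exists R'; split=> //; split=> // r; rewrite hR' (proj2 hR).
    split=> [[[h1 h2]|/(flushed_canon hK hE hF her)[h1 ->]]|[h1 h2]].
    + by split=> //; lia.
    + by split.
    + case: (ltngtP (rgt r) c) => h3; [by left | by lia | right].
      exact (canon_flushed hK hE hF hgone h1 h3).
  split=> [s e hs hs'|s hs].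
    have es := proj1 hE _ _ hs; case: (her s) => [->|[_ _]]; first exact: es.
    by rewrite -/E in es; rewrite es.
  have es : m1 10 s = E s by case: (her s) => // -[e _ _]; rewrite e in hs.
  rewrite es in hs *; have hst := proj2 hE _ hs; split=> //.
  case: (boolP (endc K c.+1 (E s) && (prv (startc K c.+1) (E s) == s.+1))).
    by case/andP=> e1 /eqP e2; apply/(stripE hK).
  move/negP=> hn; have : m1 10 s = 0.
    apply: hgone => // /(stripE hK)[e1 e2]; apply: hn; by rewrite e1 e2 eqxx.
  by rewrite es => e; rewrite e in hs.
move ei : (v 5) hi hj hl ht hlt => i hi hj hl ht hlt.
set s := m0 8 i; have hs : s <= n.+1 := hOL i hlt.
set e := m1 10 s.
have he : e <= n.+1.
  rewrite /e; case: (her s) => [->|[-> _ _] //].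
  case: (E s =P 0) => [-> //|/eqP/(proj2 hE) h].
  by have [] := strip_bounds hK h.
have hfin v3 m3 t3 (R3 : seq slab) : v3 5 = i + 1 -> erased K c E (m3 10) ->
    (E s != 0 -> ~ strip K c.+1 s (E s) -> m3 10 s = 0) ->
    (forall x, m1 10 x = 0 -> m3 10 x = 0) ->
    [/\ uniq R3, (forall r, r \in R3 <-> r \in R \/ flushed c E F (m3 10) r),
      v3 9 = size R3 & written (m3 0) R3] -> t3 <= t + cost ->
    exists2 j' : nat, j' < j & I j' (St v3 m3 t3).
  move=> g5 g1 g2 g3 g4 gt; exists (m - i.+1); first by lia.
  rewrite /I; cbv beta iota zeta delta [vr ar tm]; rewrite g5 addn1.
  exists R3; split=> //; try (rewrite ?mulSn; lia).
  move=> l; rewrite ltnS leq_eqVlt => /orP[/eqP->|hli]; first exact: g2.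
  by move=> q1 q2; apply: g3; apply: hl.
apply: wp_seq; apply/wpcP; wpexp; rewrite ei hm8 -/s; wsolve.
apply: wp_seq; apply/wpcP; wpexp; rewrite -/e; wsolve.
apply: wp_seq; apply/wpcP; wpexp; wsolve.
apply: wp_seq; apply: (@pred_call (startc K c.+1) _ _ _ e) => //; try lia.
  exact: start_bounded.
move=> v2 t2 a1 h32 ht2.
have g5 : v2 5 = i := etrans (a1 5 isT) ei.
have g6 : v2 6 = c.+1 := etrans (a1 6 isT) h6.
have g8 : v2 8 = m := etrans (a1 8 isT) h8.
have g9 : v2 9 = size R' := etrans (a1 9 isT) h9'.
have g11 : v2 11 = e := a1 11 isT.
have g12 : v2 12 = s := a1 12 isT.
clear a1 hr.
apply: wp_seq; apply: wp_if; wpexp; rewrite ?g11 ?g12 ?h32 ?h5 ?h6'.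
- wsolve; case: (bots _ _ _); case: (tops _ _ _); case: (_ == _); case: (e == 0); lia.
- move=> hz; apply/wpcP; wpexp; apply/wpcP; wpexp; rewrite g5; wsolve.
  apply: (hfin _ _ _ R') => //; try by rewrite /cost; lia.
  move=> e0 hn; case: (her s) => [ee|[] //]; exfalso.
  have ee2 : e = E s by [].
  apply: hn; rewrite -ee2; apply/(stripE hK); rewrite -ee2 in e0.
  move: hz; rewrite (negbTE e0) /endc addn1 add0n.
  by case: (bots _ _ _); case: (tops _ _ _); case: eqP.
move=> hz.
have e0 : e != 0 by apply/eqP=> e0; move: hz; rewrite {1}e0.
have hn : ~ strip K c.+1 s e.
  move=> /(stripE hK)[/andP[h1 h2] h3].
  by move: hz; rewrite (negbTE e0) h1 (negbTE h2) h3 addn1 eqxx.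
have ee : e = E s by case: (her s) => // -[e1 _ _]; rewrite /e e1 in e0.
have hEs : E s != 0 by rewrite -ee.
have hst : strip K c s e by rewrite ee; exact: (proj2 hE _ hEs).
set r := (s, e - 1, F s, c) : slab.
set R2 := rcons R' r.
have hfl x : flushed c E F (aupd m1 10 s 0 10) x <-> x = r \/ flushed c E F (m1 10) x.
  rewrite /flushed /=; case: (top x =P s) => [ex|nx].
    rewrite ex -/e -ee; split=> [[_ _ ->]|[->|[h1 h2 h3]]]; first by left.
      by split.
    by rewrite -/e in h2; rewrite h2 in e0.
  by split=> [h|[er|h]] //; [right | case: nx; rewrite er].
have her2 : erased K c E (aupd m1 10 s 0 10).
  move=> x /=; case: eqP => [->|_]; last exact: her.
  by right; split=> //; rewrite -ee.
have hR2 x : x \in R2 <-> x \in R \/ flushed c E F (aupd m1 10 s 0 10) x.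
  rewrite mem_rcons inE hfl; split=> [/orP[/eqP->|/hR'[h|h]]|[h|[->|h]]].
  - by right; left.
  - by left.
  - by right; right.
  - by apply/orP; right; apply/hR'; left.
  - by rewrite eqxx.
  - by apply/orP; right; apply/hR'; right.
have hcR x : x \in R2 -> canon K x.
  move=> /hR2[/(proj2 hR)[] //|/(flushed_canon hK hE hF her2)[] //].
have uR2 : uniq R2.
  rewrite rcons_uniq uR' andbT; apply/negP=> /hR'[/(proj2 hR)[_]|[_ + _]].
    by rewrite /rgt /=; lia.
  by rewrite -[top r]/s -/e => h; rewrite h in e0.
(* The slabs written so far, including this one, are distinct and canonical, which bounds the
   addresses used for the output. *)
have hsz := canon_size hK uR2 hcR; rewrite size_rcons in hsz.
have hsl : 4 + 4 * size R' < lim by lia.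
apply/wpcP; wpexp; rewrite g9 g11 g12 g6.
wsolve.
apply/wpcP; wpexp; rewrite g5; wsolve.
apply: (hfin _ _ _ R2) => //; try by rewrite /cost; lia.
- by move=> x h0 /=; case: eqP.
- by move=> x h0 /=; case: eqP.
split=> //; first by rewrite size_rcons addn1.
move=> l; rewrite size_rcons => hl4.
rewrite /R2 encode_slabs_rcons nth_cat size_encode_slabs /=.
case: (ltnP l (4 * size R')) => hll.
  rewrite -(hW' _ hll); move: hll; move: (4 * size R') => q hll.
  rewrite (_ : (_ == 4 + q) = false); last by apply/eqP; lia.
  rewrite (_ : (_ == 3 + q) = false); last by apply/eqP; lia.
  rewrite (_ : (_ == 2 + q) = false); last by apply/eqP; lia.
  by rewrite (_ : (_ == 1 + q) = false) //; apply/eqP; lia.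
rewrite mulnS in hl4; move: (4 * size R') hll hl4 => q hll hl4.
have [d hd ->] : exists2 d, d < 4 & l = q + d by exists (l - q); lia.
have E1 a : (1 + (q + d) == a + q) = (d.+1 == a) by apply/eqP/eqP; lia.
rewrite addKn !E1.
by case: d hd {E1} => [|[|[|[|d]]]] //= _; rewrite ?hm11 ?subSS ?subn0.
Qed.

Lemma create_ok c o m : env k o -> veb k (ar o) (startc K c.+1) -> vr o 8 = m ->
  vr o 6 = c.+1 -> m <= 4 * size K -> c <= n ->
  (forall x, ar o 5 x = tops K c.+1 x) -> (forall x, ar o 6 x = bots K c.+1 x) ->
  (forall j, j < m + m -> ar o 7 j <= n.+1) ->
  (forall s e, strip K c.+1 s e -> ~ strip K c s e ->
     exists2 j, j < m + m & ar o 7 j = e) ->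
  kept K c (ar o 10) -> starts_ok K c (ar o 11) ->
  wp bd lim create (fun o' =>
    [/\ ends_ok K c.+1 (ar o' 10), starts_ok K c.+1 (ar o' 11)
      & tm o' <= tm o + 2 * m * cost + 2]) o.
Proof.
case: o => v0 m0 t0 /= henv hv h8 h6 hmb hcn h5 h6' hX hnew hE hF.
pose E := m0 10; pose F := m0 11.
pose I j o' := let i := vr o' 5 in [/\ i <= m + m /\ j = m + m - i,
  forall s, ar o' 10 s != 0 -> strip K c.+1 s (ar o' 10 s),
  forall s, if E s == 0 then ar o' 10 s != 0 -> ar o' 11 s = c.+1
            else ar o' 10 s = E s /\ ar o' 11 s = F s,
  forall l s, l < i -> strip K c.+1 s (m0 7 l) -> ar o' 10 s != 0
  & tm o' <= t0 + i * cost + 1].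
apply: wp_seq; apply/wpcP; wpexp; split; first by lia.
apply: (@wp_while _ _ I _ _ _ _ (m + m)).
  rewrite /I; wpexp; split=> //; try lia.
    by move=> s /(proj2 hE)[].
  by move=> s; case: eqP => // e0; rewrite -/E e0.
move=> j [v m1 t] [/= [hi hj] h10 h11 hl ht] [hr ha].
have {}h8 : v 8 = m := etrans (hr 8 isT) h8.
have {}h6 : v 6 = c.+1 := etrans (hr 6 isT) h6.
have henv1 : env k (St v m1 t) := env_frame (hr 2 isT) (hr 4 isT) (ha 14 isT) henv.
have hv1 : veb k m1 (startc K c.+1) := veb_frame (ha 12 isT) (ha 13 isT) hv.
have {}h5 x : m1 5 x = tops K c.+1 x := etrans (congr1 (fun f => f x) (ha 5 isT)) (h5 x).
have {}h6' x : m1 6 x = bots K c.+1 x := etrans (congr1 (fun f => f x) (ha 6 isT)) (h6' x).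
have hm7 x : m1 7 x = m0 7 x := congr1 (fun f => f x) (ha 7 isT).
clear ha; split; first by wsolve.
rewrite h8; case: ltnP => hlt /=; last first.
  have ei : v 5 = m + m by lia.
  rewrite ei in hl ht.
  (* An old strip survived [flush]; a new one has its end on the list. Either way its entry is
     nonzero, and a start determines its end. *)
  have alive s e : strip K c.+1 s e -> m1 10 s = e.
    move=> hs; apply: (@strip_inj K c.+1 s) => //; apply: h10.
    case: (strip_dec hK c s e) => hs'.
      have es := proj1 hE _ _ hs' hs; have := h11 s; rewrite -/E in es.
      have [_ h0 _ _] := strip_bounds hK hs; rewrite es.
      by case: eqP => [|_ [-> _]]; lia.
    have [l hlm el] := hnew _ _ hs hs'; apply: (hl l) => //; by rewrite el.
  split; last by lia.
    by split.
  move=> s e hs; have es := alive _ _ hs; have := h11 s; rewrite es.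
  have [h0 h1 _ _] := strip_bounds hK hs.
  case: eqP => [e0 /(_ _)|/eqP e0 [e1 ->]].
    have -> : e != 0 by lia.
    move=> /(_ isT) ->; split=> //; first by lia.
      by move=> l hl2; have -> : l = c.+1 by lia.
    by move=> hs'; have := proj1 hE _ _ hs' hs; rewrite -/E e0; lia.
  have [hsc _] := proj2 hE _ e0; rewrite -/E -e1 in hsc.
  have [g1 g2 g3] := hF _ _ hsc; rewrite -/F in g1 g2 g3; split=> //; first by lia.
  move=> l /andP[l1]; rewrite leq_eqVlt => /orP[/eqP-> //|l2].
  by apply: g2; rewrite l1.
move ei : (v 5) hi hj hl ht hlt => i hi hj hl ht hlt.
set e := m0 7 i; have he : e <= n.+1 := hX i hlt.
have hfin v3 m3 t3 : v3 5 = i + 1 ->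
    (forall s, m3 10 s != 0 -> strip K c.+1 s (m3 10 s)) ->
    (forall s, if E s == 0 then m3 10 s != 0 -> m3 11 s = c.+1
            else m3 10 s = E s /\ m3 11 s = F s) ->
    (forall s, strip K c.+1 s e -> m3 10 s != 0) ->
    (forall s, m1 10 s != 0 -> m3 10 s != 0) -> t3 <= t + cost ->
    exists2 j' : nat, j' < j & I j' (St v3 m3 t3).
  move=> g5 g1 g2 g3 g4 gt; exists (m + m - i.+1); first by lia.
  rewrite /I; cbv beta iota zeta delta [vr ar tm]; rewrite g5 addn1.
  split=> //; try (rewrite ?mulSn; lia).
  move=> l s; rewrite ltnS leq_eqVlt => /orP[/eqP->|hli]; first exact: g3.
  by move=> q1; apply: g4; apply: hl q1.
have hC : cost = 42 * k.+2 + 30 by [].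
apply: wp_seq; apply/wpcP; wpexp; rewrite ei hm7 -/e; wsolve.
apply: wp_seq; apply: wp_if; wpexp; rewrite ?h5 ?h6'.
- wsolve; case: (bots _ _ _); case: (tops _ _ _); lia.
  2: {
move=> hz; apply/wpcP; wpexp; apply/wpcP; wpexp; rewrite ?ei; wsolve.
  apply: hfin => //; try by lia.
  move=> s /(stripE hK)[/andP[q1 q2] _]; move: hz; rewrite q1 (negbTE q2).
  by [].
  }
move=> hz.
have hend : endc K c.+1 e.
  by move: hz; rewrite /endc; case: (bots _ _ _); case: (tops _ _ _).
have [s hp hst] := end_prv hK hend.
have [k1 k2 k3 k4] := strip_bounds hK hst.
apply: wp_seq; apply/wpcP; wpexp; wsolve.
apply: wp_seq; apply: (@pred_call (startc K c.+1) _ _ _ e) => //; try lia.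
  exact: start_bounded.
move=> v2 t2 a1 h32 ht2; rewrite hp in h32.
have g5 : v2 5 = i := etrans (a1 5 isT) ei.
have g6 : v2 6 = c.+1 := etrans (a1 6 isT) h6.
have g8 : v2 8 = m := etrans (a1 8 isT) h8.
have g11 : v2 11 = e := a1 11 isT.
clear a1 hr.
have hb10 : m1 10 s <= n.+1.
  case: (m1 10 s =P 0) => [->//|/eqP/h10 h]; by have [] := strip_bounds hK h.
apply: wp_seq; apply/wpcP; wpexp; rewrite h32; wsolve.
rewrite subn1 /=.
apply: wp_if; wpexp; rewrite ?g11 ?g6 ?g5; wsolve.
- move=> hz2; apply/wpcP; wpexp; rewrite ?g11 ?g6; wsolve; apply/wpcP; wpexp; rewrite ?g5; wsolve.
  have e10 : m1 10 s = 0 by move: hz2; case: eqP.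
  have eE : E s = 0.
    by have := h11 s; case: (E s =P 0) => // _ [<-].
  apply: hfin => //; try by lia.
  - by move=> s' /=; case: (s' =P s) => [-> _|_] //; exact: h10.
  - move=> s' /=; case: (s' =P s) => [->|_]; last exact: h11.
    by rewrite eE eqxx.
  - move=> s' hs'; have [_ ps] := proj1 (stripE hK _ _ _) hs'.
    by move: ps; rewrite hp => -[->] /=; rewrite eqxx; lia.
  - by move=> s' h0 /=; case: (s' =P s) => // _; lia.
move=> hz2; apply/wpcP; wpexp; apply/wpcP; wpexp; rewrite ?g5; wsolve.
apply: hfin => //; try by lia.
move=> s' hs'; have [_ ps] := proj1 (stripE hK _ _ _) hs'.
by move: ps hz2; rewrite hp => -[->]; case: eqP.
Qed.

Definition chains (o : st) : Prop :=
  forall c, chain (ar o) (2 * size K + 1) (ar o 1 c) (evs c).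

Definition swept c (o : st) : Prop :=
  [/\ env k o /\ veb k (ar o) (startc K c),
      forall x, [/\ ar o 5 x = tops K c x, ar o 6 x = bots K c x &
                    ar o 9 x = startc K c x],
      ends_ok K c (ar o 10) /\ starts_ok K c (ar o 11),
      exists R, [/\ out_ok K c R, vr o 9 = size R & written (ar o 0) R]
    & vr o 6 = c.+1 /\ chains o].

Lemma chains_frame o o' : (forall a, a \in [:: 1; 2; 3; 4] -> ar o' a = ar o a) ->
  chains o -> chains o'.
Proof.
move=> e h c; rewrite (e 1 isT); apply: chain_frame (h c) (leqnn _) _.
by move=> j _; rewrite (e 2 isT) (e 3 isT) (e 4 isT).
Qed.

(** Two rows per event give 2 iterations each to [query], [update] and [flush], and 4 to [create];
    the 9 ticks of [collect] fit into an eleventh [cost]. *)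
Lemma column_ok c o : c <= n -> swept c o ->
  wp bd lim sweep_column (fun o' => swept c.+1 o' /\
    tm o' <= tm o + 11 * (size (evs c.+1) * cost) + 12) o.
Proof.
move=> hcn [[henv hv] hS [hE hF] [R [hR h9 hW]] [h6 hch]].
set z := size (evs c.+1); have hz : z <= 2 * size K := size_evs c.+1.
have tb := @touched_bound n M K hK c.+1.
apply: wp_seq; apply: wp_consequence (collect_ok h6 hcn (hch c.+1) _ _) _.
- by move=> x; case: (hS x).
- by move=> x; case: (hS x).
rewrite -/z => o1 [h8 hX hT hB ht1] [a1 b1].
have henv1 : env k o1 := env_frame (a1 2 isT) (a1 4 isT) (b1 14 isT) henv.
have hv1 : veb k (ar o1) (startc K c) := veb_frame (b1 12 isT) (b1 13 isT) hv.
have hE1 : ends_ok K c (ar o1 10) by rewrite (b1 10 isT).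
have hXb j : j < 2 * z -> 1 <= ar o1 7 j <= n.+1.
  by move=> hj; apply: tb; apply: (proj1 hX).
apply: wp_seq; apply: wp_consequence (query_ok henv1 hv1 h8 _ hXb hE1) _.
  by lia.
move=> o2 [hX2 hOL hq ht2] [a2 b2].
have henv2 : env k o2 := env_frame (a2 2 isT) (a2 4 isT) (b2 14 isT) henv1.
have hv2 : veb k (ar o2) (startc K c) := veb_frame (b2 12 isT) (b2 13 isT) hv1.
have h82 : vr o2 8 = 2 * z := etrans (a2 8 isT) h8.
have hXt : touched_list c.+1 (2 * z) (ar o2 7).
  split=> [j hj|x /(proj2 hX)[j hj e]]; first by rewrite hX2 //; apply: (proj1 hX).
  by exists j => //; rewrite hX2.
apply: wp_seq; apply: wp_consequence (update_ok henv2 hv2 h82 _ hXt _ _ _) _.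
- by lia.
- by move=> x; rewrite (b2 5 isT).
- by move=> x; rewrite (b2 6 isT).
- by move=> x; rewrite (b2 9 isT) (b1 9 isT); case: (hS x).
move=> o3 [hv3 hIN ht3] [a3 b3].
have henv3 : env k o3 := env_frame (a3 2 isT) (a3 4 isT) (b3 14 isT) henv2.
have h83 : vr o3 8 = 2 * z := etrans (a3 8 isT) h82.
have h63 : vr o3 6 = c.+1.
  by rewrite (a3 6 isT) (a2 6 isT) (a1 6 isT).
have hT3 x : ar o3 5 x = tops K c.+1 x by rewrite (b3 5 isT) (b2 5 isT).
have hB3 x : ar o3 6 x = bots K c.+1 x by rewrite (b3 6 isT) (b2 6 isT).
apply: wp_seq.
apply: wp_consequence (@flush_ok c o3 (2 * z) R henv3 hv3 h83 h63 _ hcn hT3 hB3 _ _ _ _ hR _ _) _.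
- by lia.
- move=> j hj; rewrite (b3 8 isT); case: (hOL j hj) => [[-> _] //|hs].
  by have [] := strip_bounds hK hs; lia.
- move=> s e hs hn; have [x /(proj2 hX)[j hj ej] hx] := strip_lost hK hs hn.
  by exists j => //; rewrite (b3 8 isT); apply: (proj1 (hq j s e hj hs _)); rewrite ej.
- by rewrite (b3 10 isT) (b2 10 isT).
- by rewrite (b3 11 isT) (b2 11 isT) (b1 11 isT).
- by rewrite (a3 9 isT) (a2 9 isT) (a1 9 isT).
- by rewrite (b3 0 isT) (b2 0 isT) (b1 0 isT).
move=> o4 [[R' [hR' h94 hW4]] hkept ht4] [a4 b4].
have henv4 : env k o4 := env_frame (a4 2 isT) (a4 4 isT) (b4 14 isT) henv3.
have hv4 : veb k (ar o4) (startc K c.+1) := veb_frame (b4 12 isT) (b4 13 isT) hv3.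
have h84 : vr o4 8 = 2 * z := etrans (a4 8 isT) h83.
have h64 : vr o4 6 = c.+1 := etrans (a4 6 isT) h63.
have hT4 x : ar o4 5 x = tops K c.+1 x by rewrite (b4 5 isT).
have hB4 x : ar o4 6 x = bots K c.+1 x by rewrite (b4 6 isT).
have e7 j : ar o4 7 j = ar o2 7 j by rewrite (b4 7 isT) (b3 7 isT).
apply: wp_seq.
apply: wp_consequence (@create_ok c o4 (2 * z) henv4 hv4 h84 h64 _ hcn hT4 hB4 _ _ hkept _) _.
- by lia.
- move=> j hj; rewrite e7; case: (ltnP j (2 * z)) => hj2.
    by rewrite hX2 //; have /andP[] := hXb j hj2.
  have [hj3 ej] : j - 2 * z < 2 * z /\ j = 2 * z + (j - 2 * z) by lia.
  rewrite ej; case: (hOL _ hj3) => [[_ ->] //|hs].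
  by have [] := strip_bounds hK hs.
- move=> s e hs hn; case: (strip_new hK hs hn) => [/(proj2 hXt)[j hj ej]|].
    by exists j; [lia | rewrite e7].
  move=> [a' [x [hs' /(proj2 hX)[j hj ej] hx]]]; exists (2 * z + j); first by lia.
  by rewrite e7; apply: (proj2 (hq j a' e hj hs' _)); rewrite ej.
- by rewrite (b4 11 isT) (b3 11 isT) (b2 11 isT) (b1 11 isT).
move=> o5 [hE5 hF5 ht5] [a5 b5].
have henv5 : env k o5 := env_frame (a5 2 isT) (a5 4 isT) (b5 14 isT) henv4.
have hv5 : veb k (ar o5) (startc K c.+1) := veb_frame (b5 12 isT) (b5 13 isT) hv4.
have h65 : vr o5 6 = c.+1 := etrans (a5 6 isT) h64.
have hc30 : z * 30 <= z * cost by rewrite leq_mul2l /cost; lia.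
have ht : tm o5 <= tm o + 11 * (z * cost) + 11.
  have e1 : 2 * z * cost = 2 * (z * cost) by rewrite mulnA.
  have e2 : 2 * (2 * z) * cost = 4 * (z * cost) by rewrite !mulnA.
  by rewrite e2 e1 in ht5 ht4 ht3 ht2 *; lia.
have hch5 : chains o5.
  apply: chains_frame hch => a ha.
  by move: ha; rewrite !inE => /or4P[] /eqP->;
    rewrite ?(b5 1 isT) ?(b5 2 isT) ?(b5 3 isT) ?(b5 4 isT)
            ?(b4 1 isT) ?(b4 2 isT) ?(b4 3 isT) ?(b4 4 isT)
            ?(b3 1 isT) ?(b3 2 isT) ?(b3 3 isT) ?(b3 4 isT)
            ?(b2 1 isT) ?(b2 2 isT) ?(b2 3 isT) ?(b2 4 isT)
            ?(b1 1 isT) ?(b1 2 isT) ?(b1 3 isT) ?(b1 4 isT).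
have hT5 x : ar o5 5 x = tops K c.+1 x by rewrite (b5 5 isT).
have hB5 x : ar o5 6 x = bots K c.+1 x by rewrite (b5 6 isT).
have hI5 x : ar o5 9 x = startc K c.+1 x by rewrite (b5 9 isT) (b4 9 isT).
have h95 : vr o5 9 = size R' by rewrite (a5 9 isT).
have hW5 : written (ar o5 0) R' by rewrite (b5 0 isT).
case: o5 {a5 b5} henv5 hv5 h65 ht hch5 hT5 hB5 hI5 h95 hW5 hE5 hF5 {ht5}.
move=> v5 m5 t5 henv5 hv5 h65 ht hch5 hT5 hB5 hI5 h95 hW5 hE5 hF5.
change (v5 6 = c.+1) in h65.
apply/wpcP; wpexp; rewrite h65; split; first by wsolve.
split; last first.
  change (is_true (t5 <= tm o + 11 * (z * cost) + 11)) in ht.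
  change (is_true (t5 < tm o + 11 * (z * cost) + 12)).
  by rewrite (leq_ltn_trans ht) // ltn_add2l.
split=> //; first by move=> x; split; [exact: hT5 | exact: hB5 | exact: hI5].
  by exists R'.
by split=> //; rewrite -[c.+2]addn1.
Qed.

Lemma cont_empty S d id : S =1 pred0 -> cont (qd k) (ud k) S d id =1 pred0.
Proof.
move=> hS; elim: d id => [|d IH] id y /=; first by case: eqP.
have h0 z : inner (ud k d) (cont (qd k) (ud k) S d (id %/ (qd k d).+1)) z = false.
  by rewrite /inner IH.
by case: (id %% _) => [|h] /=; [apply/hasP=> -[l _]; rewrite h0 | rewrite /cluster h0 andbF].
Qed.

Lemma veb_empty A S : S =1 pred0 -> (forall x, A 12 x = 0) ->
  (forall x, A 13 x = 0) -> veb k A S.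
Proof.
move=> hS h12 h13 d id _; rewrite /Vof h12 h13 /nodeval.
rewrite (eq_fst1 _ (cont_empty d id hS)) (eq_prv _ (cont_empty d id hS)).
by congr (_, _); [case: fstP | case: prvP].
Qed.

(** The factor 22 is 11 for each of the two events of a slab; 13 is the fixed time of a column
    together with its test. *)
Lemma sweep_ok o : env k o -> vr o 0 = n -> vr o 1 = size K ->
  stores (ar o 0) (encode_input n K) ->
  (forall a x, 0 < a -> a != 14 -> ar o a x = 0) ->
  wp bd lim sweep (fun o' => exists R : seq slab,
    [/\ uniq R, (forall r, r \in R <-> canon K r),
        stores (ar o' 0) (encode_output R)
      & tm o' <= tm o + 22 * (size K * cost) + 17 * size K + 13 * n + 30]) o.
Proof.
case: o => v0 m0 t0 /= henv h0 h1 hin hz.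
apply: wp_seq; apply: wp_consequence (@load_events_ok (St v0 m0 t0) h1 hin _) _.
  by move=> c; apply: hz.
move=> o1 [hch ht1] [a1 b1].
have henv1 : env k o1 := env_frame (a1 2 isT) (a1 4 isT) (b1 14 isT) henv.
have h01 : vr o1 0 = n := etrans (a1 0 isT) h0.
have hz1 a x : a \in [:: 5; 6; 9; 10; 11; 12; 13] -> ar o1 a x = 0.
  move=> ha; rewrite b1; last by move: a ha; apply/allP.
  by apply: hz; move: a ha; apply/allP.
clear a1 b1 henv hin hz.
case: o1 h01 hz1 henv1 hch ht1 => v m t /= h01 hz1 henv1 hch ht1.
apply: wp_seq; apply/wpcP; wpexp; split; first by lia.
apply: wp_seq; apply/wpcP; wpexp; split; first by lia.
set o2 := St _ _ _.
pose I j o' := exists c, [/\ j = n.+1 - c, c <= n.+1, swept c o' &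
  tm o' <= t + 2 + 11 * (evcount (rev K) c.+1 * cost) + 13 * c].
have hI : I n.+1 o2.
  (* Column 0 meets no slab, so arrays that read as zero, the empty tree among them, describe it
     already. *)
  exists 0; split=> //; try by rewrite /o2 /=; lia.
  split=> //.
  - split=> //; apply: veb_empty => x.
    + by rewrite /startc (tops0 hK).
    + by apply: hz1.
    + by apply: hz1.
  - by move=> x; rewrite /startc /= !hz1 // (tops0 hK) (bots0 hK).
  - split; last by move=> s e /(no_strip0 hK).
    by split=> [s e /(no_strip0 hK) //|s]; rewrite /o2 /= hz1.
  - exists [::]; split=> //; split=> // r; split=> // -[_]; by [].
apply: wp_seq; apply: (wp_while hI) => j o3 [c [hj hc hsw ht]] [a3 b3].
have h03 : vr o3 0 = n := etrans (a3 0 isT) h01.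
case: (hsw) => _ _ _ [R [hR h9 hW]] [h6 _].
case: o3 hsw ht h03 h9 hW h6 {a3 b3} => v3 m3 t3 hsw ht h03 h9 hW h6.
change (v3 0 = n) in h03; change (v3 6 = c.+1) in h6; change (v3 9 = size R) in h9.
change (is_true (t3 <= t + 2 + 11 * (evcount (rev K) c.+1 * cost) + 13 * c)) in ht.
wpexp; rewrite h03 h6; split; first by wsolve.
case: ltnP => hlt /=.
  have hcn : c <= n by lia.
  apply: wp_consequence (@column_ok c (St v3 m3 t3.+1) hcn hsw) _.
  move=> o4 [hsw4 ht4] _; exists (n.+1 - c.+1); first by lia.
  exists c.+1; split=> //.
  change (is_true (tm o4 <= t3.+1 + 11 * (size (evs c.+1) * cost) + 12)) in ht4.
  by rewrite evcountS mulnDl -/(evs c.+1); lia.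
have ec : c = n.+1 by lia.
rewrite {c hj hc hsw h6 hlt}ec in ht hR.
have hR2 r : r \in R <-> canon K r.
  rewrite (proj2 hR); split=> [[]//|h]; split=> //.
  by have [_ _ _] := canon_bounds hK h.
have hsz : size R <= n.+1 ^ 4.
  exact (canon_size hK (proj1 hR) (fun r h => proj1 (hR2 r) h)).
apply/wpcP; wpexp; rewrite h9; wsolve.
exists R; split=> //; first by case: hR.
  move=> [|l] //=; rewrite ltnS size_encode_slabs => hl.
  exact: hW.
rewrite (evcount_total hK) in ht.
have : (size K).*2 * cost = 2 * (size K * cost) by rewrite -mul2n mulnA.
by lia.
Qed.

End Main.

(** * Running time and word size *)

(** In other words, [width k d] is the quotient of [pw k - 1] by [pw (k - d) - 1]. It telescopes
    because [a * a - 1 = (a - 1) * (a + 1)] and a node has [a + 1] children. *)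
Lemma width_sum k d : d <= k ->
  width k d * pw (k - d) + 1 = pw k + width k d.
Proof.
elim: d => [|d IH] hd /=; first by rewrite subn0 mul1n.
have := IH (ltnW hd); have -> : k - d = (k - d.+1).+1 by lia.
rewrite pwS /qd (_ : k - 1 - d = k - d.+1); last by lia.
move: (pw (k - d.+1)) (width k d) (pw k) => a w p.
rewrite mulnS mulnDl mulnA; lia.
Qed.

(** Up to depth [k] the width is below [pw k]; the last level multiplies it by [qd k + 1 = 3]. *)
Lemma width_le k d : d <= k.+1 -> width k d <= 3 * pw k.
Proof.
have h e : e <= k -> width k e <= pw k.
  move=> he; have := width_sum he; have := pw_gt1 (k - e).
  move: (pw (k - e)) => a ha.
  have : width k e * 2 <= width k e * a by rewrite leq_mul2l ha orbT.
  by lia.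
rewrite leq_eqVlt ltnS => /orP[/eqP-> /=|/h]; last by lia.
rewrite /qd (_ : k - 1 - k = 0); last by lia.
by have := h k (leqnn k); rewrite /pw; lia.
Qed.

Definition time_bound (x k n : nat) : nat :=
  22 * (x * cost k) + 17 * x + 13 * n + 4 * k + 40.

(** A common crude bound for clock, indices and values: at most [n.+1 ^ 4] slabs, each with time
    linear in [k], and [k <= n.+1]. *)
Definition word_bound (n : nat) : nat := 64 * (64 * n.+1 ^ 5).

Section Decompose.
Variables (n : nat) (M : 'M[bool]_n) (K : seq slab).
Hypotheses (hK : slab_decomposition M K) (n_gt0 : 0 < n).

Lemma decomposition_size : size K <= n.+1 ^ 4.
Proof.
apply: uniq_slabs_size; first by case: hK.
by move=> s /(slab_bounds hK)[? ? ? ? ?]; split; lia.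
Qed.

(** Naming the cube turns the powers into products that linear arithmetic can compare. *)
Lemma word_bound_powers : exists x, [/\ n.+1 ^ 4 = n.+1 * x,
  n.+1 ^ 5 = n.+1 * (n.+1 * x), 4 * n.+1 <= x * 1 & n.+1 * n.+1 * n.+1 = x].
Proof.
exists (n.+1 * n.+1 * n.+1); rewrite !expnS expn0 muln1 !mulnA; split=> //.
by rewrite muln1 leq_pmul2r // (@leq_mul 2 2).
Qed.

(** The previous level was too small, [2 ^ (2 ^ k.-1) <= n.+1]. Two logarithms, each rounded by at
    most one, leave [k.-1 <= loglog n + 1]. *)
Lemma levels_bounds k : 0 < k -> pw k.-1 < n + 2 ->
  [/\ k <= n.+1, pw k <= n.+1 * n.+1 & k <= loglog n + 2].
Proof.
case: k => // k _; rewrite addn2 ltnS => /= hk.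
have k1 : k < pw k.
  by apply: ltn_trans (ltn_expl _ (isT : 1 < 2)) _; rewrite ltn_exp2l // ltn_expl.
split; first by lia.
  by rewrite pwS; apply: leq_mul.
have h1 : n.+1 <= 2 ^ (trunc_log 2 n).+1 by apply: trunc_log_ltn.
have h2 : 2 ^ k <= (trunc_log 2 n).+1.
  by rewrite -(@leq_exp2l 2) //; apply: leq_trans hk h1.
have h3 : (trunc_log 2 n).+1 <= 2 ^ (loglog n).+1 by apply: trunc_log_ltn.
have : k <= (loglog n).+1 by rewrite -(@leq_exp2l 2) //; apply: leq_trans h2 h3.
by lia.
Qed.

Lemma decompose_ok o : tm o = 0 -> stores (ar o 0) (encode_input n K) ->
  (forall a x, ar o a.+1 x = 0) ->
  wp (word_bound n) (out_limit n) decompose (fun o' =>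
    tm o' <= word_bound n /\
    exists k (R : seq slab), [/\ k <= n.+1, k <= loglog n + 2,
      tm o' <= time_bound (size K) k n,
      uniq R /\ (forall r, r \in R <-> canon K r)
    & stores (ar o' 0) (encode_output R)]) o.
Proof.
case: o => v m t /= -> hin hz.
have hKs := decomposition_size.
have [x [x4 x5 hx ex]] := word_bound_powers.
have m0 : m 0 0 = n := hin 0 isT.
have m1 : m 0 1 = size K := hin 1 isT.
have n4 : n.+1 * n.+1 * 4 <= n.+1 * x by rewrite -mulnA leq_mul2l mulnC; lia.
have n5 : 2 * (n.+1 * x) <= n.+1 * (n.+1 * x) by rewrite leq_mul2r; lia.
have hbd : word_bound n = 64 * (64 * (n.+1 * (n.+1 * x))) by rewrite /word_bound x5.
have hlim : out_limit n = 4 * (n.+1 * x) + 2 by rewrite /out_limit x4.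
have nsq : (n + 2) * (n + 2) <= 4 * (n.+1 * n.+1) by nia.
rewrite x4 in hKs.
apply: wp_seq; apply/wpcP; wpexp; rewrite m0; wsolve; try lia.
apply: wp_seq; apply/wpcP; wpexp; rewrite m1; wsolve; try lia.
set o1 := St _ _ _.
have q1 : (n + 2) * (n + 2) + 10 <= word_bound n by rewrite hbd; lia.
apply: wp_seq.
apply: wp_consequence (@init_levels_ok (word_bound n) (out_limit n) n o1 erefl q1 n_gt0) _.
move=> o2 [k [k2 k4 hPW [k0 /andP[hlo hhi]] ht2]] [a2 b2].
have [hk hpk hkl] := levels_bounds k0 hlo.
have hw d : d <= k.+1 -> width k d * k.+2 + k + 4 + pw k < word_bound n.
  move=> /width_le hwd.
  have : width k d * k.+2 <= 3 * pw k * k.+2 by rewrite leq_mul2r hwd orbT.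
  have : pw k * k.+2 <= n.+1 * n.+1 * (n.+1 + 2) by apply: leq_mul; lia.
  rewrite hbd mulnDr ex; lia.
have q2 : 20 * size K + 20 * n + 100 <= word_bound n by rewrite hbd; lia.
have q3 : out_limit n <= word_bound n by rewrite hbd hlim; lia.
have q4 : 4 * size K + 2 <= out_limit n by rewrite hlim; lia.
have q5 : 4 * n.+1 ^ 4 + 2 <= out_limit n by [].
have henv : env k o2 by [].
have h0 : vr o2 0 = n := a2 0 isT.
have h1 : vr o2 1 = size K := a2 1 isT.
have hin2 : stores (ar o2 0) (encode_input n K) by rewrite (b2 0 isT).
have hz2 a y : 0 < a -> a != 14 -> ar o2 a y = 0.
  case: a => // a _ ha; rewrite b2 ?hz //.
  by rewrite inE ha.
apply: wp_consequence (sweep_ok hK n_gt0 k0 hhi hw q2 q3 q4 q5 henv h0 h1 hin2 hz2) _.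
move=> o3 [R [uR hR hS ht3]] _.
have ht : tm o3 <= time_bound (size K) k n.
  by rewrite /time_bound; change (tm o1) with 2 in ht2; lia.
split; last by exists k, R.
apply: leq_trans ht _; rewrite /time_bound /cost hbd.
have : size K * (42 * k.+2 + 30) <= (n.+1 * x) * (42 * (n.+1 + 2) + 30).
  by apply: leq_mul => //; lia.
move: (size K * _) (n.+1 * x) n4 n5 hKs => A B n4 n5 hKs.
rewrite mulnDr (mulnCA B) mulnDr (mulnC B n.+1).
lia.
Qed.

(** If [loglog n] is 0, then [n < 4] and there are at most 256 slabs, paid for by the summand [n]:
    hence the factor 256. Otherwise [cost k] is at most [240 * loglog n], where 240 is 42 + 168 +
    30. *)
Lemma time_bound_linear k : k <= n.+1 -> k <= loglog n + 2 ->
  (time_bound (size K) k n).+1 <= 256 * 4500 * (n + size K * loglog n).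
Proof.
have hKs := decomposition_size.
move=> hk hkl; rewrite /time_bound /cost.
case: (posnP (loglog n)) => hl.
  have h1 : trunc_log 2 n < 2 ^ 1.
    by have := trunc_log_ltn (trunc_log 2 n) (isT : 1 < 2); rewrite -/(loglog n) hl.
  have h2 : n < 4.
    apply: leq_trans (trunc_log_ltn n (isT : 1 < 2)) _.
    by rewrite (_ : 4 = 2 ^ 2) // leq_exp2l.
  have h3 : size K <= 256.
    by apply: leq_trans hKs _; rewrite (_ : 256 = 4 ^ 4) // leq_exp2r.
  rewrite hl muln0 addn0; rewrite hl in hkl.
  have : size K * (42 * k.+2 + 30) <= 256 * (42 * 4 + 30) by apply: leq_mul; lia.
  by lia.
have : size K * (42 * k.+2 + 30) <= size K * (240 * loglog n).
  by rewrite leq_mul2l; apply/orP; right; lia.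
rewrite mulnCA.
have : size K <= size K * loglog n by rewrite leq_pmulr.
by lia.
Qed.
End Decompose.

(** Here 23 is 18 + 5: the constants fit into [64 ^ 3 = 2 ^ 18] and the fifth power of [n.+1] into
    [2 ^ (5 * L)]; since [L >= 1], the 18 may be multiplied by [L]. *)
Lemma word_bound_log n : 0 < n ->
  out_limit n + 48 * word_bound n + 51 <= 2 ^ (23 * (trunc_log 2 n).+1).
Proof.
move=> n0; have hn : n.+1 <= 2 ^ (trunc_log 2 n).+1 by apply: trunc_log_ltn.
set L := (trunc_log 2 n).+1 in hn *.
have h5 : n.+1 ^ 5 <= 2 ^ (5 * L) by rewrite mulnC expnM leq_exp2r.
have h18 a : a = 2 ^ 6 -> a * (a * a) * 2 ^ (5 * L) <= 2 ^ (23 * L).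
  by move=> ->; rewrite -!expnD leq_exp2l //; rewrite /L; lia.
apply: leq_trans (h18 64 erefl).
apply: leq_trans (_ : 64 * (64 * 64) * n.+1 ^ 5 <= _); last first.
  by rewrite leq_mul2l h5 orbT.
have h4 : n.+1 ^ 4 * 2 <= n.+1 ^ 5 by rewrite [in X in _ <= X]expnSr leq_mul2l ltnS n0 orbT.
have : 2 ^ 4 <= n.+1 ^ 4 by rewrite leq_exp2r.
rewrite (_ : 2 ^ 4 = 16) // /out_limit /word_bound.
move: (n.+1 ^ 4) (n.+1 ^ 5) h4 => a b; lia.
Qed.

Theorem theorem3 :
  exists (Decompose : program) (C D : nat),
  forall (n : nat) (M : 'M[bool]_n) (K : seq slab) (w : nat) (s : state),
    1 <= n ->
    slab_decomposition M K ->
    D * (trunc_log 2 n).+1 <= w ->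
    initial w (encode_input n K) s ->
    exists (R : seq slab) (t : nat) (s' : state),
      [/\ halts_in w Decompose t s s',
          t <= C * (n + size K * loglog n),
          canonical_slab_decomposition M R
        & stores (st_mem s') (encode_output R)].
Proof.
exists (compile decompose), (size (compile decompose) * (256 * 4500)), 23.
move=> n M K w s n0 hK hw hs.
have hb : out_limit n + 48 * word_bound n + 51 <= 2 ^ w.
  by apply: leq_trans (word_bound_log n0) _; rewrite leq_exp2l.
have hin : stores (st_mem s) (encode_input n K) by case: hs.
have [|o [t [s' [h1 h2 h3 h4]]]] := compile_correct (Q := fun o =>
    exists k (R : seq slab), [/\ k <= n.+1, k <= loglog n + 2,
      tm o <= time_bound (size K) k n,
      uniq R /\ (forall r, r \in R <-> canon K r)
    & stores (ar o 0) (encode_output R)]) (c := decompose) hb hs.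
  move=> o ht e0 hz; apply: (decompose_ok hK n0 ht) => //.
  by rewrite e0.
case: h2 => k [R [k1 k2 ht [uR hR] hS]]; exists R, t, s'; split=> //.
- apply: leq_trans h3 _; rewrite -mulnA leq_mul2l; apply/orP; right.
  apply: leq_trans (time_bound_linear hK n0 k1 k2); by rewrite ltnS.
- by split=> // r; rewrite hR; split=> /(canonP hK).
move=> l hl; rewrite h4; first exact: hS.
(* The whole output lies below [out_limit n], where machine memory and array 0 agree. *)
have : size R <= n.+1 ^ 4 by exact (canon_size hK uR (fun r h => proj1 (hR r) h)).
by move: hl; rewrite /= size_encode_slabs /out_limit; lia.
Qed.
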